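(* Let $f : S \to S$ be a $C^{1}$ map of the $2$-sphere $S$ that preserves the latitude foliation and has global degree $2$. For $n\ge 1$ let $N_{n}$ be the number of fixed points of the $n$-th iterate $f^{n}$. Then $$\limsup_{n \to \infty} \frac{1}{n} \ln (N_{n}) \geq \ln(2).$$
   Context: $S$ is the round $2$-sphere in $\mathbb{R}^3$ of diameter $1$ resting on the $xy$-plane with center $(0,0,1/2)$, with its standard orientation. The height of a point of $S$ is its $z$-coordinate $h\in[0,1]$; the Southpole has height $0$ and the Northpole has height $1$. For $0<h<1$, the latitude $L(h)$ is the circle of points of $S$ of height $h$. A continuous map $f:S\to S$ preserves the latitude foliation if it carries each latitude into a latitude (possibly the same one, and not necessarily homeomorphically) or to one of the poles. The global degree of $f$ is the integer $d$ such that $f_*:H_2(S)\to H_2(S)$ is multiplication by $d$. Fixed points are counted as geometrically distinct points (without multiplicity); if $f^n$ has infinitely many fixed points then $N_n=\infty$ and $\ln N_n=\infty$. *)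

(* Defs.v *)
From HB Require Import structures.
From mathcomp Require Import all_boot all_order all_algebra.
From mathcomp Require Import all_classical all_reals all_analysis.
From mathcomp Require Import freeg.
Import Order.TTheory GRing.Theory Num.Theory.
Import numFieldTopology.Exports numFieldNormedType.Exports.

Set Implicit Arguments.
Unset Strict Implicit.
Unset Printing Implicit Defensive.

Local Open Scope classical_set_scope.
Local Open Scope ring_scope.

Section SingularChains.
Variable R : realType.

Definition simplex n : set 'rV[R]_n.+1 :=
  [set t | (forall i, 0 <= t 0 i) /\ \sum_i t 0 i = 1].
Arguments simplex : clear implicits.

Definition face_fun n (i : 'I_n.+2) (t : 'rV[R]_n.+1) : 'rV[R]_n.+2 :=
  \row_j (if unlift i j is Some k then t 0 k else 0).

Lemma face_subproof n (i : 'I_n.+2) (t : set_type (simplex n)) :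
  face_fun i (set_val t) \in simplex n.+1.
Proof.
have [t_ge0 sum_t] : simplex n (set_val t) by exact: set_valP.
apply/mem_set; split=> [j|].
  by rewrite mxE; case: unliftP => [k _|_] //.
rewrite (bigD1_ord i)//= mxE unlift_none add0r -[RHS]sum_t.
by apply: eq_bigr => k _; rewrite mxE liftK.
Qed.

(** The i-th face of the standard simplex: the affine inclusion onto the facet
    opposite to the i-th vertex. *)
Definition face n (i : 'I_n.+2) (t : set_type (simplex n)) :
  set_type (simplex n.+1) := exist _ (face_fun i (set_val t)) (face_subproof i t).

Lemma continuous_face_fun n (i : 'I_n.+2) : continuous (@face_fun n i).
Proof.
move=> t P [Q nQ QP].
have : \forall u \near t, forall a b, Q a b (face_fun i u a b).
  apply: (@filter_forall _ _ _ _ (nbhs_filter t)) => a.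
  apply: (@filter_forall _ _ _ _ (nbhs_filter t)) => b.
  have := nQ a b; rewrite !mxE; case E: (unlift i b) => [k|] nQt.
    have := @coord_continuous R 1 n.+1 0 k t _ nQt.
    by apply: (@filterS _ _ (nbhs_filter t)) => u Qu; rewrite mxE E.
  by apply: (@nearW _ _ _ (nbhs_filter t)) => u; rewrite mxE E; apply: nbhs_singleton nQt.
by apply: (@filterS _ _ (nbhs_filter t)) => u Qu; exact: QP.
Qed.

Lemma continuous_face n (i : 'I_n.+2) : continuous (@face n i).
Proof.
apply: continuous_comp_initial => t.
apply: (@continuous_comp _ _ _ set_val (@face_fun n i)).
  exact: initial_continuous.
exact: continuous_face_fun.
Qed.

HB.instance Definition _ n (i : 'I_n.+2) :=
  isContinuous.Build _ _ (@face n i) (@continuous_face n i).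

Definition singular_simplex n (X : topologicalType) : choiceType :=
  continuousType (set_type (simplex n)) X.

Definition chain n (X : topologicalType) : lmodType int :=
  {freeg (singular_simplex n X) / int}.

Definition boundary n (X : topologicalType) : chain n.+1 X -> chain n X :=
  fglift (fun s : singular_simplex n.+1 X =>
    \sum_(i < n.+2)
      (-1) ^+ i *: (<< (s \o @face n i : singular_simplex n X) >> : chain n X)).

Definition pushforward n (X Y : topologicalType) (f : continuousType X Y) :
    chain n X -> chain n Y :=
  fglift (fun s : singular_simplex n X =>
    << (f \o s : singular_simplex n Y) >> : chain n Y).

Definition homologous n (X : topologicalType) (z w : chain n X) : Prop :=
  exists c : chain n.+1 X, boundary c = z - w.

End SingularChains.

(** [f_* : H_(n+1)(X) -> H_(n+1)(X)] is multiplication by [d], written out on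
    representatives. *)
Definition homology_mul (R : realType) n (X : topologicalType)
    (f : continuousType X X) (d : int) : Prop :=
  forall z : chain R n.+1 X,
    boundary z = 0 -> homologous (pushforward f z) (d *: z).

Section Sphere.
Variable R : realType.

Definition height (p : 'rV[R]_3) : R := p 0 ord_max.

Definition sphere : set 'rV[R]_3 :=
  [set p : 'rV[R]_3 | p 0 0 ^+ 2 + p 0 1 ^+ 2 + (height p - 2^-1) ^+ 2 = 2^-1 ^+ 2].

Lemma southpole_subproof : (0 : 'rV[R]_3) \in sphere.
Proof.
by apply/mem_set; rewrite /sphere/= /height !mxE expr0n/= !add0r sqrrN.
Qed.

Lemma northpole_subproof : (delta_mx 0 ord_max : 'rV[R]_3) \in sphere.
Proof.
apply/mem_set; rewrite /sphere/= /height !mxE/= expr0n/= !add0r.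
by rewrite {1}[1]splitr mul1r addrK.
Qed.

Definition southpole : set_type sphere :=
  exist (fun p => p \in sphere) 0 southpole_subproof.
Definition northpole : set_type sphere :=
  exist (fun p => p \in sphere) (delta_mx 0 ord_max) northpole_subproof.

Definition latitude (h : R) : set (set_type sphere) :=
  [set p | height (set_val p) = h].

Definition preserves_latitude_foliation
    (f : set_type sphere -> set_type sphere) : Prop :=
  forall h, 0 < h < 1 ->
    [\/ exists2 k, 0 < k < 1 & f @` latitude h `<=` latitude k,
        f @` latitude h = [set southpole]
      | f @` latitude h = [set northpole]].

(** A map between subsets of a Euclidean space is C^1 when it extends, locally
    around each point of its domain, to a C^1 map on an open subset of the ambient
    space. *)
Definition C1_sphere_map (f : set_type sphere -> set_type sphere) : Prop :=
  forall p : set_type sphere,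
    exists (U : set 'rV[R]_3) (F : 'rV[R]_3 -> 'rV[R]_3),
      [/\ open U, U (set_val p),
          (forall q, U q -> differentiable F q /\
                            {for q, continuous (jacobian F)})
        & forall x : set_type sphere,
            U (set_val x) -> F (set_val x) = set_val (f x)].

Definition global_degree
    (f : continuousType (set_type sphere) (set_type sphere)) (d : int) : Prop :=
  @homology_mul R 1 _ f d.

(** The value is [+oo] when there are infinitely many fixed points. *)
Definition nb_fixed_points (f : set_type sphere -> set_type sphere) (n : nat) :
    \bar R :=
  counting [set x | iter n f x = x].

End Sphere.

(* Main.v *)
(** The circle bundle S^3 -> S (Hopf) has a nontrivial Euler cocycle on singular
    2-simplices: lift a simplex to C^2 minus the origin and count how much the lift
    turns, along the boundary, relatively to lifts of the edges chosen once and for all.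
    Evaluated on the image of the fundamental cycle, it expresses the degree of a map
    preserving the latitudes through the induced height map g and the winding numbers
    of f on the latitudes: each lap of g (a maximal interval of heights sent by g onto
    ]0, 1[ from one pole to the other) contributes its winding number d if g is
    increasing across it and -d if g is decreasing, and the signs alternate.

    If the total is 2 there are three cases. If an increasing or a decreasing lap has
    |d| >= 2, then it contains a fixed point of g, so that f^n acts on a latitude with
    degree d^n and has at least |d^n - 1| fixed points there. An increasing lap might
    have its fixed points only at the poles, but f is C^1 there: if the latitudes near
    a fixed pole were not attracted to it, the differential would be a nonzero
    similarity, forcing d = 1 or d = -1. Otherwise there are a decreasing lap K with
    d <= 0 and an increasing lap J. For odd n, each of the 2^(n-1) words of length n in
    K and J with an odd number of K's is the itinerary of an interval reversed by g^n,
    hence of a latitude mapped by f^n to itself with a degree <= 0, and this circle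
    map has a fixed point. *)

Require Import Defs.
From HB Require Import structures.
From mathcomp Require Import all_boot all_order all_algebra.
From mathcomp Require Import all_classical all_reals all_analysis.
From mathcomp Require Import freeg zify ring lra complex.
Import Order.TTheory GRing.Theory Num.Theory.
Import numFieldTopology.Exports numFieldNormedType.Exports.

Set Implicit Arguments.
Unset Strict Implicit.
Unset Printing Implicit Defensive.

Local Open Scope classical_set_scope.
Local Open Scope ring_scope.

(** * Maps from compact contractible spaces and their arguments *)

(** The degree is given through singular homology. What reads it off a map is a real-valued function
    of 2-chains that vanishes on boundaries, together with one cycle on which it is nonzero; the
    identity map calibrates its value. To evaluate it on the image of that cycle, a lift over the
    square of angles and heights is compared with the two coordinates of $\mathbb{C}^2$, each of
    which vanishes on the fibre over one pole only. This gives two functions of the height, one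
    locally constant while [g] avoids 0, the other while [g] avoids 1, whose difference is the
    winding number on the latitude. The winding number itself exists only where [0 < g < 1], and [g]
    may oscillate between visits to the poles; bounding the two functions along the heights replaces
    a sum over laps. In the last case the parity of the number of K's does double duty: it makes the
    itinerary reverse an interval and, as n is odd, leaves an even number of J's, so that the
    product of the degrees is nonpositive whatever the sign of the degree of J. Hence only odd n are
    used, which a limsup allows. *)

Section Contractible.
Variable R : realType.

(** The contraction is parametrized by the whole line instead of $[0,1]$, so that the connectedness
    of [R] itself can be used; concrete contractions are frozen outside $[0,1]$ by [clamp]. *)
Definition compact_contractible (X : topologicalType) : Prop :=
  compact [set: X] /\
  exists c : R * X -> X, exists x0, [/\ continuous c, forall x, c (0, x) = x0
    & forall x, c (1, x) = x].

Lemma continuous_pairr (X Y : topologicalType) (x : X) : continuous (fun y : Y => (x, y)).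
Proof. by move=> y; apply: cvg_pair; [exact: cvg_cst|exact: cvg_id]. Qed.

(** Tube lemma: compactness of [X] makes the neighbourhood of [s] independent of [x]. *)
Lemma compact_slices_near (X : topologicalType) (M : pseudoMetricType R)
    (F : R * X -> M) (s e : R) : compact [set: X] -> continuous F -> 0 < e ->
  \forall s' \near s, forall x, ball (F (s, x)) e (F (s', x)).
Proof.
move=> /compact_near_coveringP cX cF e0.
have H : \forall s' \near s, [set: X] `<=` (fun x => ball (F (s, x)) e (F (s', x))).
  apply: (cX R (nbhs s) (fun s' x => ball (F (s, x)) e (F (s', x)))) => x _.
  have e20 : 0 < e / 2 by rewrite divr_gt0.
  have := cF (s, x) _ (nbhsx_ballx (F (s, x)) (e / 2) e20) .
  case=> -[A B] /= [nA nB] AB.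
  exists (B, A) => //= -[x' s'] [/= Bx' As'].
  rewrite [e]splitr; apply: (@ball_triangle _ _ (F (s, x))).
    by apply: ball_sym; apply: (AB (s, x')); split=> //=; exact: nbhs_singleton.
  by apply: (AB (s', x')).
by apply: (@filterS _ _ (nbhs_filter s) _ _ _ H) => s' h x; exact: h.
Qed.

(* The set of [s] for which [P] holds at the [s]-th stage of the contraction is
   clopen in [R]. *)
Lemma contractible_ind (X : topologicalType) (M : pseudoMetricType R) (A : set M)
    (P : (X -> M) -> Prop) (e : R) : compact_contractible X -> 0 < e ->
  (forall m, A m -> P (fun=> m)) ->
  (forall u v, continuous u -> continuous v -> (forall x, A (u x)) ->
     (forall x, A (v x)) -> (forall x, ball (u x) e (v x)) -> P u -> P v) ->
  forall u, continuous u -> (forall x, A (u x)) -> P u.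
Proof.
move=> [cX [c [x0 [cc c0 c1]]]] e0 Pcst Pstep u cu Au.
pose U s x := u (c (s, x)).
have cU s : continuous (U s).
  move=> x; apply: (@continuous_comp _ _ _ (fun x => c (s, x)) u); last exact: cu.
  by apply: (@continuous_comp _ _ _ (fun x => (s, x)) c); [exact: continuous_pairr|exact: cc].
have near s : \forall s' \near s, forall x, ball (U s x) e (U s' x).
  apply: (@compact_slices_near X M (fun p => u (c p))) => // p.
  by apply: continuous_comp; [exact: cc|exact: cu].
pose S := [set s : R | P (U s)].
have AU s x : A (U s x) by exact: Au.
have : S = setT.
  have /connected_intervalP cR : is_interval [set: R] by [].
  apply: cR.
  - by exists 0; rewrite /S/= /U; under eq_fun do rewrite c0; exact: Pcst.
  - exists S; rewrite ?setTI// openE => s Ss; rewrite /interior.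
    near=> s'; apply: (Pstep (U s)) => //; near: s'; exact: near.
  - exists S; rewrite ?setTI//; rewrite -[S]setCK; apply: open_closedC.
    rewrite openE => s Ss; rewrite /interior.
    near=> s' => Ss'; apply: Ss; apply: (Pstep (U s')) => //.
    by move=> x; apply: ball_sym; move: x; near: s'; exact: near.
move=> /(congr1 (fun B => B 1)) S1.
have : S 1 by rewrite S1.
by rewrite /S/= /U; under eq_fun do rewrite c1.
Unshelve. all: by end_near. Qed.

End Contractible.

(** * Continuity of real-valued functions, and a tactic for it *)

Section RealContinuity.
Variables (R : realType) (X : topologicalType).
Implicit Types f g : X -> R.

Lemma ctsD f g : continuous f -> continuous g -> continuous (fun x => f x + g x).
Proof. by move=> cf cg x; apply: continuousD; [exact: cf|exact: cg]. Qed.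

Lemma ctsN f : continuous f -> continuous (fun x => - f x).
Proof. by move=> cf x; apply: continuousN; exact: cf. Qed.

Lemma ctsM f g : continuous f -> continuous g -> continuous (fun x => f x * g x).
Proof. by move=> cf cg x; apply: continuousM; [exact: cf|exact: cg]. Qed.

Lemma ctsX f n : continuous f -> continuous (fun x => f x ^+ n).
Proof.
move=> cf; elim: n => [|n IH].
  by under eq_fun do rewrite expr0; exact: cst_continuous.
by under eq_fun do rewrite exprS; apply: ctsM.
Qed.

Lemma ctsV f : continuous f -> (forall x, f x != 0) -> continuous (fun x => (f x)^-1).
Proof. by move=> cf f0 x; apply: continuousV; [exact: f0|exact: cf]. Qed.

Lemma cts_comp (Y Z : topologicalType) (f : Y -> Z) (g : X -> Y) :
  continuous f -> continuous g -> continuous (fun x => f (g x)).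
Proof. by move=> cf cg x; apply: continuous_comp; [exact: cg|exact: cf]. Qed.

Lemma cts_pair (Y Z : topologicalType) (f : X -> Y) (g : X -> Z) :
  continuous f -> continuous g -> continuous (fun x => (f x, g x)).
Proof. by move=> cf cg x; apply: cvg_pair; [exact: cf|exact: cg]. Qed.

Lemma cts_fst (Y Z : topologicalType) : continuous (@fst Y Z).
Proof. by move=> x; apply: cvg_fst. Qed.

Lemma cts_snd (Y Z : topologicalType) : continuous (@snd Y Z).
Proof. by move=> x; apply: cvg_snd. Qed.

End RealContinuity.

Lemma cts_id (X : topologicalType) : continuous (fun x : X => x).
Proof. by move=> x; exact: cvg_id. Qed.

Ltac cts :=
  lazymatch goal with
  | |- continuous (fun _ => ?c) => exact: cst_continuous
  | |- continuous (fun x => x) => exact: cts_id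
  | |- continuous (fun x => @?f x + @?g x) => apply: (@ctsD _ _ f g); cts
  | |- continuous (fun x => @?f x * @?g x) => apply: (@ctsM _ _ f g); cts
  | |- continuous (fun x => - @?f x) => apply: (@ctsN _ _ f); cts
  | |- continuous (fun x => @?f x ^+ ?n) => apply: (@ctsX _ _ f n); cts
  | |- continuous (fun x => cos (@?f x)) =>
      apply: (@cts_comp _ _ _ _ f (@continuous_cos _)); cts
  | |- continuous (fun x => sin (@?f x)) =>
      apply: (@cts_comp _ _ _ _ f (@continuous_sin _)); cts
  | |- continuous (fun x => (@?f x, @?g x)) => apply: (@cts_pair _ _ _ f g); cts
  | |- continuous (fun x => fst (@?f x)) => apply: (@cts_comp _ _ _ _ f (@cts_fst _ _)); cts
  | |- continuous (fun x => snd (@?f x)) => apply: (@cts_comp _ _ _ _ f (@cts_snd _ _)); cts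
  | |- continuous (pair _) => exact: continuous_pairr
  | |- continuous fst => exact: cts_fst
  | |- continuous snd => exact: cts_snd
  | |- forall x t, nbhs (@?f x) t -> _ => change (continuous f); cts
  | |- _ => assumption
  end.

(** * Angles determined by their cosine and sine *)

Section Angles.
Variable R : realType.
Implicit Types a b : R.

Lemma cos2pi_int (k : int) a : cos (a + k%:~R * (2 * pi)) = cos a.
Proof.
have pos (n : nat) b : cos (b + n%:R * (2 * pi)) = cos b.
  elim: n b => [|n IH] b; first by rewrite mul0r addr0.
  rewrite -natr1 mulrDl mul1r addrA.
  by rewrite [2 * _]mulrC mulr_natr cosD2pi -[pi *+ 2]mulr_natr [pi * 2]mulrC IH.
case: k => n; first exact: pos.
by rewrite NegzE mulrNz mulNr -(pos n.+1 (a - _)) subrK.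
Qed.

Lemma sin2pi_int (k : int) a : sin (a + k%:~R * (2 * pi)) = sin a.
Proof.
have H b : sin b = - cos (b + pi / 2) by rewrite cosDpihalf opprK.
by rewrite !H addrAC cos2pi_int.
Qed.

Lemma cos_eq1 a : cos a = 1 -> exists k : int, a = k%:~R * (2 * pi).
Proof.
move=> ca; have pi0 := pi_gt0 R; have tp : 0 < 2 * pi :> R by rewrite mulr_gt0.
exists (Num.floor (a / (2 * pi))); set k := Num.floor _.
have /andP[k1 k2] := floor_itv (a / (2 * pi)); rewrite -/k in k1 k2.
rewrite ler_pdivlMr// in k1; rewrite ltr_pdivrMr// intrD mulrDl mul1r in k2.
pose b := (a - k%:~R * (2 * pi)) / 2.
have cb : cos (b *+ 2) = 1.
  rewrite -[RHS]ca -(cos2pi_int (- k) a) mulrNz.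
  by congr cos; rewrite /b; field.
have sb : sin b = 0.
  have := cos2Dsin2 b; move: cb; rewrite cos_mulr2n => cb cs.
  by apply/eqP; rewrite -sqrf_eq0; apply/eqP; lra.
have [b0|b0] := eqVneq b 0.
  by move: b0; rewrite /b => b0; lra.
suff : 0 < sin b by rewrite sb ltxx.
apply: sin_gt0_pi; rewrite lt_def b0 /b /=; apply/andP; split; lra.
Qed.

Lemma sin_eq_cos_eq a b : cos a = cos b -> sin a = sin b ->
  exists k : int, a = b + k%:~R * (2 * pi).
Proof.
move=> cab sab; have [|k kE] := @cos_eq1 (a - b).
  by rewrite cosB cab sab -!expr2 cos2Dsin2.
by exists k; rewrite -kE addrC subrK.
Qed.

Lemma cos_atan_unit (x y : R) : 0 < x -> x ^+ 2 + y ^+ 2 = 1 ->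
  cos (atan (y / x)) = x /\ sin (atan (y / x)) = y.
Proof.
move=> x0 xy; have xn0 : x != 0 by rewrite gt_eqF.
have c : cos (atan (y / x)) = x.
  rewrite cos_atan; have -> : 1 + (y / x) ^+ 2 = (x^-1) ^+ 2.
    by rewrite -[RHS]mulr1 -[X in _ = _ * X]xy; field.
  by rewrite sqrtr_sqr ger0_norm ?invrK// invr_ge0 ltW.
split=> //; have : tan (atan (y / x)) = y / x by rewrite atanK.
rewrite /tan c => /(congr1 (fun z => z * x)).
by rewrite !divfK.
Qed.

End Angles.

(** * Continuous choice of an angle on a contractible space *)

Section Logarithm.
Variables (R : realType) (X : topologicalType).
Hypothesis cX : compact_contractible R X.

(** Unit vectors whose coordinates differ by less than 1/2 have a positive inner product, so the
    angle from one to the other is an arctangent; an angle for [u] thus yields one for any [v] that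
    close to it. *)
Lemma unit_angle (x y : X -> R) : continuous x -> continuous y ->
  (forall t, x t ^+ 2 + y t ^+ 2 = 1) ->
  exists th : X -> R, continuous th /\ forall t, x t = cos (th t) /\ y t = sin (th t).
Proof.
move=> cx cy xy.
pose P (u : X -> R * R) := exists th : X -> R, continuous th /\
  forall t, (u t).1 = cos (th t) /\ (u t).2 = sin (th t).
apply: (@contractible_ind R X _ [set p : R * R | p.1 ^+ 2 + p.2 ^+ 2 = 1] P (2^-1) cX
  _ _ _ (fun t => (x t, y t))) => //; last by cts.
- move=> [a b] /= ab.
  have [a0|a0] := ltP 0 a.
    have [ca sa] := cos_atan_unit a0 ab.
    by exists (fun=> atan (b / a)); split; [exact: cst_continuous|].
  exists (fun=> (if 0 <= b then acos a else - acos a)).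
  split; first exact: cst_continuous.
  move=> t /=; have aI : -1 <= a <= 1.
    by have := sqr_ge0 b; have := sqr_ge0 a; nra.
  have s : sin (acos a) = `|b|.
    by rewrite sin_acos// -ab addrAC subrr add0r sqrtr_sqr.
  case: ifPn => b0; first by rewrite acosK// s ger0_norm.
  rewrite cosN acosK// sinN s ltr0_norm ?opprK//.
  by rewrite ltNge.
- move=> u v cu cv Au Av uv [th [cth thE]].
  (* Real and imaginary parts of the conjugate of [u] times [v]. *)
  pose re t := (u t).1 * (v t).1 + (u t).2 * (v t).2.
  pose im t := (u t).1 * (v t).2 - (u t).2 * (v t).1.
  have re0 t : 0 < re t.
    have [/= h1 h2] := uv t; have /= a1 := Au t; have /= a2 := Av t.
    move: h1 h2; rewrite /ball/= !ltr_norml => /andP[h1 h2] /andP[h3 h4].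
    rewrite /re; nra.
  have rei t : re t ^+ 2 + im t ^+ 2 = 1.
    have /= a1 := Au t; have /= a2 := Av t.
    by rewrite -[RHS]mulr1 -{1}a1 -a2 /re /im; ring.
  exists (fun t => th t + atan (im t / re t)); split.
    apply: ctsD => //; apply: cts_comp; first by move=> z; exact: continuous_atan.
    apply: ctsM; first by rewrite /im; cts.
    apply: ctsV; first by rewrite /re; cts.
    by move=> t; rewrite gt_eqF.
  move=> t; have [c s] := cos_atan_unit (re0 t) (rei t).
  have [e1 e2] := thE t; have /= a1 := Au t.
  rewrite cosD sinD c s -e1 -e2 /re /im; split.
  - by rewrite -[LHS]mul1r -a1; ring.
  - by rewrite -[LHS]mul1r -a1; ring.
Qed.

(** All values are multiples of $2\pi$. If [u] is constant and [v] stays within 1 of it, two values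
    of [v] differ by less than 2, which rules out a nonzero multiple of $2\pi$. *)
Lemma cos_eq1_constant (th : X -> R) : continuous th -> (forall t, cos (th t) = 1) ->
  forall s t, th s = th t.
Proof.
move=> cth c1.
apply: (@contractible_ind R X _ [set a : R | cos a = 1]
  (fun th => forall s t, th s = th t) 1 cX) => // u v _ _ _ Av uv uc s t.
have [k kE] : exists k : int, v s - v t = k%:~R * (2 * pi).
  apply: cos_eq1; have := Av s; have := Av t => /= vt vs.
  have := cos2Dsin2 (v t); have := cos2Dsin2 (v s); rewrite vt vs expr1n => h1 h2.
  rewrite cosB vt vs (_ : sin (v s) = 0) ?mul0r ?mulr1 ?addr0//.
  by apply/eqP; rewrite -sqrf_eq0; apply/eqP; lra.
have : `|v s - v t| < 2.
  have := uv s; have := uv t; rewrite (uc s t) /ball/= => h1 h2.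
  move: h1 h2; rewrite !ltr_norml => /andP[h1 h2] /andP[h3 h4].
  by apply/andP; split; lra.
have := pi_ge2 R; have [k0|k0] := eqVneq k 0.
  by move: kE; rewrite k0 mul0r => /eqP; rewrite subr_eq0 => /eqP.
rewrite kE normrM [`|2 * _|]ger0_norm ?mulr_ge0 ?pi_ge0//.
have : 1 <= `|k%:~R| :> R by rewrite -intr_norm ler1z -gtz0_ge1 normr_gt0.
by nra.
Qed.

End Logarithm.

(** * Arguments of complex-valued maps and their increments *)

Section Arguments.
Variable R : realType.
Local Notation C := R[i].
Local Notation Re := (@complex.Re R).
Local Notation Im := (@complex.Im R).

Definition is_arg (z : C) (a : R) : Prop :=
  exists r, [/\ 0 < r, Re z = r * cos a & Im z = r * sin a].

Lemma complexReM (z w : C) : Re (z * w) = Re z * Re w - Im z * Im w.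
Proof. by case: z w => [a b] [c d]. Qed.

Lemma complexImM (z w : C) : Im (z * w) = Re z * Im w + Im z * Re w.
Proof. by case: z w => [a b] [c d]. Qed.

Lemma complexReD (z w : C) : Re (z + w) = Re z + Re w.
Proof. by case: z w => [a b] [c d]. Qed.

Lemma complexImD (z w : C) : Im (z + w) = Im z + Im w.
Proof. by case: z w => [a b] [c d]. Qed.

Lemma complexP (z w : C) : Re z = Re w -> Im z = Im w -> z = w.
Proof. by case: z w => [a b] [c d] /= -> ->. Qed.

Lemma is_argM z w a b : is_arg z a -> is_arg w b -> is_arg (z * w) (a + b).
Proof.
move=> [r [r0 rz iz]] [s [s0 rw iw]]; exists (r * s).
by rewrite mulr_gt0// complexReM complexImM rz iz rw iw cosD sinD; split=> //; ring.
Qed.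

Lemma is_argZ z a r : 0 < r -> is_arg z a <-> is_arg (r%:C%C * z) a.
Proof.
move=> r0; split=> -[s [s0 rz iz]].
  exists (r * s); rewrite mulr_gt0// complexReM complexImM/= rz iz.
  by split=> //; ring.
exists (r^-1 * s); rewrite mulr_gt0 ?invr_gt0//; move: rz iz; rewrite complexReM complexImM/=.
rewrite mul0r subr0 mul0r addr0 => rz iz.
by rewrite -!mulrA -rz -iz !mulKf ?gt_eqF.
Qed.

Lemma is_arg_eq z a b : is_arg z a -> is_arg z b -> exists k : int, a = b + k%:~R * (2 * pi).
Proof.
move=> [r [r0 rz iz]] [s [s0 rz' iz']].
have rs : r = s.
  have h t c : 0 < t -> Re z = t * cos c -> Im z = t * sin c ->
      Re z ^+ 2 + Im z ^+ 2 = t ^+ 2.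
    by move=> t0 -> ->; rewrite !exprMn -mulrDr cos2Dsin2 mulr1.
  have := h _ _ r0 rz iz; rewrite (h _ _ s0 rz' iz').
  by move/eqP; rewrite eqrXn2 ?ltW// => /eqP.
apply: sin_eq_cos_eq; apply: (mulfI (lt0r_neq0 r0)).
  by rewrite -rz rz' rs.
by rewrite -iz iz' rs.
Qed.

Lemma is_arg_add2pi z a (k : int) : is_arg z a -> is_arg z (a + k%:~R * (2 * pi)).
Proof. by move=> [r [r0 rz iz]]; exists r; rewrite cos2pi_int sin2pi_int. Qed.

Lemma is_arg_neq0 z a : is_arg z a -> z != 0.
Proof.
move=> [r [r0 rz iz]]; apply/eqP => z0; move: rz iz; rewrite z0/= => rz iz.
have := cos2Dsin2 a; move/eqP: rz; move/eqP: iz.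
rewrite ![0 == _]eq_sym !mulf_eq0 !(gt_eqF r0)/= => /eqP -> /eqP ->.
by rewrite expr0n addr0 => /esym/eqP; rewrite oner_eq0.
Qed.

Definition ccontinuous (X : topologicalType) (u : X -> C) : Prop :=
  continuous (fun x => Re (u x)) /\ continuous (fun x => Im (u x)).

Lemma ccontinuousM (X : topologicalType) (u v : X -> C) :
  ccontinuous u -> ccontinuous v -> ccontinuous (fun x => u x * v x).
Proof.
move=> [u1 u2] [v1 v2]; split.
  by under eq_fun do rewrite complexReM; cts.
by under eq_fun do rewrite complexImM; cts.
Qed.

Lemma ccontinuousD (X : topologicalType) (u v : X -> C) :
  ccontinuous u -> ccontinuous v -> ccontinuous (fun x => u x + v x).
Proof.
move=> [u1 u2] [v1 v2]; split.
  by under eq_fun do rewrite complexReD; cts.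
by under eq_fun do rewrite complexImD; cts.
Qed.

Lemma ccontinuous_conj (X : topologicalType) (u : X -> C) :
  ccontinuous u -> ccontinuous (fun x => conjc (u x)).
Proof.
move=> [u1 u2]; split.
  by rewrite (_ : (fun x => _) = (fun x => Re (u x)))//; apply/funext => x; case: (u x).
rewrite (_ : (fun x => _) = (fun x => - Im (u x))); first by cts.
by apply/funext => x; case: (u x).
Qed.

Lemma ccontinuous_comp (X Y : topologicalType) (u : X -> C) (e : Y -> X) :
  ccontinuous u -> continuous e -> ccontinuous (fun y => u (e y)).
Proof.
by move=> [u1 u2] ce; split; [exact: (cts_comp u1 ce)|exact: (cts_comp u2 ce)].
Qed.

Lemma ccontinuous_cst (X : topologicalType) (c : C) : ccontinuous (fun _ : X => c).
Proof. by split; exact: cst_continuous. Qed.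

Section ArgumentLift.
Variable X : topologicalType.
Hypothesis cX : compact_contractible R X.

Lemma angle_lift (u : X -> C) : ccontinuous u -> (forall x, u x != 0) ->
  exists th : X -> R, continuous th /\ forall x, is_arg (u x) (th x).
Proof.
move=> [cr ci] u0.
pose n x := Num.sqrt (Re (u x) ^+ 2 + Im (u x) ^+ 2).
have s0 x : 0 < Re (u x) ^+ 2 + Im (u x) ^+ 2.
  rewrite lt_def addr_ge0 ?sqr_ge0// andbT paddr_eq0 ?sqr_ge0// !sqrf_eq0.
  by have := u0 x; case: (u x) => a b; rewrite eq_complex.
have n0 x : 0 < n x by rewrite sqrtr_gt0.
have nn x : n x != 0 by rewrite gt_eqF.
have cn : continuous n by apply: (cts_comp (@sqrt_continuous _)); cts.
have cV := ctsV cn nn.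
have [|||th [cth thE]] := unit_angle cX (x := fun x => Re (u x) * (n x)^-1)
    (y := fun x => Im (u x) * (n x)^-1); [by cts|by cts| |].
  move=> t; rewrite !exprMn -mulrDl exprVn sqr_sqrtr ?divff ?gt_eqF//.
  exact: ltW.
exists th; split=> // x; exists (n x); have [<- <-] := thE x; rewrite n0.
by split=> //; rewrite mulrCA divff// mulr1.
Qed.

Lemma arg_increment_unique (u : X -> C) (th th' : X -> R) :
  continuous th -> continuous th' ->
  (forall x, is_arg (u x) (th x)) -> (forall x, is_arg (u x) (th' x)) ->
  forall x y, th x - th y = th' x - th' y.
Proof.
move=> c c' a a' x y.
have : th x - th' x = th y - th' y.
  apply: (cos_eq1_constant cX (th := fun x => th x - th' x)); first by cts.
  by move=> t; have [k ->] := is_arg_eq (a t) (a' t); rewrite addrAC subrr cos2pi_int cos0.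
by lra.
Qed.

(** An arbitrary continuous argument: it matters only through its increments, which do not depend on
    the choice. The default 0 is returned when [u] has no continuous argument. *)
Definition angle (u : X -> C) : X -> R :=
  xget (fun=> 0) [set th | continuous th /\ forall x, is_arg (u x) (th x)].

Definition arg_increment (u : X -> C) (x y : X) : R := angle u y - angle u x.

Lemma angleP (u : X -> C) : ccontinuous u -> (forall x, u x != 0) ->
  continuous (angle u) /\ forall x, is_arg (u x) (angle u x).
Proof.
move=> cu u0; have [th hth] := angle_lift cu u0.
rewrite /angle; case: xgetP => [_ _ //|]; last by move/(_ th).
Qed.

Lemma arg_incrementE (u : X -> C) (th : X -> R) : continuous th ->
  ccontinuous u ->
  (forall x, is_arg (u x) (th x)) -> forall x y, arg_increment u x y = th y - th x.
Proof.
move=> cth cu a x y.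
have [//|c' a'] := angleP cu; first by move=> z; exact: is_arg_neq0 (a z).
by rewrite /arg_increment (arg_increment_unique c' cth a' a).
Qed.

Lemma arg_incrementM (u v : X -> C) x y : ccontinuous u -> ccontinuous v ->
  (forall x, u x != 0) -> (forall x, v x != 0) ->
  arg_increment (fun x => u x * v x) x y = arg_increment u x y + arg_increment v x y.
Proof.
move=> cu cv u0 v0; have [ca a] := angleP cu u0; have [cb b] := angleP cv v0.
rewrite (@arg_incrementE _ (fun x => angle u x + angle v x)).
- by rewrite /arg_increment; ring.
- by cts.
- exact: ccontinuousM.
- by move=> z; exact: is_argM.
Qed.

Lemma arg_incrementZ (u v : X -> C) (r : X -> R) x y : ccontinuous u -> ccontinuous v ->
  (forall x, u x != 0) -> (forall x, 0 < r x) -> (forall x, v x = (r x)%:C%C * u x) ->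
  arg_increment v x y = arg_increment u x y.
Proof.
move=> cu cv u0 r0 vE; have [ca a] := angleP cu u0.
rewrite (arg_incrementE ca)// => z; rewrite vE.
exact: (is_argZ _ _ (r0 z)).1 (a z).
Qed.

End ArgumentLift.

Lemma arg_increment_comp (X Y : topologicalType) (e : Y -> X) (u : X -> C) x y :
  compact_contractible R X -> compact_contractible R Y -> continuous e ->
  ccontinuous u -> (forall x, u x != 0) ->
  arg_increment (fun y => u (e y)) x y = arg_increment u (e x) (e y).
Proof.
move=> cX cY ce cu u0; have [ca a] := angleP cX cu u0.
rewrite (@arg_incrementE _ cY _ (fun y => angle u (e y)))//.
  exact: cts_comp.
exact: ccontinuous_comp.
Qed.

End Arguments.

(** * Lifting along the Hopf fibration *)

Lemma cts_coord (R : realType) (X : topologicalType) m n (v : X -> 'M[R]_(m, n)) i j :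
  continuous v -> continuous (fun x => v x i j).
Proof. move=> cv x; apply: (cts_comp (@coord_continuous R m n i j) cv). Qed.

Section HopfLift.
Variable R : realType.
Local Notation C := R[i].
Local Notation Re := (@complex.Re R).
Local Notation Im := (@complex.Im R).
Implicit Types (p : 'rV[R]_3) (w : C * C).

Definition horiz p : C := (p 0 0 +i* p 0 1)%C.

Lemma horiz_conj p : sphere p ->
  horiz p * conjc (horiz p) = ((height p)%:C * (1 - height p)%:C)%C.
Proof.
move=> ps; apply: complexP; rewrite !(complexReM, complexImM)/=; last by ring.
move: ps; rewrite /sphere/=; set h := height p => ps; lra.
Qed.

(* [w] spans the line fixed by the projection
   [[h, x+iy], [x-iy, 1-h]]; this is the Hopf fibration over the sphere of
   diameter 1. *)
Definition is_lift p w : Prop :=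
  [/\ w != 0, horiz p * w.2 = (1 - height p)%:C%C * w.1
    & conjc (horiz p) * w.1 = (height p)%:C%C * w.2].

(** The Hermitian product. Two lifts of one point span the same complex line; if [w'] is [c] times
    [w], the product is [c] times a positive number, so its argument is the angle from [w] to
    [w']. *)
Definition herm w w' : C := conjc w.1 * w'.1 + conjc w.2 * w'.2.

Lemma herm_self w : w != 0 -> exists2 r, 0 < r & herm w w = r%:C%C.
Proof.
case: w => [[a b] [c d]] w0; exists (a ^+ 2 + b ^+ 2 + (c ^+ 2 + d ^+ 2)).
  rewrite lt_def !addr_ge0 ?sqr_ge0// andbT.
  apply: contra w0; rewrite !paddr_eq0 ?addr_ge0 ?sqr_ge0// !sqrf_eq0.
  by move=> /andP[/andP[/eqP-> /eqP->] /andP[/eqP-> /eqP->]].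
by apply: complexP; rewrite /herm ?(complexReD, complexImD) ?(complexReM, complexImM)/=; ring.
Qed.

(** The determinant of the two vectors is annihilated both by the height [h] and by [1 - h], whose
    sum is 1. *)
Lemma is_lift_collinear p w w' : is_lift p w -> is_lift p w' ->
  w.1 * w'.2 = w.2 * w'.1.
Proof.
move=> [_ a b] [_ a' b'].
have e : (height p)%:C%C + (1 - height p)%:C%C = 1 :> C.
  by apply: complexP => /=; ring.
have h1 : (height p)%:C%C * (w.1 * w'.2 - w.2 * w'.1) = 0.
  by rewrite mulrBr mulrCA -b' [X in _ - X]mulrA -b; ring.
have h2 : (1 - height p)%:C%C * (w.1 * w'.2 - w.2 * w'.1) = 0.
  by rewrite mulrBr mulrA -a [X in _ - X]mulrCA -a'; ring.
by apply/eqP; rewrite -subr_eq0 -[X in X == _]mul1r -e mulrDl h1 h2 addr0.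
Qed.

(** On a complex line the scalars leading from [w] to [w'] and from [w'] to [w''] multiply; the
    factor [herm w' w'] is positive, so arguments of [herm] add up. *)
Lemma herm_trans p w w' w'' : is_lift p w -> is_lift p w' -> is_lift p w'' ->
  herm w w' * herm w' w'' = herm w' w' * herm w w''.
Proof.
move=> l l' l''; have := is_lift_collinear l' l''.
rewrite /herm; set a := conjc _; set b := conjc _; set c := conjc _; set d := conjc _.
move=> e; apply/eqP; rewrite -subr_eq0; apply/eqP.
transitivity ((a * d - b * c) * (w'.1 * w''.2 - w'.2 * w''.1)); first by ring.
by rewrite e subrr mulr0.
Qed.

Lemma herm_neq0 p w w' : is_lift p w -> is_lift p w' -> herm w w' != 0.
Proof.
move=> l l'; have := herm_trans l l' l.
have [r r0 ->] := herm_self (let: And3 h _ _ := l in h).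
have [s s0 ->] := herm_self (let: And3 h _ _ := l' in h).
move=> e; apply/eqP => e0; move: e; rewrite e0 mul0r => /(congr1 Re); rewrite complexReM/=.
by move/eqP; rewrite mulr0 subr0 eq_sym mulf_eq0 !gt_eqF.
Qed.

(** The columns of the projection are lifts. The first one vanishes over the South pole, where the
    second is taken instead. *)
Lemma is_lift_exists p : sphere p -> exists w, is_lift p w.
Proof.
move=> /horiz_conj e; have [h0|h0] := eqVneq (height p) 0.
  exists (horiz p, 1%C); split => /=.
  - by apply/eqP => /(congr1 snd)/eqP; rewrite oner_eq0.
  - by rewrite h0 subr0 mulr1 mul1r.
  - by rewrite [LHS]mulrC [LHS]e h0 subr0.
exists (((height p)%:C)%C, conjc (horiz p)); split => /=.
- by apply/eqP => /(congr1 fst)/(congr1 Re)/= /eqP; apply/negP.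
- by rewrite e mulrC.
- by rewrite mulrC.
Qed.

(** For [p] on the sphere, the orthogonal projection of [w] onto the line over [p]. *)
Definition transport p w : C * C :=
  ((height p)%:C%C * w.1 + horiz p * w.2, conjc (horiz p) * w.1 + (1 - height p)%:C%C * w.2).

(** The projection of a nonzero vector of the line over [p] to the line over [p'] vanishes only if
    the product of the two projections has trace 0. That trace is $1-|p-p'|^2$, and coordinates
    differing by less than 1/2 give $|p-p'|^2<3/4$. *)
Lemma is_lift_transport p p' w : sphere p -> sphere p' -> ball p (2^-1) p' ->
  is_lift p w -> is_lift p' (transport p' w).
Proof.
move=> sp sp' pp' lw; have [w0 e1 e2] := lw.
have q' := horiz_conj sp'.
rewrite /transport; split; cbn [fst snd]; last 2 first.
- by rewrite mulrDr mulrA q'; ring.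
- by rewrite mulrDr [_ * (horiz p' * _)]mulrA [conjc _ * horiz _]mulrC q'; ring.
apply/negP => /eqP t0; have t1 := congr1 fst t0; have t2 := congr1 snd t0.
move: t1 t2; cbn [fst snd]; set u1 := _ + _; set u2 := _ + _ => t1 t2.
have c1 : (height p)%:C%C + (1 - height p)%:C%C = 1 :> C.
  by apply: complexP => /=; ring.
have c2 : (height p')%:C%C + (1 - height p')%:C%C = 1 :> C.
  by apply: complexP => /=; ring.
(* the trace of the product of the two projections *)
pose tr := (height p)%:C%C * (height p')%:C%C + conjc (horiz p) * horiz p' +
  horiz p * conjc (horiz p') + (1 - height p)%:C%C * (1 - height p')%:C%C.
have tr1 : tr * w.1 = 0.
  have h : (height p)%:C%C * u1 + horiz p * u2 = 0 :> C.
    by rewrite t1 t2 !mulr0 addr0.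
  rewrite -[RHS]h /tr /u1 /u2 !mulrDl !mulrDr.
  have -> : conjc (horiz p) * horiz p' * w.1 = (height p)%:C%C * (horiz p' * w.2).
    by rewrite mulrAC e2; ring.
  have -> : (1 - height p)%:C%C * (1 - height p')%:C%C * w.1 =
      horiz p * ((1 - height p')%:C%C * w.2).
    by rewrite mulrAC -e1; ring.
  by ring.
have tr2 : tr * w.2 = 0.
  have h : conjc (horiz p) * u1 + (1 - height p)%:C%C * u2 = 0 :> C.
    by rewrite t1 t2 !mulr0 addr0.
  rewrite -[RHS]h /tr /u1 /u2 !mulrDl !mulrDr.
  have -> : (height p)%:C%C * (height p')%:C%C * w.2 =
      conjc (horiz p) * ((height p')%:C%C * w.1).
    by rewrite mulrAC -e2; ring.
  have -> : horiz p * conjc (horiz p') * w.2 =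
      (1 - height p)%:C%C * (conjc (horiz p') * w.1).
    by rewrite mulrAC e1; ring.
  by ring.
have tr0 : tr = 0.
  apply/eqP; move: w0; apply: contraNT => tr0.
  move/eqP: tr1; rewrite mulf_eq0 (negbTE tr0)/= => /eqP h1.
  move/eqP: tr2; rewrite mulf_eq0 (negbTE tr0)/= => /eqP h2.
  by case: (w) h1 h2 => a b /= -> ->.
have := congr1 Re tr0; rewrite /tr !complexReD !complexReM/=.
have [_ {}pp'] := pp'; have b0 := pp' 0 0; have b1 := pp' 0 1; have b2 := pp' 0 ord_max.
move: b0 b1 b2 sp sp'; rewrite /ball/= /sphere/= -/(height p) -/(height p').
rewrite !ltr_norml => /andP[? ?] /andP[? ?] /andP[? ?] sp sp'; rewrite !expr2 in sp sp'.
nra.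
Qed.

Definition lift_continuous (X : topologicalType) (w : X -> C * C) :=
  ccontinuous (fun x => (w x).1) /\ ccontinuous (fun x => (w x).2).

Lemma ccontinuous_herm (X : topologicalType) (w w' : X -> C * C) :
  lift_continuous w -> lift_continuous w' -> ccontinuous (fun x => herm (w x) (w' x)).
Proof.
move=> [c1 c2] [d1 d2].
by apply: ccontinuousD; apply: ccontinuousM => //; exact: ccontinuous_conj.
Qed.

Lemma lift_continuous_comp (X Y : topologicalType) (w : X -> C * C) (e : Y -> X) :
  lift_continuous w -> continuous e -> lift_continuous (fun y => w (e y)).
Proof. by move=> [c1 c2] ce; split; [exact: (ccontinuous_comp c1 ce)|exact: (ccontinuous_comp c2 ce)]. Qed.

(** A lift of [u] becomes a lift of a nearby map [v] by projecting it pointwise onto the lines over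
    [v], which keeps it continuous. *)
Lemma lift_exists (X : topologicalType) (p : X -> 'rV[R]_3) :
  compact_contractible R X -> continuous p -> (forall x, sphere (p x)) ->
  exists w : X -> C * C, lift_continuous w /\ forall x, is_lift (p x) (w x).
Proof.
move=> cX cp sp.
pose P (p : X -> 'rV[R]_3) :=
  exists w : X -> C * C, lift_continuous w /\ forall x, is_lift (p x) (w x).
apply: (@contractible_ind R X _ (@sphere R) P (2^-1) cX _ _ _ p cp sp) => //.
- move=> p0 /is_lift_exists[w wl]; exists (fun=> w); split => //.
  by split; exact: ccontinuous_cst.
- move=> u v cu cv su sv uv [w [[w1 w2] lw]].
  have cvi i j : continuous (fun x => v x i j) by exact: cts_coord cv.
  have ch : ccontinuous (fun x => (height (v x))%:C%C).
    by split; [exact: (cvi _ _)|exact: cst_continuous].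
  have ch' : ccontinuous (fun x => (1 - height (v x))%:C%C).
    split; last exact: cst_continuous.
    by apply: ctsD; [cts|apply: ctsN; exact: (cvi _ _)].
  have cq : ccontinuous (fun x => horiz (v x)).
    by split; exact: (cvi _ _).
  exists (fun x => transport (v x) (w x)); split; last first.
    by move=> x; apply: (is_lift_transport (su x)).
  by split; apply: ccontinuousD; apply: ccontinuousM => //; exact: ccontinuous_conj.
Qed.

End HopfLift.

(** * The Euler cocycle on singular 2-simplices *)

Section ConvexSets.
Variable R : realType.

Lemma set_val_continuous (T : topologicalType) (A : set T) : continuous (@set_val T A).
Proof. exact: initial_continuous. Qed.

Lemma continuous_set_type (X T : topologicalType) (A : set T) (f : X -> set_type A) :
  continuous (fun x => set_val (f x)) -> continuous f.
Proof. by move=> cf; apply: continuous_comp_initial. Qed.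

Lemma compact_set_type (T : topologicalType) (A : set T) :
  compact A -> compact [set: set_type A].
Proof.
move=> cA F PF _.
have [|p [Ap clp]] := cA (set_val @ F).
  by rewrite /nbhs/=; apply: (@filterS _ F _ setT) => [x _|]; [exact: set_valP|exact: filterT].
exists (exist _ p (mem_set Ap)); split => // B D FB [U [[V oV VU] Ux UD]].
have Vp : V p by move: Ux; rewrite -VU.
have FB' : (set_val @ F) (set_val @` B) by apply: (@filterS _ F _ B) => // y By; exists y.
have [x [/= [y By <-] Vx]] := clp _ V FB' (open_nbhs_nbhs (conj oV Vp)).
by exists y; split => //; apply: UD; rewrite -VU.
Qed.

Lemma cts_max (X : topologicalType) (f g : X -> R) :
  continuous f -> continuous g -> continuous (fun x => Num.max (f x) (g x)).
Proof. by move=> cf cg x; apply: continuous_max; [exact: cf|exact: cg]. Qed.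

Lemma cts_min (X : topologicalType) (f g : X -> R) :
  continuous f -> continuous g -> continuous (fun x => Num.min (f x) (g x)).
Proof. by move=> cf cg x; apply: continuous_min; [exact: cf|exact: cg]. Qed.

Lemma cts_sum (X : topologicalType) I (r : seq I) (f : I -> X -> R) :
  (forall i, continuous (f i)) -> continuous (fun x => \sum_(i <- r) f i x).
Proof.
move=> cf; elim: r => [|i r IH].
  by under eq_fun do rewrite big_nil; exact: cst_continuous.
by under eq_fun do rewrite big_cons; apply: ctsD.
Qed.

Definition clamp (s : R) : R := Num.max 0 (Num.min 1 s).

Lemma clamp_continuous : continuous clamp.
Proof.
by apply: cts_max; [exact: cst_continuous|apply: cts_min; [exact: cst_continuous|exact: cts_id]].
Qed.

Lemma clamp_itv s : 0 <= clamp s <= 1.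
Proof. by rewrite /clamp le_max lexx/= ge_max ler01 ge_min lexx. Qed.

Lemma clamp_id s : 0 <= s <= 1 -> clamp s = s.
Proof. by move=> /andP[s0 s1]; rewrite /clamp (min_r s1) (max_r s0). Qed.

Lemma star_compact_contractible (V : normedModType R) (A : set V) x0 :
  compact A -> A x0 ->
  (forall x s, A x -> 0 <= s <= 1 -> A (x0 + s *: (x - x0))) ->
  compact_contractible R (set_type A).
Proof.
move=> cA A0 As; split; first exact: compact_set_type.
have cP (p : R * set_type A) : x0 + clamp p.1 *: (set_val p.2 - x0) \in A.
  by apply/mem_set/As; [exact: set_valP|exact: clamp_itv].
exists (fun p => exist (fun x => x \in A) _ (cP p) : set_type A).
exists (exist (fun x => x \in A) x0 (mem_set A0)); split.
- apply: continuous_set_type => p; rewrite /set_val/=.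
  apply: cvgD; first exact: cvg_cst.
  apply: cvgZ.
    by apply: (cts_comp clamp_continuous); exact: cts_fst.
  apply: cvgB; last exact: cvg_cst.
  exact: (cts_comp (@set_val_continuous _ A) (@cts_snd _ _)).
- by move=> x; apply: val_inj; rewrite /= clamp_id ?lexx ?ler01// scale0r addr0.
- by move=> x; apply: val_inj; rewrite /= clamp_id ?lexx ?ler01// scale1r addrC subrK.
Qed.

Lemma closed_eq_fun (X : topologicalType) (f : X -> R) (a : R) :
  continuous f -> closed [set x | f x = a].
Proof. by move=> cf; apply: (@preimage_closed _ _ f [set a]) => //; exact: closed_eq. Qed.

Lemma closed_ge_fun (X : topologicalType) (f : X -> R) (a : R) :
  continuous f -> closed [set x | a <= f x].
Proof. by move=> cf; apply: (@preimage_closed _ _ f [set x | a <= x]) => //; exact: closed_ge. Qed.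

Lemma simplex_compact n : compact (@simplex R n).
Proof.
have cc (i : 'I_n.+1) : continuous (fun t : 'rV[R]_n.+1 => t 0 i).
  exact: cts_coord (@cts_id _).
pose B := [set t : 'rV[R]_n.+1 | forall i, `[0, 1]%classic (t ord0 i)].
apply: (@subclosed_compact _ _ B).
- rewrite (_ : @simplex R n = (\bigcap_i [set t : 'rV[R]_n.+1 | 0 <= t 0 i]) `&`
    [set t : 'rV[R]_n.+1 | \sum_i t 0 i = 1]); last first.
    by rewrite eqEsubset; split=> t [t0 t1]; split => // i; [move=> _|]; exact: t0.
  apply: closedI.
    by apply: closed_bigI => i _; apply: closed_ge_fun.
  by apply: closed_eq_fun; apply: cts_sum.
- exact: (rV_compact (fun=> @segment_compact R 0 1)).
- move=> t [t0 t1] i /=; rewrite in_itv/= t0 -t1 (bigD1 i)//= lerDl.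
  by apply: sumr_ge0 => j _.
Qed.

Lemma vertex_subproof n (i : 'I_n.+1) : (delta_mx 0 i : 'rV[R]_n.+1) \in @simplex R n.
Proof.
apply/mem_set; split=> [j|]; first by rewrite mxE ler0n.
rewrite (bigD1 i)//= mxE !eqxx/= big1 ?addr0// => j ji.
by rewrite mxE (negbTE ji) andbF.
Qed.

Definition vertex n (i : 'I_n.+1) : set_type (@simplex R n) :=
  exist (fun x => x \in @simplex R n) (delta_mx 0 i : 'rV[R]_n.+1) (vertex_subproof i).

Lemma simplex_contractible n : compact_contractible R (set_type (@simplex R n)).
Proof.
have [e0 e1] : @simplex R n (delta_mx 0 ord0 : 'rV[R]_n.+1).
  exact/set_mem/vertex_subproof.
apply: (star_compact_contractible (@simplex_compact n)) => [//|x s [x0 x1] /andP[s0 s1]].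
split=> [i|].
  rewrite !mxE; have := e0 i; have := x0 i; rewrite !mxE; nra.
under eq_bigr do rewrite !mxE.
rewrite big_split/= -mulr_sumr big_split/= sumrN x1.
have -> : \sum_(i < n.+1) ((0 == 0 :> 'I_1) && (i == 0))%:R = 1 :> R.
  by rewrite -[RHS]e1; apply: eq_bigr => i _; rewrite mxE.
by rewrite subrr mulr0 addr0.
Qed.

Lemma face_vertex n (i : 'I_n.+2) (j : 'I_n.+1) : face i (vertex j) = vertex (fintype.lift i j).
Proof.
apply: val_inj; apply/rowP => k; rewrite /= !mxE /=.
case: unliftP => [k' ->|->]; last by rewrite ?eqxx/= (negbTE (neq_lift _ _)).
by rewrite mxE/= (inj_eq lift_inj).
Qed.

Lemma face_face n (j i' : 'I_n.+3) (i j' : 'I_n.+2) (t : set_type (@simplex R n)) :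
  (forall x, fintype.lift j (fintype.lift i x) = fintype.lift i' (fintype.lift j' x)) ->
  face j (face i t) = face i' (face j' t).
Proof.
have val (a : 'I_n.+3) (b : 'I_n.+2) x :
    face_fun a (face_fun b (set_val t)) 0 (fintype.lift a (fintype.lift b x)) = set_val t 0 x.
  by rewrite !mxE liftK mxE liftK.
have val0 (a : 'I_n.+3) (b : 'I_n.+2) k : (forall x, k != fintype.lift a (fintype.lift b x)) ->
    face_fun a (face_fun b (set_val t)) 0 k = 0.
  move=> kx; rewrite !mxE; case: unliftP => [k' kk'|//]; rewrite mxE.
  by case: unliftP => [k'' kk''|//]; have := kx k''; rewrite kk' kk'' eqxx.
move=> H; apply: val_inj; apply/rowP => k; rewrite /=.
have [[x ->]|nx] := pselect (exists x, k = fintype.lift j (fintype.lift i x)).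
  by rewrite val H val.
by rewrite !val0// => x; apply/eqP => kx; apply: nx; exists x; [rewrite H|].
Qed.

End ConvexSets.

Section EulerCocycle.
Variable R : realType.
Local Notation C := R[i].
Local Notation S2 := (set_type (@sphere R)).
Local Notation D n := (set_type (@simplex R n)).

Definition lifts (X : topologicalType) (s : X -> S2) (w : X -> C * C) : Prop :=
  lift_continuous w /\ forall x, is_lift (set_val (s x)) (w x).

Lemma lifts_exists (X : topologicalType) (s : X -> S2) :
  compact_contractible R X -> continuous s -> exists w, lifts s w.
Proof.
move=> cX cs; apply: lift_exists => //.
  exact: (cts_comp (@set_val_continuous _ _) cs).
by move=> x; exact: set_valP.
Qed.

Lemma lifts_comp (X Y : topologicalType) (s : X -> S2) w (e : Y -> X) :
  lifts s w -> continuous e -> lifts (fun y => s (e y)) (fun y => w (e y)).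
Proof. by move=> [cw lw] ce; split; [exact: lift_continuous_comp|move=> y; exact: lw]. Qed.

(** The choice depends only on the map [s]; an edge shared by two simplices therefore receives the
    same lift from both, and its contributions cancel. *)
Definition chosen_lift (X : topologicalType) (s : X -> S2) : X -> C * C :=
  xget (fun=> 0) [set w | lifts s w].

Lemma chosen_liftP (X : topologicalType) (s : X -> S2) :
  compact_contractible R X -> continuous s -> lifts s (chosen_lift s).
Proof.
move=> cX cs; have [w lw] := lifts_exists cX cs.
by rewrite /chosen_lift; case: xgetP => [_ _ //|/(_ w)].
Qed.

(* The angle by which [w] turns along the edge, relatively to the chosen lift. *)
Definition edge_angle (e : D 1 -> S2) (w : D 1 -> C * C) : R :=
  arg_increment (fun x => herm (chosen_lift e x) (w x)) (vertex R ord0) (vertex R ord_max).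

Definition boundary_angle (s : D 2 -> S2) (w : D 2 -> C * C) : R :=
  \sum_(i < 3) (-1) ^+ i * edge_angle (s \o face i) (w \o face i).

(* The obstruction cocycle of the Hopf bundle: 2pi times its Euler class. *)
Definition euler (s : D 2 -> S2) : R := boundary_angle s (chosen_lift s).

(** By [herm_trans] the angle measured with [w'] is that of a product, up to a positive factor which
    does not turn. *)
Lemma edge_angle_change (e : D 1 -> S2) w w' : continuous e -> lifts e w -> lifts e w' ->
  edge_angle e w' = edge_angle e w +
    arg_increment (fun x => herm (w x) (w' x)) (vertex R ord0) (vertex R ord_max).
Proof.
move=> ce lw lw'; have cD := simplex_contractible R 1.
have lc := chosen_liftP cD ce.
have [cc c] := lc; have [cw l] := lw; have [cw' l'] := lw'.
rewrite /edge_angle -arg_incrementM//; last 4 first.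
- exact: ccontinuous_herm.
- exact: ccontinuous_herm.
- by move=> x; exact: herm_neq0 (c x) (l x).
- by move=> x; exact: herm_neq0 (l x) (l' x).
pose r x := complex.Re (herm (w x) (w x)).
have rE x : herm (w x) (w x) = (r x)%:C%C /\ 0 < r x.
  by have [w0 _ _] := l x; rewrite /r; have [t t0 ->] := herm_self w0.
apply/esym; apply: (@arg_incrementZ _ _ cD _ _ r).
- exact: ccontinuous_herm.
- by apply: ccontinuousM; exact: ccontinuous_herm.
- by move=> x; exact: herm_neq0 (c x) (l' x).
- by move=> x; have [] := rE x.
- by move=> x; have [<- _] := rE x; exact: herm_trans (c x) (l x) (l' x).
Qed.

Lemma face_continuous n (i : 'I_n.+2) : continuous (@face R n i).
Proof. exact: continuous_face. Qed.

(** Replacing one lift over the triangle by another adds to each edge the increment of the argument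
    of a single nonvanishing function on the whole triangle; along the closed boundary these
    increments telescope to 0. *)
Lemma euler_lift (s : D 2 -> S2) w : continuous s -> lifts s w -> euler s = boundary_angle s w.
Proof.
move=> cs lw; have lc := chosen_liftP (simplex_contractible R 2) cs.
have cf i : continuous (s \o @face R 1 i).
  by apply: (cts_comp cs); exact: face_continuous.
rewrite /euler /boundary_angle.
pose u x := herm (chosen_lift s x) (w x).
have E i : edge_angle (s \o face i) (w \o face i) =
    edge_angle (s \o face i) (chosen_lift s \o face i) +
    arg_increment u (face i (vertex R ord0)) (face i (vertex R ord_max)).
  rewrite (edge_angle_change (cf i) (lifts_comp lc (@face_continuous _ i))
    (lifts_comp lw (@face_continuous _ i))).
  congr (_ + _); rewrite -(@arg_increment_comp _ _ _ (face i) u)//.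
  - exact: simplex_contractible.
  - exact: simplex_contractible.
  - exact: face_continuous.
  - by apply: ccontinuous_herm; [have [] := lc|have [] := lw].
  - by move=> x; apply: (@herm_neq0 _ (set_val (s x))); [have [] := lc|have [] := lw].
under [RHS]eq_bigr do rewrite E mulrDr.
rewrite big_split/= -[LHS]addr0; congr (_ + _).
rewrite !big_ord_recl big_ord0 /= !face_vertex /arg_increment.
(* Vertices are put in the form [inord] of a number so that equal ones become syntactically
   equal. *)
have vE (i : 'I_3) (j : 'I_2) : fintype.lift i j = inord (bump i j).
  by apply: val_inj; rewrite /= inordK// (ltn_ord (fintype.lift i j)).
by rewrite !vE /= /bump/= !inordK//=; ring.
Qed.

(** By [euler_lift], the restrictions of one lift over the tetrahedron may serve on all its faces.
    Each edge then occurs twice with opposite signs, as in the proof that the boundary of a boundary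
    is 0. *)
Lemma euler_boundary (t : D 3 -> S2) : continuous t ->
  \sum_(j < 4) (-1) ^+ j * euler (t \o face j) = 0.
Proof.
move=> ct; have lt := chosen_liftP (simplex_contractible R 3) ct.
pose g (j : 'I_4) (i : 'I_3) := edge_angle ((t \o face j) \o face i)
  ((chosen_lift t \o face j) \o face i).
have eE j : euler (t \o face j) = \sum_(i < 3) (-1) ^+ i * g j i.
  apply: euler_lift; first by apply: (cts_comp ct); exact: face_continuous.
  exact: (lifts_comp lt (@face_continuous _ j)).
have gE (j i' : 'I_4) (i j' : 'I_3) :
    (forall x : 'I_2, bump j (bump i x) = bump i' (bump j' x)) -> g j i = g i' j'.
  move=> h; have ff x : face j (face i x) = face i' (face j' x) :> D 3.
    by apply: face_face => y; apply: val_inj => /=.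
  by rewrite /g; congr edge_angle; apply/funext => x /=; rewrite ff.
under eq_bigr do rewrite eE.
rewrite !(big_ord_recl, big_ord0) /=.
set i1 : 'I_3 := fintype.lift _ _; set i2 : 'I_3 := fintype.lift _ _.
set j1 : 'I_4 := fintype.lift _ _; set j2 : 'I_4 := fintype.lift _ _.
set j3 : 'I_4 := fintype.lift _ _.
rewrite (gE j1 ord0 ord0 ord0); last by case=> [[|[|]]].
rewrite (gE j2 ord0 ord0 i1); last by case=> [[|[|]]].
rewrite (gE j2 j1 i1 i1); last by case=> [[|[|]]].
rewrite (gE j3 ord0 ord0 i2); last by case=> [[|[|]]].
rewrite (gE j3 j1 i1 i2); last by case=> [[|[|]]].
rewrite (gE j3 j2 i2 i2); last by case=> [[|[|]]].
by rewrite /bump/=; ring.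
Qed.

Definition euler_chain (c : chain R 2 S2) : R :=
  fglift (fun s : singular_simplex R 2 S2 => euler s : zmodule R) c.

Lemma fgliftB (T : choiceType) (M : lmodType int) (h : T -> M) (x y : {freeg T / int}) :
  fglift h (x - y) = fglift h x - fglift h y.
Proof. exact: lift_is_additive. Qed.

HB.instance Definition _ (T : choiceType) (M : lmodType int) (h : T -> M) :=
  GRing.isZmodMorphism.Build {freeg T / int} M (fglift h) (fgliftB h).

Lemma fglift1 (T : choiceType) (M : lmodType int) (h : T -> M) (x : T) :
  fglift h << x >> = h x.
Proof. by rewrite liftU scale1r. Qed.

Lemma additive_freeg (T : choiceType) (M : zmodType) (h : {additive {freeg T / int} -> M}) :
  (forall x, h << x >> = 0) -> forall c, h c = 0.
Proof.
move=> h0 c; rewrite -(freeg_sumE c) raddf_sum big1// => z _.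
by rewrite -[coeff z c]intz -freegU_mulz raddfMz h0 mul0rz.
Qed.

Lemma euler_chain_boundary (c : chain R 3 S2) : euler_chain (boundary c) = 0.
Proof.
rewrite /euler_chain /boundary.
pose h1 := fglift (fun s : singular_simplex R 2 S2 => euler s : zmodule R).
set h2 := (X in fglift _ (X c)); suff : (h1 \o h2) c = 0 by [].
apply: additive_freeg => s /=.
rewrite /h2 fglift1 /h1 raddf_sum /= -[RHS](@euler_boundary s); last exact: cts_fun.
apply: eq_bigr => i _; rewrite -[in LHS]signr_odd -[in RHS]signr_odd; case: odd => /=.
  by rewrite expr1 scaleN1r raddfN /= fglift1 expr1 mulN1r.
by rewrite expr0 scale1r fglift1 expr0 mul1r.
Qed.

Lemma euler_homologous (z w : chain R 2 S2) : homologous z w -> euler_chain z = euler_chain w.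
Proof.
move=> [c cE]; have := euler_chain_boundary c.
by rewrite cE /euler_chain fgliftB => /eqP; rewrite subr_eq0 => /eqP.
Qed.

End EulerCocycle.

(** * The fundamental cycle *)

Lemma cts_mx (R : realType) (X : topologicalType) m n (v : X -> 'M[R]_(m, n)) :
  (forall i j, continuous (fun x => v x i j)) -> continuous v.
Proof.
move=> cv x P [Q nQ QP].
have : \forall y \near x, forall i j, Q i j (v y i j).
  apply: filter_forall => i; apply: filter_forall => j.
  exact: cv (nQ i j).
by apply: (@filterS _ _ (nbhs_filter x)) => y Qy; exact: QP.
Qed.

(** * Arguments and lifts over rectangles of the plane *)

Section Rectangles.
Variable R : realType.
Local Notation C := R[i].
Local Notation S2 := (set_type (@sphere R)).

Definition rect (a b c d : R) : set (R * R) := `[a, b] `*` `[c, d].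

Lemma rectE a b c d x y : rect a b c d (x, y) = ((a <= x <= b) /\ (c <= y <= d)) :> Prop.
Proof. by rewrite /rect/setX/= !in_itv. Qed.

Lemma rect_contractible a b c d : a <= b -> c <= d ->
  compact_contractible R (set_type (rect a b c d)).
Proof.
move=> ab cd; apply: (@star_compact_contractible _ _ _ (a, c)).
- by apply: compact_setX; exact: segment_compact.
- by rewrite rectE !lexx ab cd.
- move=> [x y] s; rewrite rectE => -[/andP[x1 x2] /andP[y1 y2]] /andP[s0 s1].
  rewrite -[_ + _]/(a + s * (x - a), c + s * (y - c)) rectE.
  by split; apply/andP; split; nra.
Qed.

Definition clip (a b x : R) : R := Num.max a (Num.min b x).

Lemma clip_itv a b x : a <= b -> a <= clip a b x <= b.
Proof. by move=> ab; rewrite /clip le_max lexx/= ge_max ab ge_min lexx. Qed.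

Lemma clip_id a b x : a <= x <= b -> clip a b x = x.
Proof. by move=> /andP[s0 s1]; rewrite /clip (min_r s1) (max_r s0). Qed.

Lemma clip_continuous a b : continuous (clip a b).
Proof.
by apply: cts_max; [exact: cst_continuous|apply: cts_min; [exact: cst_continuous|exact: cts_id]].
Qed.

(** Lets arguments and lifts found on the subtype be extended to continuous maps on the whole plane,
    so that later statements avoid subtypes. *)
Lemma rect_retraction a b c d : a <= b -> c <= d ->
  exists r : R * R -> set_type (rect a b c d), continuous r /\
    forall p, rect a b c d p -> set_val (r p) = p.
Proof.
move=> ab cd.
have h (p : R * R) : (clip a b p.1, clip c d p.2) \in rect a b c d.
  by apply/mem_set; rewrite rectE; split; exact: clip_itv.
exists (fun p => exist (fun p => p \in rect a b c d) _ (h p)); split.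
  apply: continuous_set_type.
  apply: cts_pair; apply: (cts_comp (@clip_continuous _ _)); [exact: cts_fst|exact: cts_snd].
move=> [x y]; rewrite rectE => -[xab ycd].
by transitivity (clip a b x, clip c d y) => //; rewrite !clip_id.
Qed.

Lemma rect_angle (u : R * R -> C) a b c d : a <= b -> c <= d ->
  ccontinuous u -> (forall p, rect a b c d p -> u p != 0) ->
  exists th : R * R -> R, continuous th /\ forall p, rect a b c d p -> is_arg (u p) (th p).
Proof.
move=> ab cd cu u0; have [r [cr rE]] := rect_retraction ab cd.
have [||th [cth thE]] := @angle_lift R _ (rect_contractible ab cd) (fun x => u (set_val x)).
- exact: (ccontinuous_comp cu (@set_val_continuous _ _)).
- by move=> x; apply: u0; exact: set_valP.
exists (fun p => th (r p)); split; first exact: cts_comp.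
by move=> p rp; rewrite -{1}(rE p rp).
Qed.

Lemma segment_angle (u : R -> C) a b : a <= b ->
  ccontinuous u -> (forall x, a <= x <= b -> u x != 0) ->
  exists th : R -> R, continuous th /\ forall x, a <= x <= b -> is_arg (u x) (th x).
Proof.
move=> ab cu u0; have [||th [cth thE]] := @rect_angle (fun p => u p.1) a b 0 0 ab (lexx _).
- exact: (ccontinuous_comp cu (@cts_fst _ _)).
- by move=> [x y]; rewrite rectE => -[xab _]; exact: u0.
exists (fun x => th (x, 0)); split.
  by apply: (cts_comp cth); apply: cts_pair; [exact: cts_id|exact: cst_continuous].
by move=> x xab; apply: (thE (x, 0)); rewrite rectE lexx.
Qed.

Lemma segment_angle_unique (u : R -> C) (th th' : R -> R) a b x y :
  a <= x <= b -> a <= y <= b -> continuous th -> continuous th' ->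
  (forall x, a <= x <= b -> is_arg (u x) (th x)) ->
  (forall x, a <= x <= b -> is_arg (u x) (th' x)) ->
  th x - th y = th' x - th' y.
Proof.
move=> xab yab c c' h h'; have ab : a <= b by case/andP: xab; exact: le_trans.
have cX := rect_contractible ab (lexx 0).
have mem z : a <= z <= b -> (z, 0) \in rect a b 0 0.
  by move=> zab; apply/mem_set; rewrite rectE lexx.
pose i z zab : set_type (rect a b 0 0) := exist (fun p => p \in rect a b 0 0) _ (mem z zab).
have cf : continuous (fun p : set_type (rect a b 0 0) => (set_val p).1).
  exact: (cts_comp (@cts_fst _ _) (@set_val_continuous _ _)).
have P (p : set_type (rect a b 0 0)) : a <= (set_val p).1 <= b.
  by case: (p) => -[s t] /= /set_mem; rewrite rectE => -[].
exact: (arg_increment_unique cX (u := fun p => u (set_val p).1)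
  (th := fun p => th (set_val p).1) (th' := fun p => th' (set_val p).1)
  (cts_comp c cf) (cts_comp c' cf) (fun p => h _ (P p)) (fun p => h' _ (P p))
  (i x xab) (i y yab)).
Qed.

Lemma rect_lift (s : R * R -> S2) a b c d : a <= b -> c <= d -> continuous s ->
  exists w : R * R -> C * C, lift_continuous w /\
    forall p, rect a b c d p -> is_lift (set_val (s p)) (w p).
Proof.
move=> ab cd cs; have [r [cr rE]] := rect_retraction ab cd.
have [|w [cw wE]] := @lifts_exists R _ (fun x => s (set_val x)) (rect_contractible ab cd).
  exact: (cts_comp cs (@set_val_continuous _ _)).
exists (fun p => w (r p)); split; first exact: lift_continuous_comp.
by move=> p rp; rewrite -{1}(rE p rp).
Qed.

End Rectangles.

(** * Angle and height as coordinates on the sphere *)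

Section Parametrization.
Variable R : realType.
Local Notation C := R[i].
Local Notation S2 := (set_type (@sphere R)).

Definition lat_radius (h : R) : R := Num.sqrt (h * (1 - h)).

Lemma lat_radius_sqr h : 0 <= h <= 1 -> lat_radius h ^+ 2 = h * (1 - h).
Proof. by move=> /andP[h0 h1]; rewrite sqr_sqrtr// mulr_ge0// subr_ge0. Qed.

Lemma lat_radius_gt0 h : 0 < h < 1 -> 0 < lat_radius h.
Proof. by move=> /andP[h0 h1]; rewrite sqrtr_gt0 mulr_gt0// subr_gt0. Qed.

Definition sph_vec (a h : R) : 'rV[R]_3 :=
  \row_i [:: lat_radius (clamp h) * cos a; lat_radius (clamp h) * sin a; clamp h]`_i.

Lemma sph_subproof a h : sph_vec a h \in @sphere R.
Proof.
apply/mem_set; rewrite /sphere/= /height !mxE/=.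
have := lat_radius_sqr (clamp_itv h); set r := lat_radius _; set k := clamp h => rk.
by rewrite !exprMn -mulrDr cos2Dsin2 mulr1 rk; lra.
Qed.

(* The height is clamped to [0, 1]. *)
Definition sph (a h : R) : S2 := exist (fun p => p \in @sphere R) _ (sph_subproof a h).

Lemma height_sph a h : height (set_val (sph a h)) = clamp h.
Proof. by rewrite /height /= mxE. Qed.

Lemma sph_continuous : continuous (fun p : R * R => sph p.1 p.2).
Proof.
apply: continuous_set_type; apply: cts_mx => i j; under eq_fun do rewrite mxE.
have cc : continuous (fun p : R * R => clamp p.2).
  exact: (cts_comp (@clamp_continuous R) (@cts_snd _ _)).
have cr : continuous (fun p : R * R => lat_radius (clamp p.2)).
  by apply: (cts_comp (@sqrt_continuous R)); cts.
by case: j => [[|[|[|//]]] ?] /=; cts.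
Qed.

Lemma sph_2pi a h (k : int) : sph (a + k%:~R * (2 * pi)) h = sph a h.
Proof.
by apply: val_inj; apply/rowP => i; rewrite !mxE cos2pi_int sin2pi_int.
Qed.

Lemma sph_south a b : sph a 0 = sph b 0.
Proof.
apply: val_inj; apply/rowP => i; rewrite !mxE /lat_radius clamp_id ?lexx ?ler01//.
by rewrite mul0r sqrtr0 !mul0r.
Qed.

Lemma sph_north a b : sph a 1 = sph b 1.
Proof.
apply: val_inj; apply/rowP => i; rewrite !mxE /lat_radius clamp_id ?lexx ?ler01//.
by rewrite subrr mulr0 sqrtr0 !mul0r.
Qed.

End Parametrization.

(** * The sphere as a square with identified sides *)

Section FundamentalCycle.
Variable R : realType.
Local Notation C := R[i].
Local Notation S2 := (set_type (@sphere R)).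
Local Notation D n := (set_type (@simplex R n)).

Definition sph_turn (p : R * R) : S2 := sph (p.1 * (2 * pi)) p.2.

Lemma sph_turn_continuous : continuous sph_turn.
Proof.
apply: (@cts_comp (R * R)%type _ _ (fun p : R * R => sph p.1 p.2) (fun p => (p.1 * (2 * pi), p.2))).
  exact: sph_continuous.
by cts.
Qed.

Lemma sph_turn1 h : sph_turn (1, h) = sph_turn (0, h).
Proof. by rewrite /sph_turn/= mul0r -(sph_2pi 0 h 1) add0r. Qed.

Lemma sph_turn_bottom t : sph_turn (t, 0) = sph_turn (0, 0).
Proof. exact: sph_south. Qed.

Lemma sph_turn_top t : sph_turn (t, 1) = sph_turn (0, 1).
Proof. exact: sph_north. Qed.

Lemma coord_D_continuous n i : continuous (fun x : D n => set_val x 0 i).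
Proof. by apply: cts_coord; exact: set_val_continuous. Qed.

(* The unit square cut along its diagonal: the vertices are (0,0), (1,0), (1,1),
   resp. (0,0), (0,1), (1,1). *)
Definition lower_triangle (x : D 2) : R * R := (set_val x 0 1 + set_val x 0 ord_max, set_val x 0 ord_max).
Definition upper_triangle (x : D 2) : R * R := (set_val x 0 ord_max, set_val x 0 1 + set_val x 0 ord_max).

Lemma lower_triangle_continuous : continuous lower_triangle.
Proof. by apply: cts_pair; first apply: ctsD; exact: coord_D_continuous. Qed.

Lemma upper_triangle_continuous : continuous upper_triangle.
Proof. by apply: cts_pair; last apply: ctsD; exact: coord_D_continuous. Qed.

Definition lower_simplex : singular_simplex R 2 S2 :=
  mkcts (cts_comp sph_turn_continuous lower_triangle_continuous).
Definition upper_simplex : singular_simplex R 2 S2 :=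
  mkcts (cts_comp sph_turn_continuous upper_triangle_continuous).
Definition const_simplex n (p : S2) : singular_simplex R n S2 :=
  mkcts (@cst_continuous (D n) S2 p).

(* The constant simplices cancel the bottom and top edges of the square, which are
   collapsed to the poles. *)
Definition fundamental : chain R 2 S2 :=
  << lower_simplex >> - << upper_simplex >>
  - (<< const_simplex 2 (sph_turn (0, 0)) >> - << const_simplex 2 (sph_turn (0, 1)) >>).

Lemma simplex1_coord0 (x : D 1) : set_val x 0 ord0 = 1 - set_val x 0 1.
Proof.
have [_] : simplex (set_val x) by exact: set_valP.
rewrite !big_ord_recl big_ord0 addr0 => <-.
by rewrite (_ : fintype.lift ord0 ord0 = 1) ?addrK//; exact: val_inj.
Qed.

Lemma simplex1_itv (x : D 1) : 0 <= set_val x 0 1 <= 1.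
Proof.
have [x0 _] : simplex (set_val x) by exact: set_valP.
by have := x0 ord0; have := x0 1; rewrite simplex1_coord0 => -> h; rewrite -subr_ge0.
Qed.

Lemma face_coord n (i : 'I_n.+2) (x : D n) j k : fintype.lift i k = j ->
  set_val (face i x) 0 j = set_val x 0 k.
Proof. by move=> <-; rewrite /= mxE liftK. Qed.

Lemma face_coord0 n (i : 'I_n.+2) (x : D n) : set_val (face i x) 0 i = 0.
Proof. by rewrite /= mxE unlift_none. Qed.

Lemma lower_face0 (x : D 1) : lower_triangle (face ord0 x) = (1, set_val x 0 1).
Proof.
rewrite /lower_triangle (@face_coord _ _ _ 1 ord0); last exact: val_inj.
rewrite (@face_coord _ _ _ ord_max 1); last exact: val_inj.
by rewrite simplex1_coord0 subrK.
Qed.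

Lemma lower_face1 (x : D 1) : lower_triangle (face 1 x) = (set_val x 0 1, set_val x 0 1).
Proof.
rewrite /lower_triangle face_coord0 add0r.
by rewrite (@face_coord _ _ _ ord_max 1)//; exact: val_inj.
Qed.

Lemma lower_face2 (x : D 1) : lower_triangle (face ord_max x) = (set_val x 0 1, 0).
Proof.
rewrite /lower_triangle face_coord0 addr0.
by rewrite (@face_coord _ _ _ 1 1)//; exact: val_inj.
Qed.

Lemma upper_face i (x : D 1) : upper_triangle (face i x) =
  ((lower_triangle (face i x)).2, (lower_triangle (face i x)).1).
Proof. by []. Qed.

Lemma boundary2 (s : singular_simplex R 2 S2) :
  @boundary R 1 S2 << s >> = << (s \o @face R 1 ord0 : singular_simplex R 1 S2) >>
   - << (s \o @face R 1 1 : singular_simplex R 1 S2) >>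
   + << (s \o @face R 1 ord_max : singular_simplex R 1 S2) >>.
Proof.
rewrite /boundary fglift1 !big_ord_recl big_ord0 addr0.
rewrite (_ : fintype.lift ord0 ord0 = 1); last exact: val_inj.
rewrite (_ : fintype.lift ord0 (fintype.lift ord0 ord0) = ord_max); last exact: val_inj.
by rewrite /= expr0 scale1r expr1 scaleN1r /bump/= -signr_odd/= expr0 scale1r addrA.
Qed.

(** The two triangles share the diagonal, and the vertical sides of the square have the same image;
    the bottom and top sides become constant edges, each being the boundary of a constant
    2-simplex. *)
Lemma fundamental_cycle : boundary fundamental = 0.
Proof.
have Bc p : @boundary R 1 S2 << const_simplex 2 p >> = << const_simplex 1 p >>.
  rewrite boundary2; set a := << _ >>; set b := << _ >>; set c := << _ >>.
  have -> : a = << const_simplex 1 p >> by congr << _ >>; exact/continuousEP.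
  have -> : b = << const_simplex 1 p >> by congr << _ >>; exact/continuousEP.
  have -> : c = << const_simplex 1 p >> by congr << _ >>; exact/continuousEP.
  by rewrite subrr add0r.
have sE (s t : singular_simplex R 1 S2) : (forall x, s x = t x) -> << s >> = << t >> :> chain R 1 S2.
  by move=> /continuousEP ->.
rewrite /fundamental /boundary !raddfB /= -!/(@boundary _ _ _ _) !Bc !boundary2.
rewrite (sE (lower_simplex \o face ord0) (upper_simplex \o face ord_max)); last first.
  move=> x; rewrite -[LHS]/(sph_turn (lower_triangle (face ord0 x)))
    -[RHS]/(sph_turn (upper_triangle (face ord_max x))).
  by rewrite upper_face lower_face0 lower_face2 sph_turn1.
rewrite (sE (upper_simplex \o face 1) (lower_simplex \o face 1)); last first.
  move=> x; rewrite -[LHS]/(sph_turn (upper_triangle (face 1 x)))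
    -[RHS]/(sph_turn (lower_triangle (face 1 x))).
  by rewrite upper_face lower_face1.
rewrite (sE (lower_simplex \o face ord_max) (const_simplex 1 (sph_turn (0, 0)))); last first.
  by move=> x; rewrite -[LHS]/(sph_turn (lower_triangle (face ord_max x))) lower_face2 sph_turn_bottom.
rewrite (sE (upper_simplex \o face ord0) (const_simplex 1 (sph_turn (0, 1)))); last first.
  by move=> x; rewrite -[LHS]/(sph_turn (upper_triangle (face ord0 x))) upper_face lower_face0 sph_turn_top.
rewrite !opprD !opprK !addrA [LHS](ACl (1*6*(2*5)*(3*7)*(4*8)))/=.
by rewrite !subrr !addNr !addr0.
Qed.

Section PushforwardEuler.
Variable f : continuousType S2 S2.
Variable w : R * R -> C * C.
Hypothesis cw : lift_continuous w.
Hypothesis lw : forall p, rect 0 1 0 1 p -> is_lift (set_val (f (sph_turn p))) (w p).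

Let edge (e : D 1 -> R * R) : R := edge_angle (fun x => f (sph_turn (e x))) (w \o e).

Lemma triangle_rect (x : D 2) : rect 0 1 0 1 (lower_triangle x) /\ rect 0 1 0 1 (upper_triangle x).
Proof.
have [x0] : simplex (set_val x) by exact: set_valP.
rewrite !big_ord_recl big_ord0 addr0.
rewrite (_ : fintype.lift ord0 ord0 = 1); last exact: val_inj.
rewrite (_ : fintype.lift ord0 (fintype.lift ord0 ord0) = ord_max); last exact: val_inj.
have := x0 ord0; have := x0 1; have := x0 ord_max.
rewrite /lower_triangle /upper_triangle !rectE => *.
by do !split; apply/andP; split; lra.
Qed.

Lemma lifts_edge (X : topologicalType) (e : X -> R * R) : continuous e ->
  (forall x, rect 0 1 0 1 (e x)) -> lifts (fun x => f (sph_turn (e x))) (w \o e).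
Proof. by move=> ce re; split; [exact: lift_continuous_comp|move=> x; exact: lw]. Qed.

Lemma cts_edge (X : topologicalType) (e : X -> R * R) : continuous e ->
  continuous (fun x => f (sph_turn (e x))).
Proof.
move=> ce; apply: (cts_comp (@cts_fun _ _ f)); apply: cts_comp ce.
exact: sph_turn_continuous.
Qed.

Lemma euler_triangle (T : D 2 -> R * R) : continuous T -> (forall x, rect 0 1 0 1 (T x)) ->
  euler (fun x => f (sph_turn (T x))) =
    edge (T \o face ord0) - edge (T \o face 1) + edge (T \o face ord_max).
Proof.
move=> cT rT; rewrite (euler_lift (cts_edge cT) (lifts_edge cT rT)) /boundary_angle.
rewrite !big_ord_recl big_ord0 addr0.
rewrite (_ : fintype.lift ord0 ord0 = 1); last exact: val_inj.
rewrite (_ : fintype.lift ord0 (fintype.lift ord0 ord0) = ord_max); last exact: val_inj.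
by rewrite /= expr0 mul1r expr1 mulN1r /bump/= -signr_odd/= expr0 mul1r addrA.
Qed.

Lemma euler_const (p : R * R) : rect 0 1 0 1 p ->
  euler (fun=> f (sph_turn p)) = edge (fun=> p).
Proof.
move=> rp; rewrite (@euler_triangle (fun=> p))//; first by rewrite subrr add0r.
exact: cst_continuous.
Qed.

(** Two paths in the square may have the same image on the sphere; [w] then provides two lifts of
    this image, and [th] records how they turn relative to each other. *)
Lemma edge_change (e e' : D 1 -> R * R) (u : R -> C) (th : R -> R) : continuous e -> continuous e' ->
  (forall x, rect 0 1 0 1 (e x)) -> (forall x, rect 0 1 0 1 (e' x)) ->
  (forall x, sph_turn (e x) = sph_turn (e' x)) ->
  (forall x, herm (w (e x)) (w (e' x)) = u (set_val x 0 1)) ->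
  continuous th -> (forall t, 0 <= t <= 1 -> is_arg (u t) (th t)) ->
  edge e' = edge e + (th 1 - th 0).
Proof.
move=> ce ce' re re' ee uE cth thE.
have sE : (fun x => f (sph_turn (e x))) = (fun x => f (sph_turn (e' x))).
  by apply/funext => x; rewrite ee.
have l := lifts_edge ce re; have := lifts_edge ce' re'; rewrite -sE => l'.
rewrite /edge -sE (edge_angle_change _ l l'); last exact: cts_edge.
congr (_ + _); rewrite (@arg_incrementE _ _ (simplex_contractible R 1) _ (fun x => th (set_val x 0 1))).
- by rewrite /= !mxE /=.
- exact: (cts_comp cth (@coord_D_continuous 1 1)).
- by apply: ccontinuous_herm; [case: l|case: l'].
- by move=> x; rewrite /= uE; apply: thE; exact: simplex1_itv.
Qed.

(** The diagonal cancels. The right side is compared with the left one through [mu]; the bottom and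
    top sides are compared with constant edges through [beta] and [tau], so that no chosen lift is
    left in the result. *)
Lemma euler_pushforward (beta mu tau : R -> R) :
  continuous beta -> continuous mu -> continuous tau ->
  (forall t, 0 <= t <= 1 -> is_arg (herm (w (0, 0)) (w (t, 0))) (beta t)) ->
  (forall t, 0 <= t <= 1 -> is_arg (herm (w (0, t)) (w (1, t))) (mu t)) ->
  (forall t, 0 <= t <= 1 -> is_arg (herm (w (0, 1)) (w (t, 1))) (tau t)) ->
  euler_chain (Defs.pushforward f fundamental) =
    (beta 1 - beta 0) + (mu 1 - mu 0) - (tau 1 - tau 0).
Proof.
move=> cb cm ct hb hm ht.
have -> : euler_chain (Defs.pushforward f fundamental) =
  euler (fun x => f (sph_turn (lower_triangle x))) - euler (fun x => f (sph_turn (upper_triangle x)))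
  - (euler (fun=> f (sph_turn (0, 0))) - euler (fun=> f (sph_turn (0, 1)))).
  by rewrite /euler_chain /Defs.pushforward /fundamental !raddfB /= !fglift1.
have cx : continuous (fun x : D 1 => set_val x 0 1) by exact: coord_D_continuous.
have r0 : 0 <= (0 : R) <= 1 by rewrite lexx ler01.
have r1 : 0 <= (1 : R) <= 1 by rewrite lexx ler01.
rewrite !euler_const ?rectE ?r0 ?r1//.
rewrite (euler_triangle lower_triangle_continuous (fun x => (triangle_rect x).1)).
rewrite (euler_triangle upper_triangle_continuous (fun x => (triangle_rect x).2)).
have eE (e e' : D 1 -> R * R) : e =1 e' -> edge e = edge e' by move=> /funext ->.
rewrite (eE _ _ lower_face0) (eE _ _ lower_face1) (eE _ _ lower_face2).
rewrite (eE (upper_triangle \o _) (fun x => (set_val x 0 1, 1))); last first.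
  by move=> x; rewrite /= upper_face lower_face0.
rewrite (eE (upper_triangle \o face 1) (fun x => (set_val x 0 1, set_val x 0 1))); last first.
  by move=> x; rewrite /= upper_face lower_face1.
rewrite (eE (upper_triangle \o _) (fun x => (0, set_val x 0 1))); last first.
  by move=> x; rewrite /= upper_face lower_face2.
rewrite (_ : edge (fun x => (set_val x 0 1, 0)) = edge (fun=> (0, 0)) + (beta 1 - beta 0)); last first.
  apply: (@edge_change _ _ (fun t => herm (w (0, 0)) (w (t, 0)))) => //; do ?[by cts];
    try (by move=> x; rewrite rectE ?simplex1_itv ?r0 ?r1).
  by move=> x; rewrite [RHS]sph_turn_bottom.
rewrite (_ : edge (fun x => (set_val x 0 1, 1)) = edge (fun=> (0, 1)) + (tau 1 - tau 0)); last first.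
  apply: (@edge_change _ _ (fun t => herm (w (0, 1)) (w (t, 1)))) => //; do ?[by cts];
    try (by move=> x; rewrite rectE ?simplex1_itv ?r0 ?r1).
  by move=> x; rewrite [RHS]sph_turn_top.
rewrite (_ : edge (fun x => (1, set_val x 0 1)) = edge (fun x => (0, set_val x 0 1)) + (mu 1 - mu 0)); last first.
  apply: (@edge_change _ _ (fun t => herm (w (0, t)) (w (1, t)))) => //; do ?[by cts];
    try (by move=> x; rewrite rectE ?simplex1_itv ?r0 ?r1).
  by move=> x; rewrite sph_turn1.
by ring.
Qed.

End PushforwardEuler.

End FundamentalCycle.

(** * Degree of a latitude-preserving map *)

Section CircleLift.
Variable R : realType.
Local Notation C := R[i].
Local Notation S2 := (set_type (@sphere R)).

(** The line is not compact, so arguments on the segments $[-n,n]$ are glued. *)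
Lemma line_angle (u : R -> C) : ccontinuous u -> (forall x, u x != 0) ->
  exists th : R -> R, continuous th /\ forall x, is_arg (u x) (th x).
Proof.
move=> cu u0.
have ex (n : nat) : exists th : R -> R,
    continuous th /\ forall x, - n%:R <= x <= n%:R -> is_arg (u x) (th x).
  by apply: segment_angle => //; rewrite -subr_ge0 opprK addr_ge0.
have [Th ThP] := choice ex.
(* Normalized to take the same value at 0 for every [n]; the correction is a multiple of $2\pi$, so
   [T n] is still an argument and agrees with [T m] on the smaller segment. *)
pose T n x := Th n x - Th n 0 + Th 0%N 0.
have in0 (n : nat) : - n%:R <= (0 : R) <= n%:R by rewrite oppr_le0 !ler0n.
have cT n : continuous (T n) by have [c _] := ThP n; rewrite /T; cts.
have aT n x : - n%:R <= x <= n%:R -> is_arg (u x) (T n x).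
  move=> xn; have [_ a] := ThP n; have [_ a0] := ThP 0%N.
  have [k kE] := is_arg_eq (a0 0 (in0 _)) (a 0 (in0 _)).
  rewrite /T kE (_ : _ - _ + _ = Th n x + k%:~R * (2 * pi)); last by ring.
  by apply: is_arg_add2pi; exact: a.
have TT (n m : nat) x : (n <= m)%N -> - n%:R <= x <= n%:R -> T n x = T m x.
  move=> nm xn; have nmR : n%:R <= m%:R :> R by rewrite ler_nat.
  have := @segment_angle_unique _ u (T n) (T m) (- n%:R) n%:R x 0 xn (in0 n) (cT n) (cT m) (aT n).
  rewrite /T => h; suff : Th n x - Th n 0 + Th 0%N 0 - (Th n 0 - Th n 0 + Th 0%N 0) =
     Th m x - Th m 0 + Th 0%N 0 - (Th m 0 - Th m 0 + Th 0%N 0) by lra.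
  apply: h => y /andP[y1 y2]; apply: aT; apply/andP; split; lra.
pose N (x : R) := (Num.truncn `|x|).+1.
have NP x : - (N x)%:R <= x <= (N x)%:R.
  by rewrite -ler_norml ltW// truncnS_gt.
exists (fun x => T (N x) x); split; last by move=> x; apply: aT.
move=> x0; pose M := (N x0).+1.
have ev : \forall x \near x0, T M x = T (N x) x.
  near=> x.
  have xM : `|x| < M%:R.
    have h1 : `|x0| < (N x0)%:R by rewrite truncnS_gt.
    have h2 : `|x - x0| < 1 by rewrite distrC; near: x; apply: nbhsx_ballx.
    rewrite /M -natr1 (le_lt_trans _ (ltrD h1 h2))//.
    by rewrite -[X in `|X| <= _](subrK x0) addrC ler_normD.
  by apply/esym/TT => //; rewrite /N /M ltnS truncn_le_nat.
have := cT M x0; rewrite /continuous_at (nbhs_singleton ev) => h.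
apply: cvg_trans h; exact: near_eq_cvg.
Unshelve. all: by end_near. Qed.

Lemma horiz_sph a h : horiz (set_val (sph a h)) =
  ((lat_radius (clamp h))%:C * (cos a +i* sin a))%C :> C.
Proof. by apply: complexP; rewrite ?complexReM ?complexImM /horiz/= !mxE /=; ring. Qed.

Lemma horiz_neq0 (p : S2) : 0 < height (set_val p) < 1 -> horiz (set_val p) != 0.
Proof.
move=> /andP[h0 h1]; have := horiz_conj (set_valP p).
apply: contra_eq_neq => ->; rewrite mul0r eq_sym mulf_eq0 negb_or.
by rewrite !eq_complex/= !negb_and subr_eq0 ![_ == height _]eq_sym (gt_eqF h0) (lt_eqF h1).
Qed.

Lemma height_itv (p : S2) : 0 <= height (set_val p) <= 1.
Proof.
have : sphere (set_val p) by exact: set_valP.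
rewrite /sphere/=; set h := height _ => e.
have := sqr_ge0 (set_val p 0 0); have := sqr_ge0 (set_val p 0 1).
by move=> *; apply/andP; split; nra.
Qed.

Lemma is_arg_sph (p : S2) a : is_arg (horiz (set_val p)) a -> p = sph a (height (set_val p)).
Proof.
move=> [r [r0 /= x y]]; have h01 := height_itv p.
have := horiz_conj (set_valP p) => /(congr1 (@complex.Re R)).
rewrite !complexReM/= x y => e.
have rE : r = lat_radius (height (set_val p)).
  have : r ^+ 2 = lat_radius (height (set_val p)) ^+ 2.
    rewrite lat_radius_sqr//.
    transitivity (r ^+ 2 * (cos a ^+ 2 + sin a ^+ 2)); first by rewrite cos2Dsin2 mulr1.
    by move: e; rewrite !mulr0 subr0 => e; rewrite -[RHS]e; ring.
  by move/eqP; rewrite eqrXn2 ?sqrtr_ge0 ?ltW// => /eqP.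
apply: val_inj; apply/rowP => j; rewrite /= mxE clamp_id// -rE -x -y.
case: j => [[|[|[|//]]] i] /=; congr (set_val p _ _); exact: val_inj.
Qed.

(* [f] maps the latitude of height [h] to the one of height [k], with winding number [d]. *)
Definition winds (f : S2 -> S2) (h k : R) (d : int) : Prop :=
  exists F : R -> R, [/\ continuous F, forall a, f (sph a h) = sph (F a) k
    & forall a, F (a + 2 * pi) = F a + d%:~R * (2 * pi)].

Lemma winds_exists (f : S2 -> S2) h k : continuous f ->
  (forall a, height (set_val (f (sph a h))) = k) -> 0 < k < 1 -> exists d, winds f h k d.
Proof.
move=> cf hk k01.
have cs : continuous (fun a => set_val (f (sph a h))).
  apply: (cts_comp (@set_val_continuous _ _)); apply: (cts_comp cf).
  by apply: (cts_comp (@sph_continuous R) (g := fun a => (a, h))); cts.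
have [||F [cF aF]] := @line_angle (fun a => horiz (set_val (f (sph a h)))).
- by split; exact: cts_coord.
- by move=> a; apply: horiz_neq0; rewrite hk.
have per a : f (sph (a + 2 * pi) h) = f (sph a h).
  by rewrite -(sph_2pi a h 1) mul1r.
have [d dE] : exists d : int, F (0 + 2 * pi) = F 0 + d%:~R * (2 * pi).
  by apply: (is_arg_eq (aF _)); rewrite per.
exists d, F; split=> // [a|a]; first by rewrite -(hk a); exact: is_arg_sph.
have cF' : continuous (fun a => F (a + 2 * pi)) by apply: (cts_comp cF); cts.
(* [F] and its translate by $2\pi$ are arguments of the same function on the segment spanned by 0
   and [a], so their difference at [a] is the one at 0, which defines [d]. *)
have := @segment_angle_unique R (fun a => horiz (set_val (f (sph a h)))) F
  (fun a => F (a + 2 * pi)) (Num.min 0 a) (Num.max 0 a) a 0.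
rewrite !ge_min !le_max !lexx !orbT/= => /(_ isT isT cF cF') h'.
have := h' (fun x _ => aF x) (fun x _ => _ ); rewrite dE.
case/(_ _)/Wrap; last by lra.
by move=> x; rewrite -per.
Qed.

End CircleLift.

Section Turn.
Variable R : realType.
Local Notation C := R[i].

Definition angle_along (u : R -> C) : R -> R :=
  xget (fun=> 0) [set th | continuous th /\ forall t, 0 <= t <= 1 -> is_arg (u t) (th t)].

Definition turn (u : R -> C) : R := angle_along u 1 - angle_along u 0.

Lemma turnE (u : R -> C) (th : R -> R) : continuous th ->
  (forall t, 0 <= t <= 1 -> is_arg (u t) (th t)) -> turn u = th 1 - th 0.
Proof.
move=> cth a; rewrite /turn /angle_along.
case: xgetP => [th' _ [c' a']|/(_ th)]; last by case.
by apply: (segment_angle_unique (a := 0) (b := 1) (u := u)); rewrite ?lexx ?ler01.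
Qed.

End Turn.

Section DegreeByLatitudes.
Variable R : realType.
Local Notation C := R[i].
Local Notation S2 := (set_type (@sphere R)).

(** If [w'] is [c] times [w], then [herm w w'] is [c] times [herm w w]. Hence each coordinate turns
    from [w] to [w'] by exactly the argument of [herm w w']. *)
Lemma herm_mul (p : 'rV[R]_3) w w' : is_lift p w -> is_lift p w' ->
  herm w w' * w.1 = herm w w * w'.1 /\ herm w w' * w.2 = herm w w * w'.2.
Proof.
move=> l l'; have e := is_lift_collinear l l'; rewrite /herm.
set a := conjc _; set b := conjc _; split; rewrite !mulrDl; congr (_ + _).
- exact: mulrAC.
- by rewrite -!mulrA [w'.2 * _]mulrC e.
- by rewrite -!mulrA [w'.1 * _]mulrC -e.
- exact: mulrAC.
Qed.

Lemma is_lift1_neq0 (p : 'rV[R]_3) w : is_lift p w -> 0 < height p -> w.1 != 0.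
Proof.
move=> [w0 _ e] h0; apply: contra w0 => /eqP w1; move/eqP: e.
rewrite w1 mulr0 eq_sym mulf_eq0 eq_complex/= (gt_eqF h0)/= => /eqP w2.
by case: w w1 w2 => a b /= -> ->.
Qed.

Lemma is_lift2_neq0 (p : 'rV[R]_3) w : is_lift p w -> height p < 1 -> w.2 != 0.
Proof.
move=> [w0 e _] h0; apply: contra w0 => /eqP w2; move/eqP: e.
rewrite w2 mulr0 eq_sym mulf_eq0 eq_complex/= subr_eq0 (gt_eqF h0)/= => /eqP w1.
by case: w w1 w2 => a b /= -> ->.
Qed.

Variable f : continuousType S2 S2.
Variable g : R -> R.
Hypothesis fg : forall a h, height (set_val (f (sph a h))) = g h.
Variable w : R * R -> C * C.
Hypothesis cw : lift_continuous w.
Hypothesis lw : forall p, rect 0 1 0 1 p -> is_lift (set_val (f (sph_turn p))) (w p).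
Variable mu : R -> R.
Hypothesis cmu : continuous mu.
Hypothesis amu : forall t, 0 <= t <= 1 -> is_arg (herm (w (0, t)) (w (1, t))) (mu t).

Let fg' p : height (set_val (f (sph_turn p))) = g p.2.
Proof. exact: fg. Qed.

Lemma is_arg_herm (p : 'rV[R]_3) v v' (pr : C * C -> C) a b :
  is_lift p v -> is_lift p v' -> herm v v' * pr v = herm v v * pr v' ->
  is_arg (herm v v') a -> is_arg (pr v) b -> is_arg (pr v') (a + b).
Proof.
move=> [v0 _ _] _ e ha hb; have [r r0 rE] := herm_self v0.
by apply/(is_argZ _ _ r0); rewrite -rE -e; exact: is_argM.
Qed.

Lemma is_lift_eq_sph (p q : R * R) : sph_turn p = sph_turn q ->
  rect 0 1 0 1 p -> rect 0 1 0 1 q ->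
  is_lift (set_val (f (sph_turn p))) (w p) /\ is_lift (set_val (f (sph_turn p))) (w q).
Proof. by move=> pq rp rq; split; [|rewrite pq]; exact: lw. Qed.

(* [pr] is one of the two coordinates of C^2, and [ok h] says that it does not
   vanish on the lifts of points of height [h]. *)
Section Coordinate.
Variables (pr : C * C -> C) (ok : R -> Prop).
Hypothesis pr_cont : forall (X : topologicalType) (v : X -> C * C),
  lift_continuous v -> ccontinuous (fun x => pr (v x)).
Hypothesis pr_neq0 : forall p v, is_lift p v -> ok (height p) -> pr v != 0.
Hypothesis pr_herm : forall p v v', is_lift p v -> is_lift p v' ->
  herm v v' * pr v = herm v v * pr v'.

Let V s := turn (fun t => pr (w (t, s))).

(** For [s] at a pole of the source: the whole side of the square goes to one point, so the vectors
    [w (t, s)] lie on one line and their coordinate turns as [herm] does. *)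
Lemma turn_herm s (th : R -> R) : 0 <= s <= 1 -> ok (g s) ->
  (forall t, sph_turn (t, s) = sph_turn (0, s)) -> continuous th ->
  (forall t, 0 <= t <= 1 -> is_arg (herm (w (0, s)) (w (t, s))) (th t)) ->
  V s = th 1 - th 0.
Proof.
move=> s01 gs st cth ath.
have r0 : rect 0 1 0 1 (0, s) by rewrite rectE lexx ler01.
have [a aE] : exists a, is_arg (pr (w (0, s))) a.
  have [||a [_ aE]] := @segment_angle R (fun=> pr (w (0, s))) 0 0 (lexx _).
  - exact: ccontinuous_cst.
  - by move=> _ _; apply: (pr_neq0 (lw r0)); rewrite fg'.
  by exists (a 0); apply: aE; rewrite lexx.
rewrite /V (@turnE _ _ (fun t => th t + a)); first by ring.
- by cts.
- move=> t t01; have rt : rect 0 1 0 1 (t, s) by rewrite rectE.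
  have [l l'] := is_lift_eq_sph (esym (st t)) r0 rt.
  exact: (is_arg_herm l l' (pr_herm l l') (ath t t01) aE).
Qed.

(** The coordinate has a continuous argument [th] on the strip between the heights [s] and [s']. On
    its right side, [th (1, x)] and [mu x + th (0, x)] are arguments of the same function, so they
    differ by a constant. *)
Lemma turn_constant s s' : 0 <= s -> s <= s' -> s' <= 1 ->
  (forall x, s <= x <= s' -> ok (g x)) -> mu s - V s = mu s' - V s'.
Proof.
move=> s0 ss' s1 gx.
have sub t x : 0 <= t <= 1 -> s <= x <= s' -> rect 0 1 0 1 (t, x).
  move=> t01 /andP[x1 x2]; rewrite rectE; split=> //.
  by rewrite (le_trans s0 x1) (le_trans x2 s1).
have [||th [cth aE]] := @rect_angle R (fun p => pr (w p)) 0 1 s s' ler01 ss'.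
- exact: pr_cont.
- move=> [t x]; rewrite rectE => -[t01 x01]; apply: (pr_neq0 (lw (sub _ _ t01 x01))).
  by rewrite fg'; exact: gx.
have VE x : s <= x <= s' -> V x = th (1, x) - th (0, x).
  move=> xs; rewrite /V (@turnE _ _ (fun t => th (t, x)))//.
    by apply: (cts_comp cth); cts.
  by move=> t t01; apply: aE; rewrite rectE.
have sI : s <= s <= s' by rewrite lexx ss'.
have s'I : s <= s' <= s' by rewrite lexx ss'.
have r0 : 0 <= (0 : R) <= 1 by rewrite lexx ler01.
have r1 : 0 <= (1 : R) <= 1 by rewrite lexx ler01.
rewrite !VE//.
have := @segment_angle_unique R (fun x => pr (w (1, x))) (fun x => mu x + th (0, x))
  (fun x => th (1, x)) s s' s s' sI s'I.
suff H : (forall x, s <= x <= s' -> is_arg (pr (w (1, x))) (mu x + th (0, x))).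
  have c1 : continuous (fun x => mu x + th (0, x)).
    by apply: ctsD => //; apply: (cts_comp cth); cts.
  have c2 : continuous (fun x => th (1, x)) by apply: (cts_comp cth); cts.
  move=> /(_ c1 c2 H) => h; suff : mu s + th (0, s) - (mu s' + th (0, s')) = th (1, s) - th (1, s') by lra.
  by apply: h => x xs; apply: aE; rewrite rectE.
move=> x xs; have [l l'] := is_lift_eq_sph (esym (sph_turn1 x)) (sub _ _ r0 xs) (sub _ _ r1 xs).
apply: (is_arg_herm l l' (pr_herm l l') _ _).
  by apply: amu; have := sub _ _ r0 xs; rewrite rectE => -[].
by apply: aE; rewrite rectE.
Qed.

End Coordinate.

Let V1 s := turn (fun t => (w (t, s)).1).
Let V2 s := turn (fun t => (w (t, s)).2).

(** The equation of the line gives the first coordinate as a positive multiple of the second times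
    [horiz], and the argument of [horiz] along the image latitude is [F]. *)
Lemma turn_winds s d : 0 <= s <= 1 -> 0 < g s < 1 -> winds f s (g s) d ->
  V1 s = V2 s + d%:~R * (2 * pi).
Proof.
move=> s01 gs [F [cF fF FE]]; have /andP[g0 g1] := gs.
have [||th [cth aE]] := @segment_angle R (fun t => (w (t, s)).2) 0 1 ler01.
- by have [_ c2] := cw; apply: (ccontinuous_comp c2); cts.
- move=> t t01; apply: (@is_lift2_neq0 (set_val (f (sph_turn (t, s))))).
    by apply: lw; rewrite rectE.
  by rewrite fg'.
rewrite /V2 (@turnE _ _ th)// /V1.
rewrite (@turnE _ _ (fun t => th t + F (t * (2 * pi)))).
- by rewrite mul0r mul1r -[in F (2 * pi)](add0r (2 * pi)) FE; ring.
- by apply: ctsD => //; apply: (cts_comp cF); cts.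
- move=> t t01; have := @lw (t, s); rewrite rectE => /(_ (conj t01 s01)) [_ e _].
  have g1' : 0 < 1 - g s by rewrite subr_gt0.
  apply/(is_argZ _ _ g1'); move: e; rewrite fg' => <-.
  rewrite /sph_turn/= fF mulrC; apply: is_argM; first exact: aE.
  rewrite horiz_sph clamp_id; last by rewrite !ltW.
  apply: (is_argZ _ _ (lat_radius_gt0 gs)).1.
  by exists 1; rewrite ltr01 !mul1r.
Qed.

End DegreeByLatitudes.

Section LatitudeDegree.
Variable R : realType.
Local Notation C := R[i].
Local Notation S2 := (set_type (@sphere R)).

(* [m1 s] and [m2 s] are the degree of [f] on the cap below the height [s],
   relatively to the two sections of the Hopf bundle that are defined away from the
   South and from the North pole. *)
Lemma latitude_degree (f : continuousType S2 S2) (g : R -> R) :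
  (forall a h, height (set_val (f (sph a h))) = g h) ->
  exists m1 m2 : R -> R, let c := - euler_chain (Defs.pushforward f (fundamental R)) / (2 * pi) in
  [/\ forall s t, 0 <= s -> s <= t -> t <= 1 -> (forall x, s <= x <= t -> 0 < g x) -> m1 s = m1 t,
      forall s t, 0 <= s -> s <= t -> t <= 1 -> (forall x, s <= x <= t -> g x < 1) -> m2 s = m2 t,
      forall s d, 0 <= s <= 1 -> 0 < g s < 1 -> winds f s (g s) d -> m1 s = m2 s + d%:~R,
      (0 < g 0 -> m1 0 = 0) /\ (g 0 < 1 -> m2 0 = 0)
    & (0 < g 1 -> m1 1 = c) /\ (g 1 < 1 -> m2 1 = c)].
Proof.
move=> fg.
have [|w [cw lw]] := @rect_lift R (fun p => f (sph_turn p)) 0 1 0 1 ler01 ler01.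
  exact: (cts_comp (@cts_fun _ _ f) (@sph_turn_continuous R)).
have fg' p : height (set_val (f (sph_turn p))) = g p.2 by exact: fg.
have r0 : 0 <= (0 : R) <= 1 by rewrite lexx ler01.
have r1 : 0 <= (1 : R) <= 1 by rewrite lexx ler01.
have herm_angle (p q : R -> R * R) : continuous p -> continuous q ->
    (forall t, 0 <= t <= 1 -> rect 0 1 0 1 (p t)) -> (forall t, 0 <= t <= 1 -> rect 0 1 0 1 (q t)) ->
    (forall t, sph_turn (p t) = sph_turn (q t)) ->
    exists th : R -> R, continuous th /\
      forall t, 0 <= t <= 1 -> is_arg (herm (w (p t)) (w (q t))) (th t).
  move=> cp cq rp rq pq; apply: segment_angle; rewrite ?ler01//.
    by apply: ccontinuous_herm; apply: lift_continuous_comp.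
  move=> t t01; have [l l'] := is_lift_eq_sph lw (pq t) (rp t t01) (rq t t01).
  exact: herm_neq0 l l'.
have [beta [cb ab]] : exists th : R -> R, continuous th /\
    forall t, 0 <= t <= 1 -> is_arg (herm (w (0, 0)) (w (t, 0))) (th t).
  apply: (herm_angle (fun t => (0, 0)) (fun t => (t, 0))); do ?[by cts];
    try (by move=> t t01; rewrite rectE ?t01 ?r0 ?r1).
  by move=> t; rewrite [RHS]sph_turn_bottom.
have [mu [cm am]] : exists th : R -> R, continuous th /\
    forall t, 0 <= t <= 1 -> is_arg (herm (w (0, t)) (w (1, t))) (th t).
  apply: (herm_angle (fun t => (0, t)) (fun t => (1, t))); do ?[by cts];
    try (by move=> t t01; rewrite rectE ?t01 ?r0 ?r1).
  by move=> t; rewrite sph_turn1.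
have [tau [ct at_]] : exists th : R -> R, continuous th /\
    forall t, 0 <= t <= 1 -> is_arg (herm (w (0, 1)) (w (t, 1))) (th t).
  apply: (herm_angle (fun t => (0, 1)) (fun t => (t, 1))); do ?[by cts];
    try (by move=> t t01; rewrite rectE ?t01 ?r0 ?r1).
  by move=> t; rewrite [RHS]sph_turn_top.
have eE := euler_pushforward cw lw cb cm ct ab am at_.
pose V1 s := turn (fun t => (w (t, s)).1).
pose V2 s := turn (fun t => (w (t, s)).2).
(* Normalized to vanish at height 0, where the coordinate turns by [beta 1 - beta 0]. At height 1 it
   turns by [tau 1 - tau 0], so the formula becomes the value of the cocycle divided by $-2\pi$. *)
pose m V s := - (mu s - mu 0 - V s + (beta 1 - beta 0)) / (2 * pi).
have h1 (p : 'rV[R]_3) v v' : is_lift p v -> is_lift p v' -> herm v v' * v.1 = herm v v * v'.1.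
  by move=> l l'; have [] := herm_mul l l'.
have h2 (p : 'rV[R]_3) v v' : is_lift p v -> is_lift p v' -> herm v v' * v.2 = herm v v * v'.2.
  by move=> l l'; have [] := herm_mul l l'.
have c1 (X : topologicalType) (v : X -> C * C) : lift_continuous v -> ccontinuous (fun x => (v x).1) by case.
have c2 (X : topologicalType) (v : X -> C * C) : lift_continuous v -> ccontinuous (fun x => (v x).2) by case.
exists (m V1), (m V2); split.
- move=> s t s0 st t1 gx.
  have := turn_constant (ok := fun h => 0 < h) fg cw lw cm am c1 (@is_lift1_neq0 R) h1 s0 st t1 gx.
  by rewrite /m /V1 => h; congr (- _ / _); lra.
- move=> s t s0 st t1 gx.
  have := turn_constant (ok := fun h => h < 1) fg cw lw cm am c2 (@is_lift2_neq0 R) h2 s0 st t1 gx.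
  by rewrite /m /V2 => h; congr (- _ / _); lra.
- move=> s d s01 gs fd; have := turn_winds fg cw lw s01 gs fd.
  rewrite /m -/(V1 s) -/(V2 s) => ->; have := pi_gt0 R.
  by move: (@pi R) => P P0; field; rewrite gt_eqF.
- split=> g0.
  + have := turn_herm (ok := fun h => 0 < h) fg lw (@is_lift1_neq0 R) h1 r0 g0 _ cb ab.
    rewrite /m /V1 => ->; last by move=> t; rewrite sph_turn_bottom.
    by rewrite subrr sub0r addNr oppr0 mul0r.
  + have := turn_herm (ok := fun h => h < 1) fg lw (@is_lift2_neq0 R) h2 r0 g0 _ cb ab.
    rewrite /m /V2 => ->; last by move=> t; rewrite sph_turn_bottom.
    by rewrite subrr sub0r addNr oppr0 mul0r.
- rewrite eE; split=> g0.
  + have := turn_herm (ok := fun h => 0 < h) fg lw (@is_lift1_neq0 R) h1 r1 g0 _ ct at_.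
    rewrite /m /V1 => ->; last by move=> t; rewrite sph_turn_top.
    by congr (- _ / _); ring.
  + have := turn_herm (ok := fun h => h < 1) fg lw (@is_lift2_neq0 R) h2 r1 g0 _ ct at_.
    rewrite /m /V2 => ->; last by move=> t; rewrite sph_turn_top.
    by congr (- _ / _); ring.
Qed.

(** The identity is the test map, with [clamp] as height map: [m2] stays 0 up to the middle
    latitude, the winding number 1 is added there, and [m1] stays 1 up to the top. *)
Lemma euler_fundamental : - euler_chain (fundamental R) / (2 * pi) = 1.
Proof.
have [|m1 [m2 /= [A1 A2 A3 [_ /(_ _)A4] [A5 _]]]] :=
    @latitude_degree (mkcts (@cts_id S2)) (@clamp R).
  by move=> a h; exact: height_sph.
have h01 : 0 <= (2^-1 : R) <= 1 by apply/andP; split; lra.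
have cE x : 0 <= x <= 1 -> clamp x = x :> R by exact: clamp_id.
have <- : - euler_chain (Defs.pushforward (mkcts (@cts_id S2)) (fundamental R)) / (2 * pi) =
    - euler_chain (fundamental R) / (2 * pi).
  by rewrite /euler_chain /Defs.pushforward /fundamental !raddfB /= !fglift1.
have I0 : 0 <= (0 : R) <= 1 by rewrite lexx ler01.
have I1 : 0 <= (1 : R) <= 1 by rewrite lexx ler01.
rewrite -A5 ?cE//.
have <- : m1 2^-1 = m1 1.
  by apply: A1 => [|||x /andP[x0 x1]]; rewrite ?cE; try (apply/andP; split); lra.
have -> : m1 2^-1 = m2 2^-1 + 1%:~R.
  apply: A3 => //; rewrite cE//; first by apply/andP; split; lra.
  by exists id; split=> // [|a]; [exact: cts_id|rewrite mul1r].
have <- : m2 0 = m2 2^-1.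
  by apply: A2 => [|||x /andP[x0 x1]]; rewrite ?cE; try (apply/andP; split); lra.
by rewrite A4 ?add0r// cE.
Qed.

Lemma euler_degree (f : continuousType S2 S2) (d : int) : global_degree f d ->
  - euler_chain (Defs.pushforward f (fundamental R)) / (2 * pi) = d%:~R.
Proof.
move=> fd; have /euler_homologous -> := fd _ (fundamental_cycle R).
rewrite /euler_chain -[in d *: _](intz d) scaler_int raddfMz.
have p0 : 2 * pi != 0 :> R by rewrite mulf_neq0// gt_eqF// pi_gt0.
have : fglift (fun s : singular_simplex R 2 S2 => euler s : zmodule R) (fundamental R) = - (2 * pi).
  have /(congr1 (fun x => - (x * (2 * pi)))) := euler_fundamental.
  by rewrite divfK// opprK mul1r.
by move=> /= ->; rewrite -[_ *~ d](mulrzl (- (2 * pi) : R)) mulrN opprK mulfK.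
Qed.

End LatitudeDegree.

(** * Laps of the height map *)

Section Laps.
Variable R : realType.
Variable g : R -> R.
Hypothesis cg : continuous g.
Hypothesis g01 : forall x, 0 <= g x <= 1.

Lemma cts_gt_ball (f : R -> R) c v : continuous f -> v < f c ->
  exists2 e : R, 0 < e & forall x, `|x - c| < e -> v < f x.
Proof.
move=> cf vc; have := cf c; move/cvgrPdist_lt => /(_ (f c - v)).
rewrite subr_gt0 => /(_ vc) /nbhs_ballP[e /= e0 H]; exists e => // x xc.
have /= := H x; rewrite /ball/= distrC => /(_ xc); rewrite ltr_norml => /andP[_ ?]; lra.
Qed.

Lemma cts_lt_ball (f : R -> R) c v : continuous f -> f c < v ->
  exists2 e : R, 0 < e & forall x, `|x - c| < e -> f x < v.
Proof.
move=> cf vc; have [||e e0 H] := @cts_gt_ball (fun x => - f x) c (- v).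
- by cts.
- by rewrite ltrN2.
by exists e => // x /H; rewrite ltrN2.
Qed.

Definition gap (up : bool) (a b : R) : Prop :=
  [/\ 0 <= a, a < b, b <= 1, g a = (~~ up)%:R /\ g b = up%:R
    & forall x, a < x < b -> 0 < g x < 1].

Lemma interior_or_pole x : [\/ 0 < g x < 1, g x = 0 | g x = 1].
Proof.
have /andP[g0 g1] := g01 x.
have [->|g0'] := eqVneq (g x) 0; first by constructor 2.
have [->|g1'] := eqVneq (g x) 1; first by constructor 3.
by constructor 1; rewrite lt_neqAle eq_sym g0' g0 lt_neqAle g1' g1.
Qed.

(* [a] is the last time before [c] at which [g] takes the value 0 or 1. *)
Lemma history c : 0 <= c <= 1 ->
  [\/ (exists a, [/\ 0 <= a, a <= c, (forall x, a <= x <= c -> g x < 1)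
        & a = 0 \/ a < c /\ g a = 0]),
      (exists a, [/\ 0 <= a, a <= c, (forall x, a <= x <= c -> 0 < g x)
        & a = 0 \/ a < c /\ g a = 1])
    | exists up a, gap up a c].
Proof.
move=> /andP[c0 c1].
pose V := [set s | 0 <= s < c /\ (g s = 0 \/ g s = 1)].
have [V0|nV] := pselect (V !=set0); last first.
  have H x : 0 <= x < c -> 0 < g x < 1.
    move=> xc; case: (interior_or_pole x) => // gx; exfalso.
      by apply: nV; exists x; split=> //; left.
    by apply: nV; exists x; split=> //; right.
  have [gc|gc] := ltP (g c) 1.
    constructor 1; exists 0; split=> //; last by left.
    move=> x /andP[x0]; rewrite le_eqVlt => /orP[/eqP-> //|xc].
    by have /andP[] : 0 < g x < 1 by apply: H; rewrite x0.
  constructor 2; exists 0; split=> //; last by left.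
  move=> x /andP[x0]; rewrite le_eqVlt => /orP[/eqP->|xc]; first by lra.
  by have /andP[] : 0 < g x < 1 by apply: H; rewrite x0.
have ubV : ubound V c by move=> s [/andP[_ /ltW]].
have supV : has_sup V by split=> //; exists c.
set s0 := sup V.
have s0c : s0 <= c by apply: ge_sup.
have s0s s : V s -> s <= s0 by move=> Vs; apply: ub_le_sup => //; exists c.
have s00 : 0 <= s0 by case: V0 => s Vs; apply: (le_trans _ (s0s s Vs)); case: Vs => /andP[].
have near e : 0 < e -> exists2 s, V s & `|s - s0| < e.
  move=> e0; have [s Vs h] := sup_adherent e0 supV; exists s => //.
  by have := s0s s Vs; rewrite -/s0 in h *; rewrite ltr_norml => ?; apply/andP; split; lra.
(* Visits to 0 and 1 may accumulate at [c], and then there is no last one. A visit close to [c] is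
   used instead: by continuity [g] avoids one of the two values from there to [c]. *)
have [s0E|s0lt] : s0 = c \/ s0 < c by move: s0c; rewrite le_eqVlt => /orP[/eqP|]; [left|right].
  have [gc|gc] := ltP (g c) 1.
    have [e e0 H] := cts_lt_ball cg gc.
    have [s Vs sc] := near e e0; rewrite s0E ltr_norml in sc.
    case: Vs => /andP[p0 pc] gs.
    constructor 1; exists s; split=> //; first exact: ltW.
      by move=> x /andP[xs xc]; apply: H; rewrite ltr_norml; apply/andP; split; lra.
    right; split=> //; case: gs => // gs.
    by have := H s; rewrite ltr_norml sc gs ltxx => /(_ isT).
  have gc' : 0 < g c by lra.
  have [e e0 H] := cts_gt_ball cg gc'.
  have [s Vs sc] := near e e0; rewrite s0E ltr_norml in sc.
  case: Vs => /andP[p0 pc] gs.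
  constructor 2; exists s; split=> //; first exact: ltW.
    by move=> x /andP[xs xc]; apply: H; rewrite ltr_norml; apply/andP; split; lra.
  right; split=> //; case: gs => // gs.
  by have := H s; rewrite ltr_norml sc gs ltxx => /(_ isT).
have I x : s0 < x < c -> 0 < g x < 1.
  move=> /andP[x0 xc]; case: (interior_or_pole x) => // gx; exfalso.
    have : x <= s0 by apply: s0s; split; [rewrite xc (le_trans s00 (ltW x0))|left].
    by lra.
  have : x <= s0 by apply: s0s; split; [rewrite xc (le_trans s00 (ltW x0))|right].
  by lra.
have gs0 : g s0 = 0 \/ g s0 = 1.
  case: (interior_or_pole s0) => [/andP[h0 h1]|->|->]; [|by left|by right].
  have [e e0 H] := cts_lt_ball cg h1; have [e' e'0 H'] := cts_gt_ball cg h0.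
  have me : 0 < Num.min e e' by rewrite lt_min e0.
  have [s [_ gs]] := near _ me; rewrite lt_min => /andP[/H h /H' h'].
  by case: gs h h' => ->; rewrite ltxx.
case: gs0 => gs0; case: (interior_or_pole c) => [/andP[gc gc1]|gc|gc].
- constructor 1; exists s0; split=> //; last by right.
  move=> x /andP[]; rewrite le_eqVlt => /orP[/eqP<- _|x0]; first by lra.
  rewrite le_eqVlt => /orP[/eqP->|xc]; first by lra.
  by have /andP[] : 0 < g x < 1 by apply: I; rewrite x0.
- constructor 1; exists s0; split=> //; last by right.
  move=> x /andP[]; rewrite le_eqVlt => /orP[/eqP<- _|x0]; first by lra.
  rewrite le_eqVlt => /orP[/eqP->|xc]; first by lra.
  by have /andP[] : 0 < g x < 1 by apply: I; rewrite x0.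
- by constructor 3; exists true, s0; split.
- constructor 2; exists s0; split=> //; last by right.
  move=> x /andP[]; rewrite le_eqVlt => /orP[/eqP<- _|x0]; first by lra.
  rewrite le_eqVlt => /orP[/eqP->|xc]; first by lra.
  by have /andP[] : 0 < g x < 1 by apply: I; rewrite x0.
- by constructor 3; exists false, s0; split.
- constructor 2; exists s0; split=> //; last by right.
  move=> x /andP[]; rewrite le_eqVlt => /orP[/eqP<- _|x0]; first by lra.
  rewrite le_eqVlt => /orP[/eqP->|xc]; first by lra.
  by have /andP[] : 0 < g x < 1 by apply: I; rewrite x0.
Qed.

Variable D : R -> int -> Prop.
Variables m1 m2 : R -> R.
Variable c : R.
Hypothesis Dex : forall s, 0 < g s < 1 -> exists d, D s d.
Hypothesis m1_const : forall s t, 0 <= s -> s <= t -> t <= 1 ->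
  (forall x, s <= x <= t -> 0 < g x) -> m1 s = m1 t.
Hypothesis m2_const : forall s t, 0 <= s -> s <= t -> t <= 1 ->
  (forall x, s <= x <= t -> g x < 1) -> m2 s = m2 t.
Hypothesis m12 : forall s d, 0 <= s <= 1 -> 0 < g s < 1 -> D s d -> m1 s = m2 s + d%:~R.
Hypothesis start1 : 0 < g 0 -> m1 0 = 0.
Hypothesis start2 : g 0 < 1 -> m2 0 = 0.
Hypothesis end1 : 0 < g 1 -> m1 1 = c.
Hypothesis end2 : g 1 < 1 -> m2 1 = c.

Definition lap (up : bool) (a b : R) (d : int) : Prop :=
  gap up a b /\ forall x, a < x < b -> D x d.

(** On a rising gap [g] is below 1 from [a] to [x] and positive from [x] to [b], so [m2] is constant
    before [x] and [m1] after it; the switch between them at [x] costs [d]. On a falling gap the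
    roles are exchanged, which is where the sign alternates. *)
Lemma gap_jump up a b x d : gap up a b -> a < x < b -> D x d ->
  d%:~R = (if up then m1 b - m2 a else m1 a - m2 b).
Proof.
move=> [a0 ab b1 [ga gb] gi] /andP[ax xb] Dx.
have x01 : 0 <= x <= 1 by apply/andP; split; lra.
have := m12 x01 (gi x _) Dx; rewrite ax xb => /(_ isT).
have H y : a < y -> y < b -> 0 < g y < 1 by move=> ay yb; apply: gi; rewrite ay.
case: up ga gb => /= ga gb h.
  have -> : m2 a = m2 x.
    apply: m2_const => //; [lra|lra|].
    move=> y /andP[]; rewrite le_eqVlt => /orP[/eqP<- _|ay yx]; first by lra.
    by have /andP[] := H y ay (le_lt_trans yx xb).
  have <- : m1 x = m1 b.
    apply: m1_const; [lra|lra|lra|].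
    move=> y /andP[xy]; rewrite le_eqVlt => /orP[/eqP->|yb]; first by lra.
    by have /andP[] := H y (lt_le_trans ax xy) yb.
  by rewrite h addrC addKr.
have -> : m1 a = m1 x.
  apply: m1_const => //; [lra|lra|].
  move=> y /andP[]; rewrite le_eqVlt => /orP[/eqP<- _|ay yx]; first by lra.
  by have /andP[] := H y ay (le_lt_trans yx xb).
have <- : m2 x = m2 b.
  apply: m2_const; [lra|lra|lra|].
  move=> y /andP[xy]; rewrite le_eqVlt => /orP[/eqP->|yb]; first by lra.
  by have /andP[] := H y (lt_le_trans ax xy) yb.
by rewrite h addrC addKr.
Qed.

(** By [gap_jump] the winding number equals a quantity in which [x] does not occur, so it is the
    same throughout the gap. *)
Lemma gap_lap up a b : gap up a b -> exists2 d, lap up a b d &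
  d%:~R = (if up then m1 b - m2 a else m1 a - m2 b).
Proof.
move=> gab; have [a0 ab b1 [ga gb] gi] := gab.
have mid : a < (a + b) / 2 < b by apply/andP; split; lra.
have [d Dd] := Dex (gi _ mid); have dE := gap_jump gab mid Dd.
exists d => //; split=> // x xab; have [d' Dd'] := Dex (gi _ xab).
have := gap_jump gab xab Dd'; rewrite -dE => /intr_inj <-.
exact: Dd'.
Qed.

(* [al], resp. [be], bounds the degree accumulated when [g] visits 0, resp. 1. *)
Lemma lap_bound (al be : R) : 0 <= al -> 0 <= be ->
  (forall a b d, lap true a b d -> al + d%:~R <= be) ->
  (forall a b d, lap false a b d -> be - d%:~R <= al) ->
  c <= Num.max al be.
Proof.
move=> al0 be0 hup hdown.
(* At a zero of [g] only [m2] is controlled, at a point of value 1 only [m1]. *)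
pose bad s := [\/ g s = 0 /\ al < m2 s | g s = 1 /\ be < m1 s].
have step s : 0 <= s <= 1 -> (forall t, 0 <= t < s -> ~ bad t) ->
    (g s < 1 /\ m2 s <= al) \/ (0 < g s /\ m1 s <= be).
  move=> s01 nb; have /andP[s0 s1] := s01.
  case: (history s01) => [[a [a0 as_ ga aE]]|[a [a0 as_ ga aE]]|[up [a gas]]].
  - left; split; first by apply: ga; rewrite as_ lexx.
    rewrite -(m2_const a0 as_ s1 ga); case: aE => [aE|[lt_as gaE]].
      by rewrite aE start2//; apply: ga; rewrite aE lexx.
    by rewrite leNgt; apply/negP => h; apply: (nb a); [rewrite a0|left].
  - right; split; first by apply: ga; rewrite as_ lexx.
    rewrite -(m1_const a0 as_ s1 ga); case: aE => [aE|[lt_as gaE]].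
      by rewrite aE start1//; apply: ga; rewrite aE lexx.
    by rewrite leNgt; apply/negP => h; apply: (nb a); [rewrite a0|right].
  - have [d ld dE] := gap_lap gas; have [a0 lt_as _ [ga gs] _] := gas.
    case: up {gas} ld dE ga gs => ld dE /= ga gs.
      right; split; first by lra.
      have := hup _ _ _ ld; rewrite dE.
      have : m2 a <= al.
        by rewrite leNgt; apply/negP => h; apply: (nb a); [rewrite a0|left].
      by lra.
    left; split; first by lra.
    have := hdown _ _ _ ld; rewrite dE.
    have : m1 a <= be.
      by rewrite leNgt; apply/negP => h; apply: (nb a); [rewrite a0|right].
    by lra.
have nobad s : 0 <= s <= 1 -> ~ bad s.
  (* At the infimum [t0] of the bad heights, [step] gives the bound for [m2] or [m1]. Local
     constancy carries it to all nearby heights above [t0], among which there is a bad one. *)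
  move=> s01 bs; pose B := [set t | 0 <= t <= 1 /\ bad t].
  have B0 : B !=set0 by exists s.
  have lB : has_inf B by split=> //; exists 0 => t [/andP[]].
  set t0 := inf B.
  have t0P t : B t -> t0 <= t by move=> Bt; apply: ge_inf => //; case: lB.
  have t00 : 0 <= t0 by apply: lb_le_inf => // t [/andP[]].
  have t01 : 0 <= t0 <= 1 by rewrite t00/= (le_trans (t0P s _)) //; case/andP: s01.
  have nb t : 0 <= t < t0 -> ~ bad t.
    move=> /andP[p0 pt] bt; have : t0 <= t.
      by apply: t0P; split => //; rewrite p0/= (le_trans (ltW pt))//; case/andP: t01.
    by lra.
  case: (step t0 t01 nb) => -[gt mt].
    have [e e0 H] := cts_lt_ball cg gt.
    have [t [t1 bt] tt] := inf_adherent e0 lB; rewrite -/t0 in tt.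
    have tt0 : t0 <= t by apply: t0P.
    have Hx x : t0 <= x <= t -> g x < 1.
      by move=> /andP[x0 xt]; apply: H; rewrite ltr_norml; apply/andP; split; lra.
    have mE : m2 t0 = m2 t by apply: m2_const => //; case/andP: t1.
    have gt1 : g t < 1 by apply: Hx; rewrite tt0 lexx.
    by case: bt => -[gE]; lra.
  have [e e0 H] := cts_gt_ball cg gt.
  have [t [t1 bt] tt] := inf_adherent e0 lB; rewrite -/t0 in tt.
  have tt0 : t0 <= t by apply: t0P.
  have Hx x : t0 <= x <= t -> 0 < g x.
    by move=> /andP[x0 xt]; apply: H; rewrite ltr_norml; apply/andP; split; lra.
  have mE : m1 t0 = m1 t by apply: m1_const => //; case/andP: t1.
  have gt1 : 0 < g t by apply: Hx; rewrite tt0 lexx.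
  by case: bt => -[gE]; lra.
have I1 : 0 <= (1 : R) <= 1 by rewrite lexx ler01.
case: (step 1 I1) => [t /andP[t0 t1]|[g1]|[g1]].
- by apply: nobad; rewrite t0 ltW.
- by rewrite end2// => h; rewrite le_max h.
- by rewrite end1// => h; rewrite le_max h orbT.
Qed.

(** Outside the first two cases a rising lap adds at most 1 and a falling lap, removing [d], adds at
    most 1. If all falling laps have [d >= 1], the bounds 0 at visits to 0 and 1 at visits to 1 are
    kept; if there is no rising lap, the bounds 1 and 0 are. Either way [c <= 1]. *)
Lemma lap_trichotomy : c = 2 ->
  [\/ exists a b d, lap true a b d /\ 2 <= d,
      exists a b d, lap false a b d /\ d <= -2
    | (exists a b d, lap false a b d /\ d <= 0) /\ exists a b d, lap true a b d].
Proof.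
move=> c2.
have [h|n1] := pselect (exists a b d, lap true a b d /\ 2 <= d); first by constructor 1.
have [h|n2] := pselect (exists a b d, lap false a b d /\ d <= -2); first by constructor 2.
have [h3|n3] := pselect (exists a b d, lap false a b d /\ d <= 0); last first.
  have := @lap_bound 0 1 (lexx _) ler01; rewrite c2 max_r ?ler01//.
  move=> /(_ _ _)/Wrap[||]; last by lra.
  - move=> a b d l; rewrite add0r -[1]/(1%:~R) ler_int leNgt; apply/negP => d1.
    by apply: n1; exists a, b, d.
  - move=> a b d l; rewrite subr_le0 -[1]/(1%:~R) ler_int leNgt; apply/negP => d1.
    by apply: n3; exists a, b, d; split=> //; rewrite -ltzD1.
have [h4|n4] := pselect (exists a b d, lap true a b d); first by constructor 3.
have := @lap_bound 1 0 ler01 (lexx _); rewrite c2 max_l ?ler01//.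
move=> /(_ _ _)/Wrap[||]; last by lra.
- by move=> a b d l; exfalso; apply: n4; exists a, b, d.
- move=> a b d l; rewrite sub0r lerNl -[- 1]/((-1)%:~R) ler_int leNgt; apply/negP => d1.
  by apply: n2; exists a, b, d; split=> //; rewrite -ltzD1.
Qed.

End Laps.

(** * Winding number near a fixed pole *)

Section LinearLoops.
Variable R : realType.
Local Notation C := R[i].
Local Notation Re := (@complex.Re R).
Local Notation Im := (@complex.Im R).

Lemma is_arg_atan (z : C) : 0 < Re z -> is_arg z (atan (Im z / Re z)).
Proof.
move=> z0; pose n := Num.sqrt (Re z ^+ 2 + Im z ^+ 2).
have s0 : 0 < Re z ^+ 2 + Im z ^+ 2 by rewrite ltr_pwDl ?sqr_ge0// exprn_gt0.
have n0 : 0 < n by rewrite sqrtr_gt0.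
have nn : n != 0 by rewrite gt_eqF.
have [||c s] := @cos_atan_unit R (Re z / n) (Im z / n).
- by rewrite divr_gt0.
- by rewrite !exprMn -mulrDl exprVn sqr_sqrtr ?divff ?gt_eqF// ltW.
have e : Im z / n / (Re z / n) = Im z / Re z by field; rewrite nn gt_eqF.
rewrite e in c s; exists n; rewrite c s n0.
by split=> //; rewrite mulrC divfK.
Qed.

Variables al be ga de : R.
Let A1 a := al * cos a + be * sin a.
Let A2 a := ga * cos a + de * sin a.

(** A linear map of the plane sending the unit circle to a circle around 0 is a similarity, so its
    loop turns at constant speed once, in the direction given by the sign of the determinant. *)
Lemma linear_loop_angle : (forall a b, A1 a ^+ 2 + A2 a ^+ 2 = A1 b ^+ 2 + A2 b ^+ 2) ->
  0 < A1 0 ^+ 2 + A2 0 ^+ 2 ->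
  exists s phi, (s = 1 \/ s = -1) /\ forall a, is_arg (A1 a +i* A2 a)%C (phi + s * a).
Proof.
move=> Nc; rewrite {1}/A1 {1}/A2 cos0 sin0 !mulr1 !mulr0 !addr0 => N0.
(* The angles 0 and $\pi/2$ show that the columns have equal norms; the angle $\pi/4$ then shows
   that they are orthogonal. *)
have e1 : al ^+ 2 + ga ^+ 2 = be ^+ 2 + de ^+ 2.
  have := Nc 0 (pi / 2); rewrite /A1 /A2 cos0 sin0 cos_pihalf sin_pihalf.
  by rewrite !mulr1 !mulr0 !addr0 !add0r.
have e2 : al * be + ga * de = 0.
  have := Nc 0 (pi / 4); rewrite /A1 /A2 cos0 sin0 !mulr1 !mulr0 !addr0.
  have := cos2Dsin2 (pi / 4 : R); have := @cos_gt0_pihalf R (pi / 4).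
  have -> : sin (pi / 4) = cos (pi / 4) :> R.
    by rewrite -cosBpihalf (_ : _ - _ = - (pi / 4)) ?cosN//; lra.
  have := pi_gt0 R; move=> p0 /(_ _)/Wrap[|]; first by apply/andP; split; lra.
  set c := cos _ => c0; rewrite -mulr2n -mulr_natr => c2 h.
  have : c ^+ 2 = 2^-1 by lra.
  move: h.
  have -> : (al * c + be * c) ^+ 2 + (ga * c + de * c) ^+ 2 =
     c ^+ 2 * (al ^+ 2 + ga ^+ 2 + (be ^+ 2 + de ^+ 2) + 2 * (al * be + ga * de)) by ring.
  by move=> h ch; move: h; rewrite ch -e1; lra.
set N := al ^+ 2 + ga ^+ 2 in N0 e1.
have Nn : N != 0 by rewrite gt_eqF.
(* The determinant divided by the squared ratio [N] of the similarity. *)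
pose s := (al * de - be * ga) / N.
have sN : N * s = al * de - be * ga by rewrite mulrC divfK.
have beE : be = - (s * ga).
  apply: (mulfI Nn); rewrite mulrN mulrA sN; apply/eqP; rewrite -subr_eq0; apply/eqP.
  transitivity (al * (al * be + ga * de)); first by rewrite /N; ring.
  by rewrite e2 mulr0.
have deE : de = s * al.
  apply: (mulfI Nn); rewrite mulrA sN; apply/eqP; rewrite -subr_eq0; apply/eqP.
  transitivity (ga * (al * be + ga * de)); first by rewrite /N; ring.
  by rewrite e2 mulr0.
have s2 : s ^+ 2 = 1.
  have e3 : be ^+ 2 + de ^+ 2 = N * s ^+ 2.
    by rewrite [X in X ^+ 2 + _]beE [X in _ + X ^+ 2]deE /N; ring.
  by apply: (mulfI Nn); rewrite mulr1 -e3.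
have s1 : s = 1 \/ s = -1.
  by move/eqP: s2; rewrite sqrf_eq1 => /orP[]/eqP; [left|right].
have [||th [_ aE]] := @segment_angle R (fun=> (al +i* ga)%C) 0 0 (lexx _).
- exact: ccontinuous_cst.
- move=> _ _; rewrite eq_complex/= negb_and -negb_and; apply: contra Nn => /andP[/eqP a0 /eqP g0].
  by rewrite /N a0 g0 expr0n addr0.
exists s, (th 0); split=> // a.
have := aE 0; rewrite lexx => /(_ isT) h.
rewrite (_ : (A1 a +i* A2 a)%C = (al +i* ga)%C * (cos (s * a) +i* sin (s * a))%C).
  by apply: is_argM h _; exists 1; rewrite ltr01 !mul1r.
have [-> ->] : cos (s * a) = cos a /\ sin (s * a) = s * sin a.
  by case: s1 => ->; rewrite ?mul1r// mulN1r cosN sinN mulN1r.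
by apply: complexP; rewrite ?complexReM ?complexImM/= /A1 /A2;
  [rewrite [X in _ + X * _]beE|rewrite [X in _ + X * _]deE]; ring.
Qed.

End LinearLoops.

(** * The differential at a fixed pole and the winding number of nearby latitudes *)

Section PoleWinding.
Variable R : realType.
Local Notation C := R[i].
Local Notation S2 := (set_type (@sphere R)).

Lemma mx_norm_le m n (v : 'M[R]_(m, n)) c : 0 <= c ->
  `|v| <= c <-> forall i j, `|v i j| <= c.
Proof.
move=> c0; rewrite -[`|v|]/(mx_norm v) mx_normrE; split=> [/bigmax_leP[_ h] i j|h].
  exact: (h (i, j)).
by apply/bigmax_leP; split=> // -[i j] _; exact: h.
Qed.

Lemma diff_estimate n (F : 'rV[R]_n.+1 -> 'rV[R]_n.+1) (P : 'rV[R]_n.+1) (e : R) :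
  differentiable F P -> 0 < e ->
  exists2 d : R, 0 < d & forall (v : 'rV[R]_n.+1) (c : R), 0 <= c -> c < d -> (forall j, `|v 0 j| <= c) ->
    forall j, `|F (P + v) 0 j - F P 0 j - ('d F P v : 'rV[R]_n.+1) 0 j| <= e * c.
Proof.
move=> dF e0; have /eqaddoP /(_ _ e0) := diff_locally dF.
move=> /nbhs_ballP[d /= d0 H]; exists d => // v c c0 cd vc j.
have vn : `|v| <= c by apply/mx_norm_le => // i k; rewrite ord1.
have := H v; rewrite mx_norm_ball /ball_/= sub0r normrN => /(_ (le_lt_trans vn cd)).
move=> h; have {}h : `|F (v + P) - (F P + 'd F P v)| <= e * c.
  by apply: le_trans h _; rewrite ler_pM2l.
have ec : 0 <= e * c by rewrite mulr_ge0// ltW.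
move/(mx_norm_le _ ec): h => /(_ 0 j); rewrite [v + P]addrC !mxE.
by rewrite opprD addrA.
Qed.

Lemma pole_unique (p q : S2) : height (set_val p) = height (set_val q) ->
  height (set_val p) = 0 \/ height (set_val p) = 1 -> p = q.
Proof.
have H (r : S2) : height (set_val r) = 0 \/ height (set_val r) = 1 ->
    set_val r 0 0 = 0 /\ set_val r 0 1 = 0.
  have : sphere (set_val r) by exact: set_valP.
  rewrite /sphere/= => e h.
  have : set_val r 0 0 ^+ 2 + set_val r 0 1 ^+ 2 = 0 by case: h => h; move: e; rewrite h; lra.
  by move/eqP; rewrite paddr_eq0 ?sqr_ge0// !sqrf_eq0 => /andP[/eqP-> /eqP->].
move=> pq hp; have [p0 p1] := H p hp; have hq := hp; rewrite pq in hq.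
have [q0 q1] := H q hq; apply: val_inj; apply/rowP => j.
case: j => [[|[|[|//]]] i].
- by transitivity (set_val p 0 0); [congr (set_val p _ _); exact: val_inj|
    rewrite p0 -q0; congr (set_val q _ _); exact: val_inj].
- by transitivity (set_val p 0 1); [congr (set_val p _ _); exact: val_inj|
    rewrite p1 -q1; congr (set_val q _ _); exact: val_inj].
- transitivity (height (set_val p)); first by congr (set_val p _ _); exact: val_inj.
  by rewrite pq; congr (set_val q _ _); exact: val_inj.
Qed.

(** Height measured from the selected pole, which treats both poles at once; being an involution, it
    also converts back. *)
Definition pole_height (north : bool) (k : R) : R := if north then 1 - k else k.

Lemma pole_heightK north : involutive (pole_height north).
Proof. by case: north => k //=; ring. Qed.

Section Estimates.
Variables (f : S2 -> S2) (g : R -> R) (north : bool).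
Local Notation ht := (pole_height north).
Hypothesis f_C1 : C1_sphere_map f.
Hypothesis fg : forall a h, height (set_val (f (sph a h))) = g h.
Hypothesis g_pole : g (ht 0) = ht 0.

(** Near a pole the vertical displacement [k] is of the order of the square of the radius [r], so to
    first order only the horizontal block of the differential acts; the four numbers are its
    entries. *)
Lemma pole_linear_approximation : exists al be ga de : R, forall e, 0 < e ->
  exists2 d, 0 < d & forall k, 0 < k < d -> k <= 2^-1 /\ forall a,
    let r := lat_radius (ht k) in let q := set_val (f (sph a (ht k))) in
    `|q 0 0 - r * (al * cos a + be * sin a)| <= e * r /\
    `|q 0 1 - r * (ga * cos a + de * sin a)| <= e * r.
Proof.
have ht01 k : 0 <= k <= 1 -> 0 <= ht k <= 1.
  by rewrite /ht; case: north => /andP[*]; apply/andP; split; lra.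
have I0 : 0 <= (0 : R) <= 1 by rewrite lexx ler01.
pose p := sph 0 (ht 0); pose P := set_val p.
have hp : height P = 0 \/ height P = 1.
  rewrite /P height_sph clamp_id ?ht01// /ht; case: north; [right|left]; lra.
have fp : f p = p.
  by apply/esym/pole_unique => //; rewrite fg g_pole height_sph clamp_id ?ht01.
have rad0 : lat_radius (ht 0) = 0.
  by rewrite /lat_radius /ht; case: north; rewrite ?subr0 ?subrr ?mulr0 ?mul0r sqrtr0.
have P0 : P 0 0 = 0 by rewrite /P /= mxE /= clamp_id ?ht01// rad0 mul0r.
have P1 : P 0 1 = 0 by rewrite /P /= mxE /= clamp_id ?ht01// rad0 mul0r.
have [U [F [oU UP FU fF]]] := f_C1 p.
have [dF _] := FU _ UP.
have FP : F P = P by rewrite fF// fp.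
have [dU dU0 HU] : exists2 d : R, 0 < d & forall (v : 'rV[R]_3) (c : R),
    0 <= c -> c < d -> (forall j, `|v 0 j| <= c) -> U (P + v).
  have := open_nbhs_nbhs (conj oU UP) => /nbhs_ballP[d /= d0 H]; exists d => // v c c0 cd vc.
  apply: H; rewrite mx_norm_ball /ball_/= opprD addrA subrr add0r normrN.
  by apply: le_lt_trans cd; apply/mx_norm_le => // i j; rewrite ord1.
pose L := 'd F P : 'rV[R]_3 -> 'rV[R]_3.
pose e_ (i : 'I_3) := delta_mx 0 i : 'rV[R]_3.
exists (L (e_ 0) 0 0), (L (e_ 1) 0 0), (L (e_ 0) 0 1), (L (e_ 1) 0 1) => e e0.
pose K := `|L (e_ ord_max) 0 0| + `|L (e_ ord_max) 0 1| + 1.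
have K0 : 0 < K by rewrite ltr_pwDr// addr_ge0.
have e4 : 0 < e / 4 by rewrite divr_gt0.
have [d1 d10 H1] := diff_estimate dF e4.
(* Below, [q] is the square root of [k]; it bounds the displacement, and [k <= 1/2] gives
   [r <= q <= 2 r]. The remainder of the differential and the vertical term each cost at most
   [e / 4 * q], in all at most [e * r]; the term [e / (4 * K)] serves the second. *)
pose d := Num.min (Num.min dU d1) (Num.min (e / (4 * K)) (2^-1)).
have d0 : 0 < d by rewrite !lt_min dU0 d10 divr_gt0 ?mulr_gt0//= invr_gt0.
exists (d ^+ 2); first by rewrite exprn_gt0.
move=> k /andP[k0 kd].
pose q := Num.sqrt k.
have q0 : 0 < q by rewrite sqrtr_gt0.
have q2 : q ^+ 2 = k by rewrite sqr_sqrtr// ltW.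
have qd : q < d by rewrite -(@ltr_pXn2r _ 2) ?nnegrE ?ltW// q2.
move: qd; rewrite !lt_min => /andP[/andP[qU q1] /andP[qK qh]].
have kh : k <= 2^-1 by rewrite -q2; clear -f_C1 fg g_pole q0 qh; nra.
split=> [//|a r]; have k01 : 0 <= k <= 1 by clear -f_C1 fg g_pole k0 kh; apply/andP; split; lra.
have r2 : r ^+ 2 = k * (1 - k).
  by rewrite /r lat_radius_sqr ?ht01// /ht; case: north => //; ring.
have r0 : 0 <= r by rewrite sqrtr_ge0.
have qr : q <= 2 * r.
  by rewrite -(@ler_pXn2r _ 2) ?nnegrE ?mulr_ge0// ?ltW// exprMn r2 q2; clear -f_C1 fg g_pole k0 kh; nra.
have rq : r <= q by rewrite -(@ler_pXn2r _ 2) ?nnegrE// ?ltW// r2 q2; clear -f_C1 fg g_pole k0; nra.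
pose v := set_val (sph a (ht k)) - P.
pose sg : R := if north then -1 else 1.
have sg1 : `|sg| = 1 by rewrite /sg; case: north; rewrite ?normrN normr1.
have vE : v = r * cos a *: e_ 0 + r * sin a *: e_ 1 + sg * k *: e_ ord_max.
  apply/rowP => j; rewrite /v !mxE /= !clamp_id ?ht01// rad0 !mul0r -/r.
  case: j => [[|[|[|//]]] i] /=; rewrite ?(mulr0, mulr1, addr0, add0r, subr0)//.
  by rewrite /sg /ht; case: north; ring.
have vc j : `|v 0 j| <= q.
  have cb : `|cos a| <= 1 by rewrite ler_norml cos_geN1 cos_le1.
  have sb : `|sin a| <= 1 by rewrite ler_norml sin_geN1 sin_le1.
  have kq : k <= q by rewrite -q2; clear -f_C1 fg g_pole q0 qh; nra.
  rewrite vE !mxE; case: j => [[|[|[|//]]] i] /=; rewrite ?(mulr0, mulr1, addr0, add0r)//.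
  - by rewrite normrM (ger0_norm r0); clear -f_C1 fg g_pole r0 rq cb; nra.
  - by rewrite normrM (ger0_norm r0); clear -f_C1 fg g_pole r0 rq sb; nra.
  - by rewrite normrM sg1 mul1r ger0_norm// ltW.
have PvE : P + v = set_val (sph a (ht k)) by rewrite /v addrC subrK.
have Fv : F (P + v) = set_val (f (sph a (ht k))).
  by rewrite PvE; apply: fF; rewrite -PvE; exact: (HU v q (ltW q0) qU vc).
have est := H1 v q (ltW q0) q1 vc.
have Lv : ('d F P v : 'rV[R]_3) = r * cos a *: L (e_ 0) + r * sin a *: L (e_ 1) + sg * k *: L (e_ ord_max).
  by rewrite vE !linearD !linearZ.
have kK x : `|x| <= K -> `|sg * k * x| <= e / 4 * q.
  move=> xK; rewrite !normrM sg1 mul1r (gtr0_norm k0) -q2.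
  have qK' : q * K <= e / 4.
    by move: qK; rewrite ltr_pdivlMr ?mulr_gt0// => h; clear -f_C1 fg g_pole h; lra.
  by have := normr_ge0 x; clear -f_C1 fg g_pole q0 xK qK'; nra.
have fin_ x y z w0 : `|z - w0 - (r * cos a * x + r * sin a * y)| <= e / 4 * q + e / 4 * q -> w0 = 0 ->
    `|z - r * (x * cos a + y * sin a)| <= e * r.
  move=> h w00; rewrite w00 subr0 in h.
  rewrite (_ : z - _ = z - (r * cos a * x + r * sin a * y)); last by ring.
  by apply: le_trans h _; clear -f_C1 fg g_pole e0 qr; nra.
have key j : `|L (e_ ord_max) 0 j| <= K ->
    `|set_val (f (sph a (ht k))) 0 j - P 0 j -
      (r * cos a * L (e_ 0) 0 j + r * sin a * L (e_ 1) 0 j)| <= e / 4 * q + e / 4 * q.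
  move=> xK; have := est j; rewrite Fv FP Lv !mxE => h.
  rewrite -[X in `|X|](subrK (sg * k * L (e_ ord_max) 0 j)).
  apply: le_trans (ler_normD _ _) _; apply: lerD (kK _ xK).
  by apply: le_trans h; rewrite le_eqVlt; apply/orP; left; apply/eqP; congr `|_|; ring.
split; apply: fin_; [apply: key| |apply: key|] => //.
- by rewrite /K -addrA lerDl addr_ge0.
- by rewrite /K addrAC lerDr addr_ge0.
Qed.

(* If [f] does not bring latitudes closer to the fixed pole, then its differential
   there is nonzero, hence a similarity of the tangent plane. *)
Lemma pole_winding (d : int) (dl : R) : continuous g -> 0 < dl ->
  (forall k, 0 < k < dl -> [/\ 0 < g (ht k) < 1, k <= ht (g (ht k))
     & winds f (ht k) (g (ht k)) d]) ->
  d = 1 \/ d = -1.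
Proof.
move=> cg dl0 H; have [al [be [ga [de app]]]] := pole_linear_approximation.
pose A1 a := al * cos a + be * sin a; pose A2 a := ga * cos a + de * sin a.
pose N a := A1 a ^+ 2 + A2 a ^+ 2.
pose B : R := `|al| + `|be| + (`|ga| + `|de|).
(* Both coordinates of the linear loop are bounded by [B]. Moving one by at most [e <= 1] changes
   its square by at most [e * (2 * B + 1)], hence the sum of the two squares by at most [e * M]. *)
pose M : R := 2 * (2 * B + 1).
have B0 : 0 <= B by rewrite !addr_ge0.
have M0 : 0 < M by rewrite mulr_gt0// ltr_wpDl ?mulr_ge0.
have lin (x y a : R) : `|x * cos a + y * sin a| <= `|x| + `|y|.
  apply: le_trans (ler_normD _ _) _; rewrite !normrM.
  have cb : `|cos a| <= 1 by rewrite ler_norml cos_geN1 cos_le1.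
  have sb : `|sin a| <= 1 by rewrite ler_norml sin_geN1 sin_le1.
  by have := normr_ge0 x; have := normr_ge0 y; nra.
have A1B a : `|A1 a| <= B by apply: (le_trans (lin al be a)); rewrite lerDl addr_ge0.
have A2B a : `|A2 a| <= B by apply: (le_trans (lin ga de a)); rewrite lerDr addr_ge0.
have near_pole e : 0 < e -> exists k, [/\ 0 < k < dl, k <= 2^-1, ht (g (ht k)) <= 2^-1
    & forall a, let r := lat_radius (ht k) in let q := set_val (f (sph a (ht k))) in
    `|q 0 0 - r * A1 a| <= e * r /\ `|q 0 1 - r * A2 a| <= e * r].
  move=> e0; have [d1 d10 H1] := app e e0.
  have [d2 d20 H2] : exists2 d2, 0 < d2 & forall k, 0 < k < d2 -> ht (g (ht k)) <= 2^-1.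
    have ch : continuous ht by rewrite /pole_height; case: north; cts.
    have cc : continuous (fun k => ht (g (ht k))).
      by apply: (cts_comp ch); apply: (cts_comp cg).
    have [|d2 d20 H2] := @cts_lt_ball R _ 0 2^-1 cc.
      by rewrite g_pole pole_heightK invr_gt0.
    exists d2 => // k /andP[k0 kd]; apply/ltW/H2; rewrite subr0 gtr0_norm//.
  pose k := Num.min dl (Num.min d1 d2) / 2.
  have m0 : 0 < Num.min dl (Num.min d1 d2) by rewrite !lt_min dl0 d10.
  have k0 : 0 < k by rewrite divr_gt0.
  have : k < Num.min dl (Num.min d1 d2) by rewrite /k; lra.
  rewrite !lt_min => /andP[kdl /andP[k1 k2]].
  have [kh est] := H1 k (introT andP (conj k0 k1)).
  by exists k; split=> //; [rewrite k0|apply: H2; rewrite k0].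
(* The image is again a latitude, so its squared radius is independent of [a]; [rho] is its ratio to
   that of the source. Since $x(1-x)$ increases on $[0,1/2]$, an image no closer to the pole keeps
   this ratio away from 0. *)
have sq k : 0 < k < dl -> k <= 2^-1 -> ht (g (ht k)) <= 2^-1 ->
    exists2 rho, 2^-1 <= rho & 0 < lat_radius (ht k) /\
      forall a, let q := set_val (f (sph a (ht k))) in
      q 0 0 ^+ 2 + q 0 1 ^+ 2 = rho * lat_radius (ht k) ^+ 2.
  move=> /[dup] kdl /andP[k0 _] kh gh; have [/andP[g0 g1] kg _] := H k kdl.
  have r2 : lat_radius (ht k) ^+ 2 = k * (1 - k).
    rewrite lat_radius_sqr /pole_height; first by case: north => //; ring.
    by clear -f_C1 fg g_pole k0 kh; case: north; apply/andP; split; lra.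
  have r20 : 0 < k * (1 - k) by clear -f_C1 fg g_pole k0 kh; nra.
  exists (g (ht k) * (1 - g (ht k)) / (k * (1 - k))).
    have -> : g (ht k) * (1 - g (ht k)) = ht (g (ht k)) * (1 - ht (g (ht k))).
      by move: (g (ht k)) => G; rewrite /pole_height; case: north => //; ring.
    by rewrite ler_pdivlMr//; clear -f_C1 fg g_pole k0 kh kg gh; nra.
  split; first by rewrite lt_def sqrtr_ge0 andbT -sqrf_eq0 r2 gt_eqF.
  move=> a q; rewrite r2 divfK ?gt_eqF// -(fg a).
  have : sphere q by exact: set_valP.
  by rewrite /sphere/= -/q; set h := height q => e; clear -f_C1 fg g_pole e; lra.
have close e : 0 < e -> e <= 1 -> exists rho, 2^-1 <= rho /\ forall a, `|N a - rho| <= e * M.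
  move=> e0 e1; have [k [kdl kh gh est]] := near_pole e e0.
  have [rho rho2 [r0 qE]] := sq k kdl kh gh; exists rho; split=> // a.
  have /= [x1 y1] := est a; have /= qa := qE a.
  set r := lat_radius _ in r0 x1 y1 qa; set x := _ 0 0 in x1 qa; set y := _ 0 1 in y1 qa.
  have rn : r != 0 by rewrite gt_eqF.
  pose X := x / r; pose Y := y / r.
  have X1 : `|X - A1 a| <= e.
    rewrite -(@ler_pM2r _ r)// -{1}(gtr0_norm r0) -normrM mulrBl divfK//.
    by rewrite [A1 a * r]mulrC.
  have Y1 : `|Y - A2 a| <= e.
    rewrite -(@ler_pM2r _ r)// -{1}(gtr0_norm r0) -normrM mulrBl divfK//.
    by rewrite [A2 a * r]mulrC.
  have -> : rho = X ^+ 2 + Y ^+ 2.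
    by apply: (mulIf (expf_neq0 2 rn)); rewrite -qa mulrDl /X /Y !exprMn !exprVn !divfK ?expf_neq0.
  have sqd z w : `|w - z| <= e -> `|z| <= B -> `|z ^+ 2 - w ^+ 2| <= e * (2 * B + 1).
    move=> wz zB; rewrite subr_sqr normrM distrC; apply: ler_pM => //.
    rewrite (_ : z + w = 2 * z + (w - z)); last by ring.
    apply: le_trans (ler_normD _ _) _; rewrite normrM ger0_norm//; clear -f_C1 fg g_pole e1 wz zB; lra.
  rewrite /N (_ : _ - _ = A1 a ^+ 2 - X ^+ 2 + (A2 a ^+ 2 - Y ^+ 2)); last by ring.
  apply: le_trans (ler_normD _ _) _.
  move: (sqd _ _ X1 (A1B a)) (sqd _ _ Y1 (A2B a)); rewrite /M => h1 h2; clear -f_C1 fg g_pole h1 h2; lra.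
(* [N] does not depend on [e], although [rho] does: for every [e] all its values are within [e * M]
   of a common number, so [N] is constant. *)
have Nc a b : N a = N b.
  apply/eqP; rewrite -subr_eq0; apply/negPn/negP => ab.
  have ab0 : 0 < `|N a - N b| by rewrite normr_gt0.
  pose e := Num.min 1 (`|N a - N b| / (4 * M)).
  have e0 : 0 < e by rewrite lt_min ltr01 divr_gt0// mulr_gt0.
  have [|rho [_ h]] := close e e0; first by rewrite ge_min lexx.
  have : `|N a - N b| <= e * M + e * M.
    move: (h a) (h b); rewrite !ler_norml => /andP[h1 h2] /andP[h3 h4].
    by clear -f_C1 fg g_pole h1 h2 h3 h4; apply/andP; split; lra.
  have : e * (4 * M) <= `|N a - N b|.
    have h4 : e <= `|N a - N b| / (4 * M) by rewrite /e ge_min lexx orbT.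
    by move: h4; rewrite ler_pdivlMr// mulr_gt0.
  by lra.
(* This gives [e * M <= 1/4], hence [N >= 1/4], and [e * B <= 1/16], so the error terms of [z] below
   are at most half of the main term. *)
pose e := Num.min 1 (1 / (4 * M)).
have e0 : 0 < e by rewrite lt_min ltr01 divr_gt0// mulr_gt0.
have e1 : e <= 1 by rewrite ge_min lexx.
have eM : e * (4 * M) <= 1.
  have h4 : e <= 1 / (4 * M) by rewrite /e ge_min lexx orbT.
  by move: h4; rewrite ler_pdivlMr// mulr_gt0.
have N4 a : 4^-1 <= N a.
  have [rho [rho2 h]] := close e e0 e1; have := h a; rewrite ler_norml => /andP[? _].
  lra.
have N0 : 0 < N 0 by apply: lt_le_trans (N4 0); rewrite invr_gt0.
have [s [phi [s1 aA]]] := linear_loop_angle Nc N0.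
have [k [kdl kh gh est]] := near_pole e e0.
have [rho rho2 [r0 _]] := sq k kdl kh gh.
have [gk _ [F [cF fF FE]]] := H k kdl.
pose u a := horiz (set_val (f (sph a (ht k)))).
pose A a : C := (A1 a +i* A2 a)%C.
(* Up to a positive factor, the quotient of the image curve by the linear loop. It stays in the
   right half-plane, so its argument is an arctangent and returns to its initial value after one
   turn: the curve winds as often as the linear loop. *)
pose z a := conjc (A a) * u a.
have cf : continuous (fun a => sph (F a) (g (ht k))).
  by apply: (cts_comp (@sph_continuous R) (g := fun a => (F a, g (ht k)))); cts.
have cu : ccontinuous u.
  have E : u = fun a => horiz (set_val (sph (F a) (g (ht k)))) by apply/funext => a; rewrite /u fF.
  by rewrite E; split; apply: cts_coord; exact: (cts_comp (@set_val_continuous _ _) cf).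
have cA : ccontinuous A by split; rewrite /A /A1 /A2 /=; cts.
have [cz1 cz2] : ccontinuous z by apply: ccontinuousM => //; exact: ccontinuous_conj.
have z0 a : 0 < complex.Re (z a).
  rewrite /z complexReM /=; have /= [x1 y1] := est a; have := N4 a.
  set r := lat_radius _ in r0 x1 y1; set x := _ 0 0 in x1 *; set y := _ 0 1 in y1 *.
  move=> Na; have b1 := A1B a; have b2 := A2B a.
  have -> : A1 a * x - - A2 a * y = r * N a + ((x - r * A1 a) * A1 a + (y - r * A2 a) * A2 a).
    by rewrite /N; ring.
  have h1 : `|(x - r * A1 a) * A1 a| <= e * r * B by rewrite normrM ler_pM.
  have h2 : `|(y - r * A2 a) * A2 a| <= e * r * B by rewrite normrM ler_pM.
  move: h1 h2; rewrite !ler_norml => /andP[h1 _] /andP[h2 _].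
  have eB : e * B <= 16^-1 by rewrite /M in eM; clear -f_C1 fg g_pole eM e0; lra.
  clear -f_C1 fg g_pole r0 Na h1 h2 eB; nra.
pose psi a := atan (complex.Im (z a) / complex.Re (z a)).
have cpsi : continuous psi.
  apply: cts_comp; first by move=> x; exact: continuous_atan.
  by apply: ctsM => //; apply: ctsV => // a; rewrite gt_eqF.
have au a : is_arg (u a) (phi + s * a + psi a).
  have Na : 0 < N a by apply: lt_le_trans (N4 a); rewrite invr_gt0.
  apply/(is_argZ _ _ Na); rewrite (_ : _ * u a = A a * z a).
    by apply: is_argM; [exact: aA|exact: is_arg_atan].
  rewrite /z mulrA; congr (_ * _); rewrite /N /A.
  by apply: complexP; rewrite ?complexReM ?complexImM/=; ring.
have aF a : is_arg (u a) (F a).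
  rewrite /u fF horiz_sph clamp_id; last by rewrite !ltW; case/andP: gk.
  apply: (is_argZ _ _ (lat_radius_gt0 gk)).1.
  by exists 1; rewrite ltr01 !mul1r.
have tp : 0 <= 2 * pi :> R by rewrite mulr_ge0// pi_ge0.
have := @segment_angle_unique R u F (fun a => phi + s * a + psi a) 0 (2 * pi) (2 * pi) 0.
rewrite !lexx tp => /(_ isT isT cF) h.
have {}h : F (2 * pi) - F 0 = phi + s * (2 * pi) + psi (2 * pi) - (phi + s * 0 + psi 0).
  by apply: h => //; cts.
have psi0 : psi (2 * pi) = psi 0.
  have c0 : cos (2 * pi) = cos 0 :> R by rewrite -(cos2pi_int 1 0) mul1r add0r.
  have s0 : sin (2 * pi) = sin 0 :> R by rewrite -(sin2pi_int 1 0) mul1r add0r.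
  have h0 y : sph (2 * pi) y = sph 0 y by rewrite -(sph_2pi 0 y 1) mul1r add0r.
  have zz : z (2 * pi) = z 0 by rewrite /z /u /A /A1 /A2 h0 c0 s0.
  by rewrite /psi zz.
have : d%:~R = s.
  have := FE 0; rewrite add0r => FE0; rewrite FE0 psi0 in h.
  have p0 : 2 * pi != 0 :> R by rewrite mulf_neq0// gt_eqF// pi_gt0.
  by apply: (mulIf p0); clear -f_C1 fg g_pole h; lra.
case: s1 => -> ds; [left|right]; apply: (@intr_inj R); rewrite ds //.
Qed.

End Estimates.

End PoleWinding.

(** * Fixed points of the iterates *)

Section CircleDynamics.
Variable R : realType.
Local Notation S2 := (set_type (@sphere R)).

Lemma sph_inj (a b h : R) : 0 < h < 1 -> 0 <= a < 2 * pi -> 0 <= b < 2 * pi ->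
  sph a h = sph b h -> a = b.
Proof.
move=> h01 /andP[a0 a1] /andP[b0 b1] ab.
have r0 := lat_radius_gt0 h01; have rn : lat_radius h != 0 by rewrite gt_eqF.
have hc : clamp h = h by case/andP: h01 => *; rewrite clamp_id ?ltW.
have e0 := congr1 (fun p : S2 => set_val p 0 0) ab; have e1 := congr1 (fun p : S2 => set_val p 0 1) ab.
move: e0 e1; rewrite /= !mxE /= hc => /(mulfI rn) e0 /(mulfI rn) e1.
have [k kE] := sin_eq_cos_eq e0 e1.
have p0 : 0 < 2 * pi :> R by rewrite mulr_gt0// pi_gt0.
have k1 : k%:~R < 1 :> R by rewrite -(ltr_pM2r p0); lra.
have k2 : -1 < k%:~R :> R by rewrite -(ltr_pM2r p0); lra.
have k0 : k = 0.
  move: k1 k2; rewrite -[1]/(1%:~R) -mulrNz !ltr_int => k1 k2.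
  by lia.
by rewrite kE k0 mul0r addr0.
Qed.

Lemma winds_shift (F : R -> R) d (k : int) a :
  (forall a, F (a + 2 * pi) = F a + d%:~R * (2 * pi)) ->
  F (a + k%:~R * (2 * pi)) = F a + (d * k)%:~R * (2 * pi).
Proof.
move=> FE; have nat_shift (n : nat) b : F (b + n%:R * (2 * pi)) = F b + (d * n)%:~R * (2 * pi).
  elim: n b => [|n IH] b; first by rewrite mulr0 !mul0r !addr0.
  rewrite -natr1 mulrDl mul1r addrA FE IH.
  have -> : (d * n.+1 = d * n + d)%R by rewrite intS; ring.
  by rewrite intrD; ring.
case: k => n; first by rewrite nat_shift.
rewrite NegzE; have := nat_shift n.+1 (a + (- n.+1%:Z)%:~R * (2 * pi)).
rewrite -addrA -mulrDl mulrNz addNr mul0r addr0 => ->.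
by rewrite mulrN mulrNz; ring.
Qed.

Lemma winds_comp (f1 f2 : S2 -> S2) h k l d e :
  winds f1 h k d -> winds f2 k l e -> winds (f2 \o f1) h l (d * e).
Proof.
move=> [F1 [c1 E1 P1]] [F2 [c2 E2 P2]]; exists (F2 \o F1); split=> [|a|a] /=.
- exact: cts_comp.
- by rewrite E1 E2.
- by rewrite P1 (winds_shift _ _ P2) [(e * d)%R]mulrC.
Qed.

(* [F a - a] varies by [2 pi (d - 1)] around the circle. *)
Lemma circle_fixed_points (f : S2 -> S2) h (d : int) : 0 < h < 1 -> winds f h h d ->
  exists x : 'I_`|d - 1|%N -> S2, injective x /\
    forall j, f (x j) = x j /\ height (set_val (x j)) = h.
Proof.
move=> h01 [F [cF fF FE]].
have p0 : 0 < 2 * pi :> R by rewrite mulr_gt0// pi_gt0.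
have pn : 2 * pi != 0 :> R by rewrite gt_eqF.
(* The sign makes the net variation of [G] equal to [|d - 1|]. An angle where [G] is an integer
   gives a fixed point. *)
pose s : int := if 0 <= d - 1 then 1 else -1.
have s2 : (s%:~R * s%:~R = 1 :> R) by rewrite /s; case: ifP; rewrite ?mulr1// mulrNz mulrNN mulr1.
have sd : (s * (d - 1))%R = `|d - 1|%N.
  by rewrite /s; case: ifPn; [rewrite mul1r; lia|rewrite mulN1r; lia].
pose G a : R := s%:~R * (F a - a) / (2 * pi).
have cG : continuous G by rewrite /G; cts.
have G2 : G (2 * pi) = G 0 + `|d - 1|%N%:R.
  have := FE 0; rewrite add0r /G => ->.
  rewrite -[`|d - 1|%N%:R]/(`|d - 1|%N%:Z%:~R) -sd intrM intrB subr0.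
  by move: pn; move: (2 * pi) => T Tn; field.
(* These [|d - 1|] integers are at least [G 0] and strictly below [G (2 * pi)]; the strict
   inequality keeps the angle away from the right end, which represents the same point as 0. *)
have ex (j : 'I_`|d - 1|%N) : exists a, 0 <= a < 2 * pi /\ G a = (Num.ceil (G 0))%:~R + j%:R.
  have /andP[k1 k2] := ceil_itv (G 0); rewrite intrB in k1.
  have jm : j%:R + 1 <= `|d - 1|%N%:R :> R by rewrite natr1 ler_nat.
  have [||a] := @IVT R G 0 (2 * pi) ((Num.ceil (G 0))%:~R + j%:R) (ltW p0).
  - exact: continuous_subspaceT.
  - have j0 : 0 <= j%:R :> R by [].
    by rewrite G2 ge_min le_max; apply/andP; split; apply/orP; [left|right]; lra.
  rewrite in_itv/= => /andP[a0]; rewrite le_eqVlt => /orP[/eqP->|a1 aE]; last first.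
    by exists a; rewrite a0.
  by rewrite G2 => e; exfalso; lra.
have [a aP] := choice ex.
exists (fun j => sph (a j) h); split.
  move=> i j /sph_inj; have [ai Gi] := aP i; have [aj Gj] := aP j.
  move=> /(_ h01 ai aj) e; apply/val_inj/eqP => /=.
  by move: Gj; rewrite -e Gi => /addrI/eqP; rewrite eqr_nat.
move=> j; have [_ Gj] := aP j; split.
  rewrite fF; set k : int := Num.ceil (G 0) + j%:Z.
  have -> : F (a j) = a j + (s * k)%:~R * (2 * pi).
    have : G (a j) = k%:~R by rewrite Gj /k intrD.
    move=> /(congr1 (fun x => s%:~R * x * (2 * pi))); rewrite /G.
    by rewrite -mulrA divfK// mulrA s2 mul1r intrM => <-; rewrite addrC subrK.
  exact: sph_2pi.
by rewrite height_sph clamp_id//; case/andP: h01 => *; rewrite !ltW.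
Qed.

Lemma counting_ge (T : finType) (x : T -> S2) (A : set S2) : injective x ->
  (forall t, A (x t)) -> ((#|T|%:R)%:E <= (counting A : \bar R))%E.
Proof.
move=> xi xA; rewrite /counting; case: ifPn => [fA|_]; last exact: leey.
rewrite lee_fin ler_nat; move/asboolP: fA => fA.
rewrite cardE -(size_map x).
apply: uniq_leq_size; first by rewrite map_inj_uniq ?enum_uniq.
by move=> y /mapP[t _ ->]; rewrite in_fset_set// inE.
Qed.

End CircleDynamics.

(** * Fixed points and crossings of interval maps *)

Section IntervalDynamics.
Variable R : realType.
Implicit Types p : R -> R.

Lemma ivt_zero p a b : a <= b -> continuous p -> 0 <= p a -> p b <= 0 ->
  exists2 x, a <= x <= b & p x = 0.
Proof.
move=> ab cp pa pb; have [||x xab px] := @IVT R p a b 0 ab.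
- exact: continuous_subspaceT.
- by rewrite ge_min le_max pb pa orbT.
by exists x => //; move: xab; rewrite in_itv.
Qed.

Lemma reversing_fixed_point p u v : continuous p -> 0 <= u -> u < v -> v <= 1 ->
  p u = 1 -> p v = 0 -> exists2 x, u < x < v & p x = x.
Proof.
move=> cp u0 uv v1 pu pv; have [||||x] := @ivt_zero (fun x => p x - x) u v.
- exact: ltW.
- by cts.
- by rewrite pu; lra.
- by rewrite pv; lra.
move=> /andP[]; rewrite !le_eqVlt => /orP[/eqP<- _|ux]; first by rewrite pu; lra.
move=> /orP[/eqP->|xv] e; first by move: e; rewrite pv; lra.
by exists x; [rewrite ux|lra].
Qed.

Lemma first_crossing p a b v : continuous p -> a <= b -> p a <= v -> v <= p b ->
  exists c, [/\ a <= c, c <= b, p c = v & forall x, a <= x < c -> p x < v].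
Proof.
move=> cp ab pa pb; pose A := [set x | a <= x <= b /\ v <= p x].
have A0 : A !=set0 by exists b; split; rewrite ?ab ?lexx.
have lA : has_lbound A by exists a => x [/andP[]].
have iA : has_inf A by [].
set c := inf A.
have cA x : A x -> c <= x by move=> Ax; apply: ge_inf.
have ac : a <= c by apply: lb_le_inf => // x [/andP[]].
have cb : c <= b by apply: cA; split; rewrite ?ab ?lexx.
have below x : a <= x < c -> p x < v.
  move=> /andP[ax xc]; rewrite ltNge; apply/negP => vx.
  have : c <= x by apply: cA; split=> //; rewrite ax (le_trans (ltW xc)).
  by lra.
exists c; split=> //; apply/eqP; rewrite eq_le; apply/andP; split.
  rewrite leNgt; apply/negP => vc.
  have [e e0 H] := cts_gt_ball cp vc.
  have [ca|ca] := eqVneq c a; first by move: vc; rewrite ca; lra.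
  have lac : a < c by rewrite lt_neqAle eq_sym ca.
  pose x := Num.max a (c - e / 2).
  have xc : x < c by rewrite gt_max lac/=; lra.
  have xa : a <= x by rewrite le_max lexx.
  have xe : c - e / 2 <= x by rewrite le_max lexx orbT.
  have := H x; rewrite ltr_norml => /(_ _)/Wrap[|]; first by apply/andP; split; lra.
  have := below x; rewrite xa xc => /(_ isT); lra.
rewrite leNgt; apply/negP => vc.
have [e e0 H] := cts_lt_ball cp vc.
have [x Ax xe] := inf_adherent e0 iA; rewrite -/c in xe.
have cx := cA x Ax; have := H x; rewrite ltr_norml => /(_ _)/Wrap[|]; first by apply/andP; split; lra.
by case: Ax => _; lra.
Qed.

(** [v'] is the first time at which the value [v] is taken, and [u'] the last time before [v'] at
    which [u] is taken; the latter is a first crossing after reversing both time and sign. *)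
Lemma crossing p a b u v : continuous p -> a <= b -> p a <= u -> u < v -> v <= p b ->
  exists u' v', [/\ a <= u', u' < v', v' <= b, p u' = u /\ p v' = v
    & forall x, u' < x < v' -> u < p x < v].
Proof.
move=> cp ab pa uv pb.
have [|v' [av vb pv lv]] := first_crossing cp ab _ pb; first lra.
have [||||c [ac cb pc lc]] := @first_crossing (fun x => - p (- x)) (- v') (- a) (- u).
- by apply: ctsN; exact: (cts_comp cp (ctsN (@cts_id R))).
- by rewrite lerN2.
- by rewrite opprK pv lerN2 ltW.
- by rewrite opprK lerN2.
exists (- c), v'; have cv : - c < v'.
  rewrite lt_neqAle (_ : - c <= v'); last by lra.
  by rewrite andbT; apply/eqP => e; move: pc; rewrite e pv; lra.
split=> //; [lra|split=> //; lra|move=> x /andP[x1 x2]].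
apply/andP; split.
  by have := lc (- x); rewrite opprK => /(_ _)/Wrap[|]; [apply/andP; split; lra|lra].
by apply: lv; apply/andP; split; lra.
Qed.

Lemma iter_continuous (X : topologicalType) (p : X -> X) n : continuous p -> continuous (iter n p).
Proof.
move=> cp; elim: n => [|n IH]; first exact: cts_id.
exact: (cts_comp cp IH).
Qed.

End IntervalDynamics.

(** * Symbolic dynamics of a rising and a falling lap *)

Section Itineraries.
Variable R : realType.
Local Notation S2 := (set_type (@sphere R)).
Variables (f : S2 -> S2) (g : R -> R).
Hypothesis cg : continuous g.
Hypothesis fg : forall a h, height (set_val (f (sph a h))) = g h.
Local Notation lap := (lap g (fun s d => winds f s (g s) d)).

Lemma lap_fixed_power h d n : g h = h -> winds f h (g h) d -> winds (iter n f) h h (d ^+ n).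
Proof.
move=> gh fd; rewrite gh in fd; elim: n => [|n IH].
  by rewrite expr0; exists id; split=> // [|a]; [exact: cts_id|rewrite mul1r].
by rewrite exprSr; apply: winds_comp IH fd.
Qed.

Variables (aa bb : bool -> R) (dd : bool -> int).
Hypothesis laps : forall up, lap up (aa up) (bb up) (dd up).

Fixpoint visits (w : seq bool) (h : R) : Prop :=
  if w is up :: w' then aa up < h < bb up /\ visits w' (g h) else True.

Definition orientation (w : seq bool) : bool := foldr (fun up s => up == s) true w.
Definition total_degree (w : seq bool) : int := foldr (fun up e => dd up * e) 1 w.

(** A lap covers the whole of $[0,1]$, so an interval realizing the tail of the word is pulled back
    by a crossing inside the lap of the first letter. For a falling lap the crossing is taken for
    [- g], which exchanges the ends. *)
Lemma visits_interval w : exists u v, [/\ 0 <= u, u < v, v <= 1,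
    iter (size w) g u = (~~ orientation w)%:R /\ iter (size w) g v = (orientation w)%:R
  & forall x, u < x < v -> visits w x].
Proof.
elim: w => [|up w [u [v [u0 uv v1 [gu gv] H]]]] /=.
  by exists 0, 1; split.
have [[a0 ab b1 [ga gb] _] _] := laps up.
case: up ga gb a0 ab b1 => /= ga gb a0 ab b1.
  have [||u' [v' [au uv' vb [gu' gv'] H']]] := crossing cg (ltW ab) (u := u) (v := v) _ uv _.
  - by rewrite ga.
  - by rewrite gb.
  exists u', v'; split=> //; [lra|lra| |].
    by rewrite -[g (iter _ g u')]iterS -[g (iter _ g v')]iterS !iterSr gu' gv' gu gv; case: (orientation w).
  move=> x xuv; split; last by apply: H; exact: H'.
  by case/andP: xuv => *; apply/andP; split; lra.
have [u' [v' [au uv' vb [gu' gv'] H']]] : exists u' v', [/\ aa false <= u', u' < v',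
    v' <= bb false, - g u' = - v /\ - g v' = - u
    & forall x, u' < x < v' -> - v < - g x < - u].
  apply: (crossing (p := fun x => - g x)); [by cts|exact: ltW| |by rewrite ltrN2|].
  - by rewrite ga lerN2.
  - by rewrite gb lerN2.
have {}gu' : g u' = v by apply: oppr_inj.
have {}gv' : g v' = u by apply: oppr_inj.
exists u', v'; split=> //; [lra|lra| |].
  by rewrite -[g (iter _ g u')]iterS -[g (iter _ g v')]iterS !iterSr gu' gv' gu gv; case: (orientation w).
move=> x xuv; split.
  by case/andP: xuv => *; apply/andP; split; lra.
by apply: H; have := H' x xuv; rewrite !ltrN2 andbC.
Qed.

Lemma visits_fixed_point w : ~~ orientation w ->
  exists2 h, iter (size w) g h = h & 0 < h < 1 /\ visits w h.
Proof.
move=> ow; have [u [v [u0 uv v1 [gu gv] H]]] := visits_interval w.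
rewrite (negbTE ow) in gu gv.
have [|x xuv gx] := reversing_fixed_point _ u0 uv v1 gu gv; first exact: iter_continuous.
exists x => //; split; last exact: H.
by case/andP: xuv => *; apply/andP; split; lra.
Qed.

Lemma visits_winds w h : visits w h ->
  winds (iter (size w) f) h (iter (size w) g h) (total_degree w).
Proof.
elim: w h => [h _|up w IH h [hI vw]] /=.
  by exists id; split=> // [|a]; [exact: cts_id|rewrite mul1r].
have [_ D] := laps up; rewrite -!iterS iterSr.
have -> : iter (size w).+1 f = iter (size w) f \o f by apply/funext => x; rewrite iterSr.
exact: winds_comp (D _ hI) (IH _ vw).
Qed.

(** The two laps have disjoint interiors: if they met, an endpoint of one, where [g] is 0 or 1,
    would lie inside the other, or both would start at the same height with different values of
    [g]. *)
Lemma visits_inj w w' h : size w = size w' -> visits w h -> visits w' h -> w = w'.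
Proof.
have disj x : ~ ((aa true < x < bb true) /\ (aa false < x < bb false)).
  move=> [/andP[t1 t2] /andP[f1 f2]].
  have [[_ _ _ /= [gta gtb] ti] _] := laps true; have [[_ _ _ /= [gfa gfb] fi] _] := laps false.
  case: (ltgtP (aa true) (aa false)) => e.
  - have := ti (aa false); rewrite e gfa ltxx andbF => /(_ _)/Wrap[|//].
    by rewrite (lt_trans f1 t2).
  - have := fi (aa true); rewrite e gta ltxx => /(_ _)/Wrap[|//].
    by rewrite (lt_trans t1 f2).
  - by move: gta; rewrite e gfa => /eqP; rewrite oner_eq0.
elim: w w' h => [|up w IH] [|up' w'] h //= [sz] [h1 v1] [h2 v2].
rewrite (IH _ _ sz v1 v2); congr (_ :: _).
by case: up up' h1 h2 => -[] //= h1 h2; exfalso; apply: (disj h).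
Qed.

Lemma orientationE w : orientation w = ~~ odd (count negb w).
Proof. by elim: w => //= up w ->; rewrite oddD; case: up; case: (odd (count _ _)). Qed.

Lemma total_degreeE w : total_degree w =
  dd false ^+ count negb w * dd true ^+ count id w.
Proof.
by elim: w => [|[] w IH] /=; rewrite ?expr0 ?mulr1// IH ?add0n ?add1n exprS; ring.
Qed.

(* The first letter makes the number of falling laps odd; then [g ^ m.+1] reverses
   the interval of the itinerary, and the degree on the fixed latitude is nonpositive. *)
Lemma itinerary_fixed_points m : ~~ odd m -> dd false <= 0 ->
  exists x : m.-tuple bool -> S2, injective x /\ forall t, iter m.+1 f (x t) = x t.
Proof.
move=> om d0; pose w (t : m.-tuple bool) := odd (count negb t) :: t.
have ow t : ~~ orientation (w t).
  by rewrite orientationE negbK /w /= oddD; case: (odd (count _ _)).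
have sw t : size (w t) = m.+1 by rewrite /= size_tuple.
have dw t : total_degree (w t) <= 0.
  have := ow t; rewrite orientationE negbK => oc; rewrite total_degreeE.
  (* The length [m.+1] is odd and so is the number of falling letters; the degree of the rising lap
     thus enters with an even power. *)
  have ec : ~~ odd (count id (w t)).
    have /(congr1 odd) := count_predC negb (w t).
    rewrite sw oddD oc (@eq_count _ (predC negb) id); last by case.
    by rewrite [odd m.+1]/= om; case: (odd (count id _)).
  by rewrite mulr_le0_ge0 ?exprn_odd_le0 ?exprn_even_ge0.
have ex t : exists x : S2, iter m.+1 f x = x /\ exists2 h, height (set_val x) = h & visits (w t) h.
  have [h gh [h01 vh]] := visits_fixed_point (ow t).
  have := visits_winds vh; rewrite gh => wh.
  have [x [_ xP]] := circle_fixed_points h01 wh.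
  (* A nonpositive degree differs from 1, so there is at least one fixed point. *)
  have j : 'I_`|total_degree (w t) - 1|%N.
    by apply: (@Ordinal _ 0); have := dw t; lia.
  have [fx hx] := xP j; exists (x j); split; first by rewrite -(sw t).
  by exists h.
have [x xP] := choice ex; exists x; split; last by move=> t; have [] := xP t.
move=> t t' xt; have [_ [h hh vh]] := xP t; have [_ [h' hh' vh']] := xP t'.
have hE : h = h' by rewrite -hh -hh' xt.
rewrite -hE in vh'; have := visits_inj _ vh vh'; rewrite !sw => /(_ erefl) [_ e].
exact: val_inj.
Qed.

End Itineraries.

(** * Exponential growth along odd iterates *)

Section Growth.
Variable R : realType.

Lemma growth_ln2 (N : nat -> \bar R) :
  (forall m, ~~ odd m -> (((2 ^ m)%N%:R)%:E <= N m.+1)%E) ->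
  ((ln 2%R)%:E <= limn_esup (fun n : nat => (n%:R^-1)%:E * lne (N n)))%E.
Proof.
move=> HN; apply: le_ereal_inf_tmp => _ [A [M _ MA] <-].
apply/lee_addgt0Pr => e e0.
have l0 : 0 <= ln 2 :> R by rewrite ln_ge0// ler1n.
have [T TP] : exists T : nat, ln 2 / e < T%:R.
  by exists (Num.truncn (ln 2 / e)).+1; exact: truncnS_gt.
(* Even, past the start [M] of the tail, and so large that [ln 2 / m.+1 < e]; this is the loss from
   having $2^m$ points for the iterate of order [m.+1]. *)
pose m := (M + T).*2.
have mM : (M <= m.+1)%N by rewrite /m; lia.
have me : ln 2 / e < m.+1%:R :> R.
  by apply: (lt_le_trans TP); rewrite ler_nat /m; lia.
pose u n : \bar R := ((n%:R^-1)%:E * lne (N n))%E.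
have uS : (u m.+1 <= ereal_sup [set u x | x in A])%E.
  by apply: ereal_sup_ubound; exists m.+1 => //; apply: MA.
apply: (@le_trans _ _ (u m.+1 + e%:E)%E); last exact: leeD2r.
have om : ~~ odd m by rewrite /m odd_double.
have p2 : 0 < (2 ^ m)%N%:R :> R by rewrite ltr0n expn_gt0.
have hl : (((ln 2 : R) *+ m)%:E <= lne (N m.+1))%E.
  rewrite -lnXn// -natrX -lne_EFin//.
  rewrite lee_lne; first exact: HN.
  - by rewrite in_itv/= leey andbT lee_fin ltW.
  - by rewrite in_itv/= leey andbT; apply: le_trans (HN m om); rewrite lee_fin ltW.
have n0 : 0 < m.+1%:R :> R by rewrite ltr0n.
apply: (@le_trans _ _ ((m.+1%:R^-1)%:E * ((ln 2 : R) *+ m)%:E + e%:E)%E); last first.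
  by apply: leeD2r; apply: lee_wpmul2l => //; rewrite lee_fin invr_ge0 ltW.
rewrite -EFinM -EFinD lee_fin -[ln 2 *+ m]mulr_natr.
rewrite -(ler_pM2l n0) mulrDr mulrA divff ?gt_eqF// mul1r -natr1.
move: me; rewrite ltr_pdivrMr// -natr1 => me; lra.
Qed.

End Growth.

(** * From laps to fixed points of the iterates *)

Section MainTheorem.
Variable R : realType.
Local Notation S2 := (set_type (@sphere R)).

Lemma sph_clamp (a h : R) : sph a h = sph a (clamp h).
Proof. by apply: val_inj; apply/rowP => i; rewrite /= !mxE (clamp_id (clamp_itv h)). Qed.

(** The foliation hypothesis covers the heights strictly between 0 and 1; after clamping, the
    remaining heights are those of the poles, where [sph] does not depend on the angle. *)
Lemma latitude_height (f : S2 -> S2) : preserves_latitude_foliation f ->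
  forall a h, height (set_val (f (sph a h))) = height (set_val (f (sph 0 h))).
Proof.
move=> Hf a h; rewrite (sph_clamp a) (sph_clamp 0).
have := clamp_itv h; move: (clamp h) => k /andP[]; rewrite le_eqVlt => /orP[/eqP<- _|k0].
  by rewrite (sph_south a 0).
rewrite le_eqVlt => /orP[/eqP->|k1]; first by rewrite (sph_north a 0).
have lat b : latitude k (sph b k) by rewrite /latitude/= height_sph clamp_id// !ltW.
have img b : (f @` latitude k) (f (sph b k)) by exists (sph b k).
have [|[l _ sub]|E|E] := Hf k; first by rewrite k0.
- by rewrite (sub _ (img a)) (sub _ (img 0)).
- by have := img a; have := img 0; rewrite E /= => -> ->.
- by have := img a; have := img 0; rewrite E /= => -> ->.
Qed.

(** On a rising lap the graph must pass from below the diagonal to above it. Near [a] it is below by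
    continuity if [a > 0]; if [a = 0], the pole is fixed, and a graph on or above the diagonal near
    it would force [d] to be 1 or -1 by [pole_winding]. The end [b] is symmetric. *)
Lemma lap_fixed_height (f : S2 -> S2) (g : R -> R) up a b d :
  C1_sphere_map f -> continuous g ->
  (forall a h, height (set_val (f (sph a h))) = g h) ->
  lap g (fun s d => winds f s (g s) d) up a b d -> d <> 1 -> d <> -1 ->
  exists2 h, a < h < b & g h = h.
Proof.
move=> f1 cg fg [[a0 ab b1 [ga gb] gi] wi] d1 dN1.
case: up ga gb => /= ga gb; last exact: reversing_fixed_point.
pose m := (a + b) / 2.
have am : a < m by rewrite /m; lra.
have mb : m < b by rewrite /m; lra.
have [x /andP[ax xm] gx] : exists2 x, a < x < m & g x < x.
  have [a00|a00] := ltP 0 a.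
    have [||e e0 H] := @cts_lt_ball R (fun x => g x - x) a 0; [by cts|by rewrite ga; lra|].
    pose x := a + Num.min e (m - a) / 2.
    have h0 : 0 < Num.min e (m - a) by rewrite lt_min e0 subr_gt0.
    have h1 : Num.min e (m - a) <= e by rewrite ge_min lexx.
    have h2 : Num.min e (m - a) <= m - a by rewrite ge_min lexx orbT.
    exists x; first by rewrite /x; apply/andP; split; lra.
    rewrite -subr_lt0; apply: H; rewrite /x ltr_norml; apply/andP; split; lra.
  have aE : a = 0 by lra.
  apply: contrapT => nx; have [] // : d = 1 \/ d = -1.
  have gp : g (pole_height false 0) = pole_height false 0 by rewrite /pole_height -[in LHS]aE ga.
  apply: (@pole_winding R f g false f1 fg gp d m cg); rewrite /pole_height; first lra.
  move=> k kI; have kab : a < k < b.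
    by move: kI => /andP[k0 km]; apply/andP; split; lra.
  split; [exact: gi| |exact: wi].
  by rewrite leNgt; apply/negP => gk; apply: nx; exists k; rewrite ?aE.
have [y /andP[my yb] gy] : exists2 y, m < y < b & y < g y.
  have [b00|b00] := ltP b 1.
    have [||e e0 H] := @cts_gt_ball R (fun x => g x - x) b 0; [by cts|by rewrite gb; lra|].
    pose z := b - Num.min e (b - m) / 2.
    have h0 : 0 < Num.min e (b - m) by rewrite lt_min e0 subr_gt0.
    have h1 : Num.min e (b - m) <= e by rewrite ge_min lexx.
    have h2 : Num.min e (b - m) <= b - m by rewrite ge_min lexx orbT.
    exists z; first by rewrite /z; apply/andP; split; lra.
    rewrite -subr_gt0; apply: H; rewrite /z ltr_norml; apply/andP; split; lra.
  have bE : b = 1 by lra.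
  apply: contrapT => nx; have [] // : d = 1 \/ d = -1.
  have gp : g (pole_height true 0) = pole_height true 0 by rewrite /pole_height subr0 -[in LHS]bE gb.
  apply: (@pole_winding R f g true f1 fg gp d (1 - m) cg); rewrite /pole_height; first lra.
  move=> k /andP[k0 km]; have kab : a < 1 - k < b by apply/andP; split; lra.
  split; [exact: gi| |exact: wi].
  rewrite leNgt; apply/negP => gk; apply: nx; exists (1 - k); last by lra.
  by apply/andP; split; lra.
have [||||h] := @ivt_zero R (fun x => - (g x - x)) x y.
- lra.
- by cts.
- by rewrite oppr_ge0; lra.
- by rewrite oppr_le0; lra.
by move=> /andP[xh hy] e; exists h; [apply/andP; split; lra|lra].
Qed.

(** [|d ^ m.+1 - 1|] is at least [2 ^ m.+1 - 1], hence at least [2 ^ m]; only [2 ^ m] points are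
    kept, to match the number of itineraries. *)
Lemma fixed_points_power (f : S2 -> S2) h d m : 0 < h < 1 -> winds f h h (d ^+ m.+1) ->
  (2 <= `|d|)%N -> exists x : 'I_(2 ^ m)%N -> S2, injective x /\ forall j, f (x j) = x j.
Proof.
move=> h01 /(circle_fixed_points h01)[x [xi xP]] d2.
have le : (2 ^ m <= `|(d ^+ m.+1 - 1)%R|)%N.
  have : (2 ^ m.+1 <= `|(d ^+ m.+1)%R|)%N by rewrite abszX leq_exp2r.
  have : (0 < 2 ^ m)%N by rewrite expn_gt0.
  rewrite expnS; move: (2 ^ m)%N (d ^+ m.+1) => p q; lia.
exists (fun j => x (widen_ord le j)); split; last by move=> j; have [] := xP (widen_ord le j).
by move=> i j /xi /(congr1 val)/= e; exact: val_inj.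
Qed.

End MainTheorem.

Theorem corollary2 (R : realType)
    (f : continuousType (set_type (@sphere R)) (set_type (@sphere R)))
    (f_C1 : C1_sphere_map f)
    (f_latitude : preserves_latitude_foliation f)
    (f_degree : global_degree f 2%:Z) :
  ((ln 2%R)%:E <=
     limn_esup (fun n : nat => (n%:R^-1)%:E * lne (nb_fixed_points f n)))%E.
Proof.
apply: growth_ln2 => m om.
(* Defined on the whole line, since [sph] clamps the height. *)
pose g h := height (set_val (f (sph 0 h))).
have fg a h : height (set_val (f (sph a h))) = g h by exact: latitude_height.
have cg : continuous g.
  apply: (@cts_coord R R 1 3 (fun h => set_val (f (sph 0 h))) 0 ord_max).
  apply: (cts_comp (@set_val_continuous _ _)); apply: (cts_comp (@cts_fun _ _ f)).
  by apply: (cts_comp (@sph_continuous R) (g := fun h => (0, h))); cts.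
have g01 h : 0 <= g h <= 1 by exact: height_itv.
have [m1 [m2 /= [H1 H2 H3 [H4 H5] [H6 H7]]]] := latitude_degree fg.
have c2 := euler_degree f_degree.
rewrite c2 in H6 H7.
have Dex s : 0 < g s < 1 -> exists d, winds f s (g s) d.
  by move=> gs; apply: winds_exists => //; exact: cts_fun.
(* Serves rising and falling laps alike: [|d| >= 2] excludes 1 and -1, so the lap contains a
   latitude mapped to itself with winding number [d]. *)
have power up a b d : lap g (fun s d => winds f s (g s) d) up a b d -> (2 <= `|d|)%N ->
    (((2 ^ m)%N%:R)%:E <= nb_fixed_points f m.+1)%E.
  move=> l d2; have [h hab gh] : exists2 h, a < h < b & g h = h.
    by apply: (lap_fixed_height f_C1 cg fg l) => dE; move: d2; rewrite dE.
  have [[a0 _ b1 _ _] wi] := l; have h01 : 0 < h < 1.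
    by case/andP: hab => *; apply/andP; split; lra.
  have [x [xi xP]] := fixed_points_power h01 (lap_fixed_power m.+1 gh (wi _ hab)) d2.
  by have := counting_ge (A := [set y | iter m.+1 f y = y]) xi xP; rewrite card_ord.
have [] := lap_trichotomy cg g01 Dex H1 H2 H3 H4 H5 H6 H7 erefl.
- by move=> [a [b [d [l d2]]]]; apply: (power _ _ _ _ l); lia.
- by move=> [a [b [d [l d2]]]]; apply: (power _ _ _ _ l); lia.
move=> [[a [b [d [l d0]]]] [a' [b' [d' l']]]].
have [x [xi xP]] := @itinerary_fixed_points R f g cg (fun up => if up then a' else a)
  (fun up => if up then b' else b) (fun up => if up then d' else d)
  (fun up => if up is true then l' else l) m om d0.
by have := counting_ge (A := [set y | iter m.+1 f y = y]) xi xP; rewrite card_tuple card_bool.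
Qed.
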